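(* Suppose Hypothesis (R) (stated in the context) holds. Let $\mu_1$ and $\mu_2$ be two empirical measures on $\mathbb R$ (i.e. measures of the form $\frac1N\sum_{i=1}^N\delta_{x_i}$ with $N\ge1$, $x_i\in\mathbb R$). Then for each $t\in[0,T]$, $$|\mathcal V(t,\mu_1)-\mathcal V(t,\mu_2)|\le \tilde C_{71}\,\mathcal W_2(\mu_1,\mu_2)+\tilde C_{72}\Big[\mathcal W_2^2(\mu_1,\mu_2)+\Big(\int_{\mathbb R}y^2\mu_1(dy)+\int_{\mathbb R}y^2\mu_2(dy)\Big)\mathcal W_2(\mu_1,\mu_2)\Big],$$ where $$\tilde C_{71}=\tilde C_2\,(C^L_{11}+C^U_{11}+C^L_{10}+C^U_{10}),\qquad \tilde C_{72}=\frac{\tilde C_2\,(C^L_{11}+C^U_{11})}{2}.$$ As a result, $\mathcal V(t,\cdot)$ can be uniquely extended to a locally Lipschitz function on $(\mathcal P_2(\mathbb R),\mathcal W_2)$.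
   Context: **Setting.** $T,\lambda>0$, $\sigma\in\mathbb R$, $\Theta=\mathbb R$. $\mathcal P_2(\mathbb R)$ is the set of Borel probability measures on $\mathbb R$ with finite second moment, $\mathcal W_2$ the 2-Wasserstein distance. $\partial_\mu$ denotes the intrinsic (Wasserstein/Lions) derivative; the extra variable it creates is written after the measure variable. Data: $f:[0,T]\times\Theta\times\mathbb R\times\mathcal P_2(\mathbb R)\to\mathbb R$ and $L,U:\mathbb R\to\mathbb R$. **Standing assumption.** (1) $(t,\theta)\mapsto f(t,\theta,0,\delta_0)$ is continuous; (2) $\partial_tf$ is bounded and $f$ has bounded derivatives with respect to $(\theta,x,\mu)$ up to second order; (3) for $\varphi\in\{L,U\}$: $\varphi\ge0$, $|\varphi'(x)|\le C^\varphi_{11}|x|+C^\varphi_{10}$, $|\varphi''(x)|\le C^\varphi_{20}$ for constants $C^\varphi_{11},C^\varphi_{10},C^\varphi_{20}$; (4) there are $\alpha\in(0,2)$, $C_g>0$ with $|L(x)|+|U(x)|\le C_g(|x|^{2-\alpha}+1)$. **Control problem.** For $s\in[0,T]$, $\mathcal U^{ad}_s$ is the set of (weak) admissible controls: a complete probability space with independent real Brownian motions $W^0,W^1,W^2,\dots$ started at time $s$, and a $\Theta$-valued process $\theta$ on $[s,T]$ adapted to the augmented filtration they generate, such that for every $N$ the system below has a (pathwise unique) solution. For $x\in\mathbb R^N$, $$dX^{\theta,i}_N(t)=f\Big(t,\theta(t),X^{\theta,i}_N(t),\tfrac1N\sum_{j=1}^N\delta_{X^{\theta,j}_N(t)}\Big)dt+\sigma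 dW^0(t),\quad X^{\theta,i}_N(s)=x_i,$$ $$J_N(s,\theta,x)=\mathbb E\Big[\tfrac1N\sum_i\int_s^TL(X^{\theta,i}_N(t))dt+\tfrac1N\sum_iU(X^{\theta,i}_N(T))+\tfrac\lambda2\int_s^T|\theta(t)|^2dt\Big],$$ $$V_N(s,x)=\inf_{\theta\in\mathcal U^{ad}_s}J_N(s,\theta,x).$$ For $\varepsilon>0$, $V^\varepsilon_N$ is defined in the same way with the dynamics of the $i$-th particle perturbed by the additional term $\varepsilon\,dW^i(t)$. **Lift.** For $\mu^N=\frac1N\sum_{i=1}^N\delta_{x_i}$ set $\mathcal V(t,\mu^N):=V_N(t,x_1,\dots,x_N)$ (this is well defined: it depends only on the measure $\mu^N$). **The constant $\tilde C_2$.** $\tilde C_2=\tilde C_2(f,\lambda^{-1/2},T)$ denotes a constant, independent of $N$ and $\varepsilon$, such that for all $N\ge1$, $\varepsilon>0$, $1\le i\le N$, $(t,x)\in[0,T]\times\mathbb R^N$: $$|\partial_{x_i}V^\varepsilon_N(t,x)|\le\frac{\tilde C_2(C^L_{11}+C^U_{11})}N\Big(1+|x_i|^2+\frac1N\sum_{j=1}^N|x_j|^2\Big)^{1/2}+\frac{\tilde C_2(C^L_{10}+C^U_{10})}N .$$ **Hypothesis (R)** (with parameters $\Gamma_1,\Gamma_2\in\mathbb R$). For $\Gamma\in\mathbb R$ put $G_{N,i}(x,\Gamma)=\frac{\Gamma(C^L_{11}+C^U_{11})}N\big(1+|x_i|^2+\frac1N\sum_j|x_j|^2\big)^{1/2}+\frac{\Gamma(C^L_{10}+C^U_{10})}N$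 and $\mathcal A_{N,\Gamma_1,\Gamma_2}=\{(x,p)\in\mathbb R^N\times\mathbb R^N:\ -G_{N,i}(x,\Gamma_1)\le p_i\le G_{N,i}(x,\Gamma_2),\ 1\le i\le N\}$. Hypothesis (R) requires: (i) there is $\lambda_0>0$ such that for all $N\ge1$, $t\in[0,T]$, $\theta\in\Theta$, $(x,p)\in\mathcal A_{N,\Gamma_1,\Gamma_2}$: $\lambda_0+\sum_{i=1}^N\partial^2_{\theta\theta}f(t,\theta,x_i,\frac1N\sum_j\delta_{x_j})p_i\ge0$; (ii) there is $C^Q>0$ such that for the same $(N,t,\theta,x,p)$, all $i$, and all $\varphi\in\{|\partial^2_{x\theta}f|,|\partial^2_{xx}f|\}$, $\phi\in\{|\partial^2_{x\mu}f|,|\partial^2_{\theta\mu}f|\}$: $C^Q>\varphi(t,\theta,x_i,\frac1N\sum_j\delta_{x_j})Np_i+\phi(t,\theta,x_i,\frac1N\sum_j\delta_{x_j},x_i)Np_i$; (iii) $\lambda>\lambda_0$. In this statement Hypothesis (R) is assumed for some parameters $\Gamma_1,\Gamma_2$. *)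

(* Defs.v *)
From HB Require Import structures.
From mathcomp Require Import all_boot all_order all_algebra.
From mathcomp Require Import all_classical all_reals all_analysis.
From mathcomp Require Import measurable_realfun giry.
Set Implicit Arguments.
Unset Strict Implicit.
Unset Printing Implicit Defensive.
Import Order.TTheory GRing.Theory Num.Theory.
Import numFieldNormedType.Exports.
Local Open Scope classical_set_scope.
Local Open Scope ring_scope.

Section wasserstein_space.
Context (R : realType).

(* [probability] is a function on all sets, constrained only on measurable
   ones; two elements of [P2] are the same measure when they agree on Borel
   sets ([_ ≡μ _]), which is weaker than Leibniz equality. *)
Record P2 := MkP2 {
  p2_measure :> probability (measurableTypeR R) R;
  p2_finite_moment : (\int[p2_measure]_y (y ^+ 2)%:E < +oo)%E }.

Definition moment2 (mu : P2) : R := fine (\int[mu]_y (y ^+ 2)%:E).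

Definition coupling (mu nu : P2)
    (pi : probability (measurableTypeR R * measurableTypeR R)%type R) : Prop :=
  forall A : set (measurableTypeR R), measurable A ->
    pi (A `*` setT) = mu A /\ pi (setT `*` A) = nu A.

Definition W2 (mu nu : P2) : R :=
  Num.sqrt (fine (ereal_inf
    [set (\int[pi]_z ((z.1 - z.2) ^+ 2)%:E)%E | pi in coupling mu nu])).

Lemma dirac_finite_moment (a : R) :
  (\int[\d_(a : measurableTypeR R)]_y (y ^+ 2)%:E < +oo)%E.
Proof.
rewrite integral_dirac//; first by rewrite diracT mul1e ltry.
by apply/measurable_EFinP; apply: measurable_funX.
Qed.

Definition P2_dirac (a : R) : P2 := MkP2 (dirac_finite_moment a).

Section empirical.
Variables (n : nat) (x : 'rV[R]_n.+1).

Definition empirical_fun (A : set (measurableTypeR R)) : \bar R :=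
  ((n.+1%:R^-1)%:E * \sum_(i < n.+1) \d_(x ord0 i) A)%E.

Let scaled_sum : {measure set (measurableTypeR R) -> \bar R} :=
  mscale (n.+1%:R^-1)%:nng
    (msum (fun k : nat => \d_(x ord0 (inord k) : measurableTypeR R)) n.+1).

Let empirical_funE : empirical_fun = scaled_sum.
Proof.
apply/funext => A; rewrite /empirical_fun /= /mscale /msum /=; congr (_ * _)%E.
by apply: eq_bigr => i _; rewrite inord_val.
Qed.

Let empirical0 : empirical_fun set0 = 0%E.
Proof. by rewrite empirical_funE measure0. Qed.

Let empirical_ge0 A : (0 <= empirical_fun A)%E.
Proof. by rewrite empirical_funE measure_ge0. Qed.

Let empirical_sigma_additive : semi_sigma_additive empirical_fun.
Proof. rewrite empirical_funE; exact: measure_semi_sigma_additive. Qed.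

HB.instance Definition _ := isMeasure.Build _ _ _ empirical_fun
  empirical0 empirical_ge0 empirical_sigma_additive.

Let empirical_setT : empirical_fun setT = 1%E.
Proof.
rewrite /empirical_fun (eq_bigr (fun=> 1%:E)); last first.
  by move=> i _; rewrite diracT.
by rewrite sumEFin sumr_const card_ord -EFinM mulVf// pnatr_eq0.
Qed.

HB.instance Definition _ :=
  Measure_isProbability.Build _ _ _ empirical_fun empirical_setT.

Lemma empirical_finite_moment :
  (\int[empirical_fun]_y (y ^+ 2)%:E < +oo)%E.
Proof.
have mf : measurable_fun [set: measurableTypeR R]
    (fun y : measurableTypeR R => (y ^+ 2)%:E).
  by apply/measurable_EFinP; apply: measurable_funX.
have f0 y : [set: measurableTypeR R] y -> (0 <= (y ^+ 2)%:E :> \bar R)%E.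
  by rewrite lee_fin sqr_ge0.
rewrite (eq_measure_integral scaled_sum); last first.
  by move=> A _ _; rewrite -empirical_funE.
rewrite ge0_integral_mscale//= ge0_integral_measure_sum//.
rewrite lte_mul_pinfty// ?lee_fin// lte_sum_pinfty// => i _.
by rewrite integral_dirac// diracT mul1e ltry.
Qed.

Definition empirical : P2 := MkP2 empirical_finite_moment.

End empirical.

Definition is_empirical (mu : P2) : Prop :=
  exists n (x : 'rV[R]_n.+1), mu ≡μ empirical x.

Definition locally_lipschitz (F : P2 -> R) : Prop :=
  forall mu, exists2 r, 0 < r & exists K, forall nu1 nu2,
    W2 mu nu1 < r -> W2 mu nu2 < r -> `|F nu1 - F nu2| <= K * W2 nu1 nu2.

End wasserstein_space.

Section lions_derivative.
Context (R : realType).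

Definition has_law d (Om : measurableType d) (P : probability Om R)
    (Y : Om -> R) (m : set (measurableTypeR R) -> \bar R) : Prop :=
  forall A : set (measurableTypeR R), measurable A -> P (Y @^-1` A) = m A.

(* [g] represents the gradient at [mu]: the lift [xi |-> F (law of xi)] has
   Frechet derivative [g xi] in L^2 at every [xi] of law [mu].  When [mu] and
   [nu] are in [P2], [eta] is automatically square integrable.  [g] is only
   determined mu-almost everywhere. *)
Definition lions_derivative (F : P2 R -> R) (mu : P2 R) (g : R -> R) : Prop :=
  [/\ measurable_fun setT g,
      (\int[mu]_y (g y ^+ 2)%:E < +oo)%E &
      forall e, 0 < e -> exists2 del, 0 < del &
        forall d (Om : measurableType d) (P : probability Om R)
          (xi eta : {RV P >-> R}) (nu : P2 R),
        has_law P xi mu -> has_law P (fun w => xi w + eta w) nu ->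
        let norm_eta := fine ('N[P]_2%:E[EFin \o eta]) in
        norm_eta <= del ->
        `|F nu - F mu - fine ('E_P[fun w => g (xi w) * eta w])|
          <= e * norm_eta ].

Implicit Types (g : R -> R -> P2 R -> R) (th x : R) (mu : P2 R).

Definition d_theta g th x mu : R := (fun a => g a x mu)^`()%classic th.
Definition d_x g th x mu : R := (fun a => g th a mu)^`()%classic x.

Definition bounded_derivatives (C : R) g (g_mu : R -> R -> P2 R -> R -> R) :=
  forall th x mu,
    [/\ derivable (fun a => g a x mu) th 1 /\ `|d_theta g th x mu| <= C,
        derivable (fun a => g th a mu) x 1 /\ `|d_x g th x mu| <= C &
        lions_derivative (g th x) mu (g_mu th x mu) /\
          forall y, `|g_mu th x mu y| <= C ].

Definition is_derive_within (A : set R) (h : R -> R) (t l : R) : Prop :=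
  (fun s => (h s - h t) / (s - t)) @ within A t^' --> l.

End lions_derivative.

Section standing_assumption.
Context (R : realType).
Variables (T : R) (f : R -> R -> R -> P2 R -> R).
(* A version [f_mu t th x mu y] of the intrinsic derivative; the second-order
   derivatives involving [mu] are read off it with [y] fixed, so that nothing
   is asked of its dependence on [y] beyond measurability and boundedness. *)
Variable f_mu : R -> R -> R -> P2 R -> R -> R.

Record drift_assumption : Prop := {
  drift_cont : {within `[0, T] `*` setT,
    continuous (fun p : R * R => f p.1 p.2 0 (P2_dirac 0))};
  drift_dt : exists C, forall t th x mu, t \in `[0, T] ->
    exists2 l, is_derive_within `[0, T] (fun s => f s th x mu) t l & `|l| <= C;
  drift_d1 : exists C, forall t, t \in `[0, T] ->
    bounded_derivatives C (f t) (f_mu t);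
  drift_d2_theta : exists C, forall t, t \in `[0, T] ->
    exists h, bounded_derivatives C (d_theta (f t)) h;
  drift_d2_x : exists C, forall t, t \in `[0, T] ->
    exists h, bounded_derivatives C (d_x (f t)) h;
  drift_d2_mu : exists C, forall t y, t \in `[0, T] ->
    exists h, bounded_derivatives C (fun th x mu => f_mu t th x mu y) h }.

Record cost_assumption (phi : R -> R) (C11 C10 C20 : R) : Prop := {
  cost_ge0 : forall x, 0 <= phi x;
  cost_derivable : forall x, derivable phi x 1;
  cost_derivable2 : forall x, derivable phi^`()%classic x 1;
  cost_d1 : forall x, `|phi^`()%classic x| <= C11 * `|x| + C10;
  cost_d2 : forall x, `|phi^`(2)%classic x| <= C20 }.

Definition subquadratic (L U : R -> R) : Prop :=
  exists alpha Cg, [/\ 0 < alpha < 2, 0 < Cg &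
    forall x, `|L x| + `|U x| <= Cg * (`|x| `^ (2 - alpha) + 1)].

End standing_assumption.

Section brownian_motion.
Context (R : realType) d (Om : measurableType d) (P : probability Om R).

Definition generated (I : Type) (D : set I) (Y : I -> Om -> R) : set (set Om) :=
  \bigcup_(i in D) preimage_set_system setT (Y i)
    (@measurable _ (measurableTypeR R)).

Record brownian (s : R) (B : R -> Om -> R) : Prop := {
  brownian_meas : forall t, s <= t -> measurable_fun setT (B t);
  brownian_start : {ae P, forall w, B s w = 0};
  brownian_cont : {ae P, forall w, {within `[s, +oo[, continuous (B ^~ w)}};
  brownian_normal : forall r t, s <= r < t ->
    has_law P (fun w => B t w - B r w) (normal_prob 0 (Num.sqrt (t - r)));
  brownian_indep : forall r t, s <= r < t ->
    forall (A : set Om) (D : set (measurableTypeR R)),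
    <<s generated `[s, r] B >> A -> measurable D ->
    (P (A `&` (fun w => B t w - B r w)%R @^-1` D) =
     P A * P ((fun w => B t w - B r w)%R @^-1` D))%E }.

Definition independent_family (G : nat -> set (set Om)) : Prop :=
  forall (J : seq nat) (A : nat -> set Om), uniq J ->
    (forall i, i \in J -> G i (A i)) ->
    (P (\bigcap_(i in [set` J]) A i) = \prod_(i <- J) P (A i))%E.

Definition augmented_filtration (W : nat -> R -> Om -> R) (s t : R) :=
  <<s generated (setT `*` `[s, t]) (fun ir : nat * R => W ir.1 ir.2)
      `|` P.-negligible >>.

Definition adapted (W : nat -> R -> Om -> R) (s T : R) (Y : R -> Om -> R) :=
  forall t, s <= t <= T -> forall B : set (measurableTypeR R), measurable B ->
    augmented_filtration W s t (Y t @^-1` B).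

End brownian_motion.

Section control_problem.
Context (R : realType).
Variables (T lambda sigma : R) (f : R -> R -> R -> P2 R -> R) (L U : R -> R).

(* Since the noise is additive, the SDE is an integral equation that involves
   no stochastic integral.  [eps = 0] is the unperturbed system; particle
   [i < n.+1] carries the individual noise [W i.+1]. *)
Record solution d (Om : measurableType d) (P : probability Om R)
    (W : nat -> R -> Om -> R) (theta : R -> Om -> R) (eps s : R)
    n (x : 'rV[R]_n.+1) (X : R -> Om -> 'rV[R]_n.+1) : Prop := {
  solution_adapted : forall i,
    adapted P W s T (fun t w => X t w ord0 i);
  solution_cont : {ae P, forall w, forall i,
    {within `[s, T], continuous (fun t => X t w ord0 i)}};
  solution_integrable : {ae P, forall w, forall i,
    lebesgue_measure.-integrable `[s, T]
      (fun r => (f r (theta r w) (X r w ord0 i) (empirical (X r w)))%:E)};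
  solution_eq : {ae P, forall w, forall i t, s <= t <= T ->
    X t w ord0 i = x ord0 i
      + (\int[lebesgue_measure]_(r in `[s, t])
           f r (theta r w) (X r w ord0 i) (empirical (X r w)))%R
      + sigma * (W 0 t w - W 0 s w) + eps * (W i.+1 t w - W i.+1 s w)} }.

(* The joint measurability of [theta] gives a meaning to its time integrals. *)
Record admissible d (Om : measurableType d) (P : probability Om R)
    (W : nat -> R -> Om -> R) (theta : R -> Om -> R) (eps s : R) : Prop := {
  admissible_complete : measure_is_complete P;
  admissible_brownian : forall i, brownian P s (W i);
  admissible_independent :
    independent_family P (fun i => <<s generated `[s, +oo[ (W i) >>);
  admissible_measurable : measurable_fun (`[s, T] `*` setT)
    (fun p : measurableTypeR R * Om => theta p.1 p.2);
  admissible_adapted : adapted P W s T theta;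
  admissible_exists : forall n (x : 'rV[R]_n.+1),
    exists X, solution P W theta eps s x X;
  admissible_unique : forall n (x : 'rV[R]_n.+1) X Y,
    solution P W theta eps s x X -> solution P W theta eps s x Y ->
    {ae P, forall w, forall t, s <= t <= T -> X t w = Y t w} }.

Definition total_cost d (Om : measurableType d) (P : probability Om R)
    (theta : R -> Om -> R) (s : R) n (X : R -> Om -> 'rV[R]_n.+1) : \bar R :=
  (\int[P]_w
     ((n.+1%:R^-1)%:E *
        \sum_(i < n.+1) \int[lebesgue_measure]_(t in `[s, T])
          (L (X t w ord0 i))%:E
      + (n.+1%:R^-1)%:E * \sum_(i < n.+1) (U (X T w ord0 i))%:E
      + (lambda / 2)%:E *
          \int[lebesgue_measure]_(t in `[s, T]) (`|theta t w| ^+ 2)%:E))%E.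

(* [fine] is harmless: the costs are nonnegative and the control 0 has finite
   cost. *)
Definition value (eps s : R) n (x : 'rV[R]_n.+1) : R :=
  fine (ereal_inf [set c | exists d (Om : measurableType d)
    (P : probability Om R) (W : nat -> R -> Om -> R) (theta : R -> Om -> R) X,
    [/\ admissible P W theta eps s, solution P W theta eps s x X &
        c = total_cost P theta s X]]).

(* Junk value off the empirical measures. *)
Definition lifted_value (t : R) (mu : P2 R) : R :=
  xget 0 [set v | exists n (x : 'rV[R]_n.+1),
    mu ≡μ empirical x /\ v = value 0 t x].

End control_problem.

Section hypothesis_R.
Context (R : realType).
Variables (T lambda sigma : R) (f : R -> R -> R -> P2 R -> R).
Variable f_mu : R -> R -> R -> P2 R -> R -> R.
Variables (L U : R -> R) (CL11 CL10 CU11 CU10 : R).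

Definition G_bound n (i : 'I_n.+1) (x : 'rV[R]_n.+1) (Gamma : R) : R :=
  Gamma * (CL11 + CU11) / n.+1%:R *
    Num.sqrt (1 + `|x ord0 i| ^+ 2
              + n.+1%:R^-1 * \sum_(j < n.+1) `|x ord0 j| ^+ 2)
  + Gamma * (CL10 + CU10) / n.+1%:R.

Definition A_set (Gamma1 Gamma2 : R) n : set ('rV[R]_n.+1 * 'rV[R]_n.+1) :=
  [set xp : 'rV[R]_n.+1 * 'rV[R]_n.+1 | forall i,
    - G_bound i xp.1 Gamma1 <= xp.2 ord0 i <= G_bound i xp.1 Gamma2].

Definition hypothesis_R (Gamma1 Gamma2 : R) : Prop :=
  (exists lambda0, [/\ 0 < lambda0, lambda0 < lambda &
    forall n t th (x p : 'rV[R]_n.+1),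
      t \in `[0, T] -> A_set Gamma1 Gamma2 (x, p) ->
      0 <= lambda0 + \sum_(i < n.+1)
        d_theta (d_theta (f t)) th (x ord0 i) (empirical x) * p ord0 i]) /\
  (exists2 CQ, 0 < CQ &
    forall n t th (x p : 'rV[R]_n.+1) (i : 'I_n.+1) (a b : R),
      t \in `[0, T] -> A_set Gamma1 Gamma2 (x, p) ->
      let mu := empirical x in
      let xi := x ord0 i in
      let Np := n.+1%:R * p ord0 i in
      (a = `|d_x (d_theta (f t)) th xi mu| \/
       a = `|d_x (d_x (f t)) th xi mu|) ->
      (b = `|d_x (fun th' x' mu' => f_mu t th' x' mu' xi) th xi mu| \/
       b = `|d_theta (fun th' x' mu' => f_mu t th' x' mu' xi) th xi mu|) ->
      a * Np + b * Np < CQ).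

(* The bound on the partial derivatives includes their existence. *)
Definition gradient_bound (C2 : R) : Prop :=
  forall n (i : 'I_n.+1) eps t (x : 'rV[R]_n.+1), 0 < eps -> t \in `[0, T] ->
    let Veps := fun y : 'rV[R]_n.+1 => value T lambda sigma f L U eps t y in
    let e_i : 'rV[R]_n.+1 := delta_mx ord0 i in
    derivable Veps x e_i /\ `|'D_e_i Veps x| <= G_bound i x C2.

End hypothesis_R.

(* Main.v *)
Require Import Defs.
From HB Require Import structures.
From mathcomp Require Import all_boot all_order all_algebra perm.
From mathcomp Require Import all_classical all_reals all_analysis.
From mathcomp Require Import measurable_realfun giry ring lra.
Set Implicit Arguments.
Unset Strict Implicit.
Unset Printing Implicit Defensive.
Import Order.TTheory GRing.Theory Num.Theory.
Import numFieldNormedType.Exports.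
Local Open Scope classical_set_scope.
Local Open Scope ring_scope.

(** Bounded Lions derivatives make [f] Lipschitz along empirical measures, so
    the additive-noise SDE is solved path by path by Picard iteration and a
    control admissible for one [eps] is admissible for all. By Gronwall,
    changing [eps] changes the cost by at most
    [|eps1 - eps2| * C * (1 + E int |theta|^2)], and the energy of the control
    is itself bounded by the cost: hence [V^eps -> V] as [eps -> 0].

    The gradient bound, the mean value theorem in each coordinate and
    Cauchy-Schwarz control [V^eps] on a short segment; letting [eps -> 0] and
    subdividing the segment from [x] to [y] ever more finely gives
    [|V x - V y| <= (A (1 + (m2 x + m2 y) / 2) + B) * (avg |x - y|^2)^(1/2)]
    with [A = C2 (CL11 + CU11)] and [B = C2 (CL10 + CU10)].

    The value is unchanged when every particle is duplicated the same number of
    times, so two empirical measures may be given by sorted vectors of equal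
    length. On the line the monotone coupling is optimal, so that the last
    factor is then [W2], and in general [W2] is the [L^2] distance of the
    quantile functions. This makes [W2] a pseudometric in which the empirical
    measures are dense, and McShane's formula extends [V]. *)

(** * Empirical measures and Lions derivatives *)

(** The gradient bound is available for positive [eps] only and gives partial derivatives without
    joint differentiability, so it cannot be integrated along a segment. Coordinates are changed one
    at a time instead; the path leaves the segment, and its second moment is controlled through a
    box containing both ends. Refining the subdivision shrinks the boxes, and averaging a second
    moment that interpolates linearly produces the 1/2 in [C72]. A control is adapted and jointly
    measurable, but not assumed progressively measurable. Fubini's theorem therefore does not make
    time integrals adapted; they are recovered as almost sure limits of averages of values at chosen
    sample times, which are adapted term by term. Admissibility concerns all numbers of particles at
    once. Hence one control drives a system and its duplicate, and pathwise uniqueness identifies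
    the two. In the limit [eps -> 0] the constants may depend on the number of particles; uniformity
    in that number comes from [C2] alone. *)

Section empirical_integral.
Context (R : realType).

Lemma ge0_integral_empirical n (x : 'rV[R]_n.+1) (h : measurableTypeR R -> \bar R) :
  measurable_fun setT h -> (forall y, 0 <= h y)%E ->
  (\int[empirical x]_y h y = (n.+1%:R^-1)%:E * \sum_(i < n.+1) h (x ord0 i))%E.
Proof.
move=> mh h0.
have k0 : 0 <= n.+1%:R^-1 :> R by rewrite invr_ge0.
pose m : {measure set (measurableTypeR R) -> \bar R} :=
  mscale (NngNum k0)
    (msum (fun k : nat => \d_(x ord0 (inord k) : measurableTypeR R)) n.+1).
rewrite (eq_measure_integral m); last first.
  move=> A _ _; rewrite /= /empirical_fun /mscale /msum /=; congr (_ * _)%E.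
  by apply: eq_bigr => i _; rewrite inord_val.
rewrite /m ge0_integral_mscale//= ge0_integral_measure_sum//.
congr (_ * _)%E; apply: eq_bigr => i _.
by rewrite integral_dirac// diracT mul1e inord_val.
Qed.

Lemma integral_empirical n (x : 'rV[R]_n.+1) (h : measurableTypeR R -> R) :
  measurable_fun setT h ->
  (\int[empirical x]_y (h y)%:E =
    (n.+1%:R^-1 * \sum_(i < n.+1) h (x ord0 i))%:E)%E.
Proof.
move=> mh; have mh' : measurable_fun setT (EFin \o h) by exact/measurable_EFinP.
rewrite integralE !ge0_integral_empirical//; try (by exact: measurable_funeneg);
  try (by exact: measurable_funepos).
under eq_bigr do rewrite (@funeposE _ _ (EFin \o h)) /= -EFin_max.
under [in X in (_ - X)%E]eq_bigr do rewrite funenegE -EFinN -EFin_max.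
rewrite !sumEFin -!EFinM -EFinB -mulrBr -sumrB; congr (_ * _)%:E.
by apply: eq_bigr => i _; rewrite -[RHS]/(h _) /Num.max/=; do 2 case: ifPn; lra.
Qed.

Lemma empirical_measureE n (x : 'rV[R]_n.+1) (A : set (measurableTypeR R)) :
  empirical x A = ((n.+1%:R^-1)%:E * \sum_(i < n.+1) \d_(x ord0 i) A)%E.
Proof. by []. Qed.

Lemma moment2_empirical n (x : 'rV[R]_n.+1) :
  moment2 (empirical x) = n.+1%:R^-1 * \sum_(i < n.+1) x ord0 i ^+ 2.
Proof. by rewrite /moment2 integral_empirical//; exact: measurable_funX. Qed.

(* The uniform law on {0, ..., n}, as a probability on the real line. *)
Definition index_law n : probability (measurableTypeR R) R :=
  empirical (\row_(i < n.+1) (i%:R : R)).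

(** Rows of one length become random variables on the common space [index_law n], and addition of
    rows becomes addition of variables. This provides the pairs [xi], [eta] on which a Lions
    derivative at an empirical measure is tested. *)
Definition tabulate n (x : 'rV[R]_n.+1) (u : measurableTypeR R) : R :=
  \sum_(i < n.+1) x ord0 i * (u == i%:R)%:R.

Lemma tabulateE n (x : 'rV[R]_n.+1) (i : 'I_n.+1) : tabulate x i%:R = x ord0 i.
Proof.
rewrite /tabulate (bigD1 i)//= eqxx mulr1 big1 ?addr0// => j ji.
by rewrite eqr_nat eq_sym val_eqE (negbTE ji) mulr0.
Qed.

Lemma measurable_tabulate n (x : 'rV[R]_n.+1) : measurable_fun setT (tabulate x).
Proof.
rewrite /tabulate; apply: measurable_sum => i; apply: measurable_funM => //.
rewrite (_ : (fun _ => _) = \1_[set (i%:R : R)]); first exact: measurable_indic.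
by apply/funext => u; rewrite indicE in_set1.
Qed.

Definition tabulate_RV n (x : 'rV[R]_n.+1) : {RV (index_law n) >-> R} :=
  mfun_Sub (mem_set (measurable_tabulate x)).

Lemma tabulate_RVE n (x : 'rV[R]_n.+1) u : tabulate_RV x u = tabulate x u.
Proof. by []. Qed.

Lemma has_law_tabulate n (x : 'rV[R]_n.+1) :
  has_law (index_law n) (tabulate_RV x) (empirical x).
Proof.
move=> A mA; rewrite /index_law !empirical_measureE; congr (_ * _)%E.
apply: eq_bigr => i _; rewrite mxE !diracE.
suff -> : (i%:R \in tabulate_RV x @^-1` A) = (x ord0 i \in A) by [].
by rewrite -(tabulateE x i); apply/idP/idP; rewrite !inE.
Qed.

Lemma tabulateD n (x y : 'rV[R]_n.+1) u :
  tabulate (x + y) u = tabulate x u + tabulate y u.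
Proof.
by rewrite /tabulate -big_split/=; apply: eq_bigr => i _; rewrite mxE mulrDl.
Qed.

Lemma integral_index_law n (h : measurableTypeR R -> R) : measurable_fun setT h ->
  (\int[index_law n]_u (h u)%:E =
    (n.+1%:R^-1 * \sum_(i < n.+1) h i%:R)%:E)%E.
Proof.
move=> mh; rewrite integral_empirical//; congr (_ * _)%:E.
by apply: eq_bigr => i _; rewrite mxE.
Qed.

Lemma Lnorm2_tabulate n (x : 'rV[R]_n.+1) :
  fine ('N[index_law n]_2%:E[EFin \o tabulate_RV x]) =
  Num.sqrt (n.+1%:R^-1 * \sum_(i < n.+1) x ord0 i ^+ 2).
Proof.
rewrite unlock /=.
under eq_integral do rewrite /= powR_mulrn// -normrX ger0_norm ?sqr_ge0//.
rewrite integral_index_law; last first.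
  by apply: measurable_funX; exact: measurable_tabulate.
rewrite poweR_EFin/= powR12_sqrt; last first.
  by rewrite mulr_ge0// ?invr_ge0// sumr_ge0// => i _; rewrite sqr_ge0.
by congr (Num.sqrt (_ * _)); apply: eq_bigr => i _; rewrite /= tabulateE.
Qed.

(** Moving the particles by [h *: d] is the perturbation [eta] tabulating [h *: d]. Its L2 norm is
    [|h|] times that of [d], so the Frechet remainder is o(h). *)
Lemma lions_derivative_along (F : P2 R -> R) (g : R -> R) n (x d : 'rV[R]_n.+1) :
  lions_derivative F (empirical x) g ->
  is_derive (0 : R) (1 : R) (fun h : R => F (empirical (x + h *: d)))
    (n.+1%:R^-1 * \sum_(i < n.+1) g (x ord0 i) * d ord0 i).
Proof.
move=> [mg _ Fg]; set D := _ * _.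
set N := Num.sqrt (n.+1%:R^-1 * \sum_(i < n.+1) d ord0 i ^+ 2).
have N0 : 0 <= N by exact: sqrtr_ge0.
have key : (fun h => h^-1 *: (F (empirical (x + (h *: (1 : R) + 0) *: d))
    - F (empirical (x + (0 : R) *: d)))) @ 0^' --> D.
  apply/cvgrPdist_le => e e0.
  (* Dividing by [N + 1] covers [d = 0], where [N] vanishes. *)
  have eN : 0 < e / (N + 1) by rewrite divr_gt0// ltr_wpDl.
  have [del del0 Hd] := Fg _ eN.
  have N1 : N / (N + 1) <= 1 by rewrite ler_pdivrMr ?mul1r ?lerDl// ltr_wpDl.
  near=> h.
  have h0 : h != 0 by near: h; exact: nbhs_dnbhs_neq.
  have hd : `|h| < del / (N + 1).
    near: h; apply: dnbhs0_lt; by rewrite divr_gt0// ltr_wpDl.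
  rewrite scale0r addr0 addr0 [h *: 1]mulr1.
  have := Hd _ _ (index_law n) (tabulate_RV x) (tabulate_RV (h *: d))
    (empirical (x + h *: d)) (has_law_tabulate x).
  have -> : (fun w => tabulate_RV x w + tabulate_RV (h *: d) w) =
      tabulate_RV (x + h *: d).
    by apply/funext => w; rewrite !tabulate_RVE tabulateD.
  move=> /(_ (has_law_tabulate _)) /=; rewrite Lnorm2_tabulate.
  have -> : Num.sqrt (n.+1%:R^-1 * \sum_(i < n.+1) (h *: d) ord0 i ^+ 2) = `|h| * N.
    under eq_bigr do rewrite mxE exprMn.
    by rewrite -mulr_sumr mulrCA sqrtrM ?sqr_ge0// sqrtr_sqr.
  have hN : `|h| * N <= del.
    by rewrite (le_trans (ler_wpM2r N0 (ltW hd)))// mulrAC -mulrA ler_piMr ?(ltW del0).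
  move=> /(_ hN); rewrite unlock integral_index_law; last first.
    apply: measurable_funM; last exact: measurable_tabulate.
    by apply: measurableT_comp => //; exact: measurable_tabulate.
  have -> : fine (n.+1%:R^-1 * \sum_(i < n.+1) (g (tabulate_RV x i%:R) *
      tabulate_RV (h *: d) i%:R))%:E = h * D.
    rewrite /= /D mulrCA; congr (_ * _); rewrite mulr_sumr; apply: eq_bigr => i _.
    by rewrite /= !tabulateE mxE mulrCA.
  move=> H.
  rewrite distrC -(@ler_pM2l _ `|h|) ?normr_gt0// -normrM mulrBr [_ * (_ *: _)]mulrA.
  rewrite mulfV// mul1r (le_trans H)// mulrCA ler_wpM2l//.
  by rewrite mulrAC -mulrA ler_piMr ?(ltW e0).
split; first by apply/cvg_ex; exists D; exact: key.
exact: cvg_lim key.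
Unshelve. all: by end_near. Qed.

(** On the segment from [y] to [x] every point is an empirical measure at which the lift is
    differentiable along [x - y], so the mean value theorem applies. *)
Lemma lions_lipschitz (F : P2 R -> R) (g : P2 R -> R -> R) (C : R) :
  (forall mu, lions_derivative F mu (g mu) /\ forall y, `|g mu y| <= C) ->
  forall n (x y : 'rV[R]_n.+1),
  `|F (empirical x) - F (empirical y)| <=
    C * (n.+1%:R^-1 * \sum_(i < n.+1) `|x ord0 i - y ord0 i|).
Proof.
move=> H n x y; set d := x - y.
pose z (s : R) := y + s *: d.
pose D s := n.+1%:R^-1 * \sum_(i < n.+1) g (empirical (z s)) (z s ord0 i) * d ord0 i.
have dz (s : R) : is_derive s (1 : R) (fun s => F (empirical (z s))) (D s).
  have := lions_derivative_along d (H (empirical (z s))).1.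
  have -> : (fun h => F (empirical (z s + h *: d))) =
      (fun s => F (empirical (z s))) \o (fun h => h + s).
    apply/funext => h /=; congr (F (empirical _)).
    by rewrite /z -addrA -scalerDl (addrC s).
  move=> [d1 d2]; split.
    move: d1; rewrite /derivable/=; under eq_fun do rewrite addr0.
    by under eq_fun do rewrite add0r.
  rewrite /D -d2 /derive /=; under [in RHS]eq_fun do rewrite addr0.
  by rewrite add0r.
have [c _] := @MVT_segment _ _ D 0 1 ler01 (fun s _ => dz s)
  (derivable_within_continuous (fun s _ => @ex_derive _ _ _ _ _ _ _ (dz s))).
rewrite subr0 mulr1 {1 2}/z scale1r scale0r addr0 /d addrCA subrr addr0 => ->.
rewrite /D normrM ger0_norm ?invr_ge0// mulrCA ler_wpM2l ?invr_ge0//.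
rewrite (le_trans (ler_norm_sum _ _ _))// mulr_sumr ler_sum// => i _.
by rewrite normrM !mxE ler_wpM2r//; exact: (H _).2.
Qed.

(* The increment [eta = 0] turns a variable of law [mu] into one of law [nu]. *)
Lemma lions_eqmeas (F : P2 R -> R) (mu nu : P2 R) (g : R -> R) :
  lions_derivative F mu g -> mu ≡μ nu -> F mu = F nu.
Proof.
move=> [mg _ Fg] e.
have [del del0 /(_ _ _ mu)H] := Fg _ ltr01.
pose i0 : measurableTypeR R -> R := fun w => w.
pose c0 : measurableTypeR R -> R := fun _ => 0.
have mid : measurable_fun setT i0 by exact: measurable_id.
have mcst : measurable_fun setT c0 by exact: measurable_cst.
pose xi : {RV mu >-> R} := mfun_Sub (mem_set mid).
pose eta : {RV mu >-> R} := mfun_Sub (mem_set mcst).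
have := H xi eta nu.
have N0 : fine ('N[mu]_2%:E[EFin \o eta]) = 0.
  by rewrite (_ : _ \o _ = cst 0%E)// Lnorm0.
move=> /(_ (fun A _ => erefl)) H1.
have hl : has_law mu (fun w => xi w + eta w) nu.
  move=> A mA; rewrite (_ : (fun w => _) = i0); first exact: e.
  by apply/funext => w; rewrite /= addr0.
move: (H1 hl); rewrite /= N0 mulr0 => /(_ (ltW del0)).
rewrite (_ : 'E_mu[_]%E = 0%E); last first.
  by rewrite unlock; under eq_integral do rewrite mulr0; rewrite integral0.
by rewrite subr0 normr_le0 subr_eq0 => /eqP.
Qed.

End empirical_integral.

(** * Lipschitz regularity of the drift *)

Section drift_lipschitz.
Context (R : realType).

(** A continuity induction: the supremum [c] of the points up to which the bound from [a] holds
    satisfies it too, and could be pushed further if it were below [b]. It takes the place of the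
    mean value theorem for [is_derive_within], a limit taken inside the interval only. *)
Lemma lipschitz_local_itv (h : R -> R) (C a b : R) : a <= b ->
  (forall x, x \in `[a, b] -> exists2 del, 0 < del & forall s, s \in `[a, b] ->
     `|s - x| < del -> `|h s - h x| <= C * `|s - x|) ->
  `|h b - h a| <= C * (b - a).
Proof.
move=> ab H.
pose S := [set s | s \in `[a, b] /\ `|h s - h a| <= C * (s - a)].
have Sa : S a by rewrite /S/= in_itv/= lexx ab !subrr normr0 mulr0.
have ubS : ubound S b by move=> s [/itvP sab _]; rewrite sab.
have supS : has_sup S by split; [exists a | exists b].
set c := sup S.
have cab : c \in `[a, b].
  by rewrite in_itv/= ub_le_sup ?ge_sup//; [exists a|exists b].
have [del del0 Hc] := H _ cab.
have Sc : S c.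
  split=> //.
  have [s Ss cs] := sup_adherent del0 supS.
  have sc : s <= c by apply: ub_le_sup => //; exists b.
  have [sab hs] := Ss.
  have := Hc s sab; rewrite distrC ger0_norm ?subr_ge0// ltrBlDl -ltrBlDr => /(_ cs).
  rewrite distrC => hcs.
  rewrite (_ : h c - h a = (h c - h s) + (h s - h a)); last by ring.
  by rewrite (le_trans (ler_normD _ _))// (le_trans (lerD hcs hs))//; lra.
have [cb|bc] := ltP c b; last first.
  suff -> : b = c by exact: Sc.2.
  by apply/eqP; rewrite eq_le bc (itvP cab).
pose s := Num.min b (c + del / 2).
have cs : c < s by rewrite /s lt_min cb ltrDl divr_gt0.
have sab : s \in `[a, b].
  by rewrite in_itv/= ge_min lexx andbT (le_trans _ (ltW cs))// (itvP cab).
suff Ss : S s by have := ub_le_sup (ex_intro _ b ubS) Ss; rewrite leNgt -/c cs.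
split=> //.
have hs := Hc s sab.
rewrite gtr0_norm ?subr_gt0// in hs.
have {}hs : `|h s - h c| <= C * (s - c).
  apply: hs; rewrite ltrBlDl /s gt_min; apply/orP; right.
  by rewrite ltrD2l ltr_pdivrMr// ltr_pMr// ltr1n.
rewrite (_ : h s - h a = (h s - h c) + (h c - h a)); last by ring.
by rewrite (le_trans (ler_normD _ _))// (le_trans (lerD hs Sc.2))//; lra.
Qed.

Lemma derive_within_lipschitz (h : R -> R) (C a b : R) :
  (forall t, t \in `[a, b] ->
    exists2 l, is_derive_within `[a, b] h t l & `|l| <= C) ->
  forall t s, t \in `[a, b] -> s \in `[a, b] -> `|h t - h s| <= (C + 1) * `|t - s|.
Proof.
move=> H; suff Hlt t s : t \in `[a, b] -> s \in `[a, b] -> t <= s ->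
    `|h s - h t| <= (C + 1) * (s - t).
  move=> t s tab sab; have [ts|st] := leP t s.
    by rewrite distrC (distrC t) (ger0_norm (_ : 0 <= s - t)) ?subr_ge0// Hlt.
  by rewrite (gtr0_norm (_ : 0 < t - s)) ?subr_gt0// Hlt// ltW.
move=> tab sab ts; apply: lipschitz_local_itv => // x xts.
have sub u : u \in `[t, s] -> u \in `[a, b].
  rewrite !in_itv/= => /andP[u1 u2].
  by rewrite (le_trans _ u1) ?(itvP tab)// (le_trans u2)// (itvP sab).
have [l hl lC] := H _ (sub _ xts).
(* Near [x] the difference quotient is within 1 of its limit, whence the [+ 1] in the constant. *)
have /cvgrPdist_lt/(_ _ ltr01) := hl.
rewrite /= near_withinE /dnbhs near_withinE => /nbhs_ballP[/= del del0 Hd].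
exists del => // u uts ux.
have [->|ne] := eqVneq u x; first by rewrite !subrr normr0 mulr0.
have := Hd u; rewrite /ball /= distrC ux => /(_ isT ne (sub _ uts)) => Hu.
have du : 0 < `|u - x| by rewrite normr_gt0 subr_eq0.
rewrite -ler_pdivrMr// -normf_div.
have : `|(h u - h x) / (u - x)| <= `|l| + 1.
  rewrite -[_ / _](subrK l) (le_trans (ler_normD _ _))// addrC lerD2l distrC ltW//.
by move=> /le_trans; apply; rewrite lerD2r.
Qed.

Lemma derive1_lipschitz (h : R -> R) (C : R) :
  (forall t, derivable h t 1 /\ `|h^`()%classic t| <= C) ->
  forall t s, `|h t - h s| <= C * `|t - s|.
Proof.
move=> H; suff Hlt t s : t <= s -> `|h s - h t| <= C * (s - t).
  move=> t s; have [ts|st] := leP t s.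
    by rewrite distrC (distrC t) (ger0_norm (_ : 0 <= s - t)) ?subr_ge0// Hlt.
  by rewrite (gtr0_norm (_ : 0 < t - s)) ?subr_gt0// Hlt// ltW.
move=> ts.
have dh (x : R) : is_derive x (1 : R) h (h^`()%classic x).
  by rewrite derive1E; split => //; exact: (H x).1.
have [c _ ->] := MVT_segment ts (fun x _ => dh x)
  (derivable_within_continuous (fun x _ => (H x).1)).
by rewrite normrM (ger0_norm (_ : 0 <= s - t)) ?subr_ge0// ler_wpM2r ?subr_ge0// (H c).2.
Qed.

Variables (T : R) (f : R -> R -> R -> P2 R -> R)
  (f_mu : R -> R -> R -> P2 R -> R -> R).
Hypothesis f_assum : drift_assumption T f f_mu.

Lemma drift_eqmeas t th x (mu nu : P2 R) : t \in `[0, T] -> mu ≡μ nu ->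
  f t th x mu = f t th x nu.
Proof.
move=> tT; have [C /(_ _ tT th x mu)[_ _ [H _]]] := drift_d1 f_assum.
exact: lions_eqmeas H.
Qed.

(** Measure, position, time and control are changed one at a time. The factor 2 in the constant is
    there because the particle's own position and the measure both cost the displacements. Their
    sum, not their mean, is used: the constants derived from it depend on the number of particles,
    and serve only existence and the limit in [eps] for fixed [n]. *)
Lemma drift_lipschitz : exists2 K, 0 <= K &
  forall t s th th' n (x y : 'rV[R]_n.+1) i, t \in `[0, T] -> s \in `[0, T] ->
  `|f t th (x ord0 i) (empirical x) - f s th' (y ord0 i) (empirical y)| <=
  K * (`|t - s| + `|th - th'| + \sum_j `|x ord0 j - y ord0 j|).
Proof.
have [C1 H1] := drift_d1 f_assum.
have [C0 H0] := drift_dt f_assum.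
pose C := Num.max 0 (Num.max (C0 + 1) C1).
have CC0 : C0 + 1 <= C by rewrite /C !le_max lexx orbT.
have CC1 : C1 <= C by rewrite /C !le_max lexx !orbT.
have C_ge0 : 0 <= C by rewrite /C le_max lexx.
exists (C * 2) => [|t s th th' n x y i tT sT]; first by rewrite mulr_ge0.
set z := fun th x mu => f t th x mu.
have e1 : `|f t th (y ord0 i) (empirical y) - f s th (y ord0 i) (empirical y)| <=
    C * `|t - s|.
  apply: (le_trans (@derive_within_lipschitz
    (fun s => f s th (y ord0 i) (empirical y)) C0 0 T _ t s tT sT)).
    by move=> u uT; exact: H0.
  exact: ler_wpM2r.
have e2 : `|f s th (y ord0 i) (empirical y) - f s th' (y ord0 i) (empirical y)| <=
    C * `|th - th'|.
  apply: (le_trans (@derive1_lipschitz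
    (fun u => f s u (y ord0 i) (empirical y)) C1 _ th th')).
    by move=> u; have [] := H1 _ sT u (y ord0 i) (empirical y).
  exact: ler_wpM2r.
have e3 : `|f t th (x ord0 i) (empirical y) - f t th (y ord0 i) (empirical y)| <=
    C * `|x ord0 i - y ord0 i|.
  apply: (le_trans (@derive1_lipschitz
    (fun u => f t th u (empirical y)) C1 _ (x ord0 i) (y ord0 i))).
    by move=> u; have [] := H1 _ tT th u (empirical y).
  exact: ler_wpM2r.
have S0 : 0 <= \sum_j `|x ord0 j - y ord0 j| by exact: sumr_ge0.
have e4 : `|f t th (x ord0 i) (empirical x) - f t th (x ord0 i) (empirical y)| <=
    C * \sum_j `|x ord0 j - y ord0 j|.
  apply: (le_trans (@lions_lipschitz _ (f t th (x ord0 i))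
    (f_mu t th (x ord0 i)) C1 _ _ x y)).
    by move=> mu; have [_ _] := H1 _ tT th (x ord0 i) mu.
  apply: ler_pM => //.
  - by have [[_ + ] _ _] := H1 _ tT 0 0 (P2_dirac 0); exact: le_trans.
  - by rewrite mulr_ge0.
  - by rewrite ler_piMl// invf_le1// ler1n.
have e5 : `|x ord0 i - y ord0 i| <= \sum_j `|x ord0 j - y ord0 j|.
  by rewrite (bigD1 i)//= lerDl sumr_ge0.
have e5' := ler_wpM2l C_ge0 e5.
rewrite -(subrKA (f t th (x ord0 i) (empirical y))).
rewrite (le_trans (ler_normD _ _))//.
rewrite -(subrKA (f t th (y ord0 i) (empirical y)) (f t th (x ord0 i) (empirical y))).
rewrite (le_trans (lerD (lexx _) (ler_normD _ _)))//.
rewrite -(subrKA (f s th (y ord0 i) (empirical y)) (f t th (y ord0 i) (empirical y))).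
rewrite (le_trans (lerD (lexx _) (lerD (lexx _) (ler_normD _ _))))//.
have := mulr_ge0 C_ge0 (normr_ge0 (t - s)).
have := mulr_ge0 C_ge0 (normr_ge0 (th - th')).
lra.
Qed.

End drift_lipschitz.

(** * Time averages of adapted processes *)

Section measurability_by_discretization.
Context (R : realType).

Definition grid (m : nat) (y : R) : R := (Num.floor (m.+1%:R * y))%:~R / m.+1%:R.

Lemma grid_dist m y : `|grid m y - y| <= m.+1%:R^-1.
Proof.
rewrite /grid -{2}(mulKf (_ : m.+1%:R != 0 :> R) y) ?pnatr_eq0// mulrC -mulrBr normrM.
rewrite ger0_norm ?invr_ge0// ler_piMr ?invr_ge0// distrC ger0_norm; last first.
  by rewrite subr_ge0 ge_floor.
by rewrite lerBlDl ltW// -[X in _ + X]/(1%:~R) -intrD floorD1_gt.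
Qed.

Lemma measurable_grid_cell m (z : int) :
  measurable [set y : R | Num.floor (m.+1%:R * y) = z].
Proof.
rewrite (_ : [set _ | _] = `[z%:~R / m.+1%:R, (z + 1)%:~R / m.+1%:R[%classic).
  exact: measurable_itv.
apply/seteqP; split => y /=; rewrite in_itv/= ler_pdivrMr ?ltr0n// ltr_pdivlMr ?ltr0n// (mulrC y).
  by move=> <-; exact: floor_itv.
by move=> h; exact: floor_def.
Qed.

(** Rounding each coordinate to a grid leaves countably many values, so preimages are countable
    unions of measurable sets whatever [Phi] is. The Lipschitz bound gives convergence as the mesh
    shrinks. No sigma-algebra on rows is involved. *)
Lemma measurable_lipschitz_comp d (T : measurableType d) k (Phi : 'rV[R]_k -> R)
    (K : R) (Y : 'I_k -> T -> R) (D : set T) :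
  (forall x y, `|Phi x - Phi y| <= K * \sum_i `|x ord0 i - y ord0 i|) ->
  (forall i, measurable_fun D (Y i)) ->
  measurable_fun D (fun t => Phi (\row_i Y i t)).
Proof.
move=> Phi_lip mY mD.
pose h m t := Phi (\row_i grid m (Y i t)).
suff : measurable_fun D (fun t => Phi (\row_i Y i t)) by exact.
apply: (@measurable_fun_cvg _ _ _ _ h) => [m _ B mB|t Dt].
  pose c (z : 'rV[int]_k) : 'rV[R]_k := \row_i ((z ord0 i)%:~R / m.+1%:R).
  rewrite (_ : D `&` _ = \bigcup_(z in [set z | B (Phi (c z))])
      (D `&` \bigcap_(i in [set: 'I_k]) (Y i @^-1` [set y | Num.floor (m.+1%:R * y) = z ord0 i]))).
    rewrite bigcup_mkcond; apply: countable_bigcupT_measurable => // z.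
    case: ifPn => // _.
    rewrite (_ : D `&` _ = D `\` \bigcup_(i : 'I_k)
        (D `\` (D `&` Y i @^-1` [set y | Num.floor (m.+1%:R * y) = z ord0 i]))).
      apply: measurableD => //; apply: countable_bigcupT_measurable => // i.
      apply: measurableD => //; apply: mY => //; exact: measurable_grid_cell.
    apply/seteqP; split => t /=.
      by move=> [Dt Yt]; split => // -[i _ [_]]; apply; split => //; exact: Yt.
    move=> [Dt Yt]; split => // i _ /=; apply: contrapT => Yi; apply: Yt.
    by exists i => //; split => // -[_].
  apply/seteqP; split => t /=.
    move=> [Dt Bt]; exists (\row_i Num.floor (m.+1%:R * Y i t)) => /=.
      rewrite (_ : c _ = \row_i grid m (Y i t))//.
      by apply/rowP => i; rewrite !mxE.
    by split=> // i _ /=; rewrite mxE.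
  move=> [z Bz [Dt Yz]]; split=> //.
  rewrite /h (_ : \row_i _ = c z)//.
  by apply/rowP => i; rewrite !mxE /grid (Yz i I).
apply/cvgrPdist_le => e e0.
near=> m.
rewrite distrC (le_trans (Phi_lip _ _))// (le_trans (ler_wpM2r _ (ler_norm _))) ?sumr_ge0//.
rewrite (@le_trans _ _ (`|K| * \sum_(i < k) m.+1%:R^-1))//.
  by apply: ler_wpM2l => //; apply: ler_sum => i _; rewrite !mxE grid_dist.
rewrite sumr_const card_ord -[_ *+ k]mulr_natl mulrA.
rewrite ler_pdivrMr ?ltr0n// -ler_pdivrMl//.
rewrite (@le_trans _ _ m%:R)// ?ler_nat//.
near: m; exact: nbhs_infty_ger.
Unshelve. all: by end_near. Qed.

(** Time is rounded to the grid and clamped to [[a, b]], so that only sections at times of the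
    interval are used; continuity of the paths gives the limit. *)
Lemma measurable_within_continuous d (T : measurableType d) (a b : R) (Y : R -> T -> R) :
  a <= b ->
  (forall w, {within `[a, b], continuous (Y ^~ w)}) ->
  (forall t, t \in `[a, b] -> measurable_fun setT (Y t)) ->
  measurable_fun (`[a, b] `*` setT) (fun p : measurableTypeR R * T => Y p.1 p.2).
Proof.
move=> ab cY mY.
pose q m r := Num.max a (Num.min b (grid m r)).
have qab m r : q m r \in `[a, b].
  by rewrite in_itv/= le_max lexx/= ge_max ab ge_min lexx.
have qdist m r : r \in `[a, b] -> `|q m r - r| <= m.+1%:R^-1.
  rewrite in_itv/= => /andP[ar rb]; apply: le_trans (grid_dist m r).
  have := ler_norm (grid m r - r); have := ler_norm (- (grid m r - r)); rewrite normrN.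
  move=> h1 h2; rewrite ler_norml /q /Num.max /Num.min.
  by case: (ltP b (grid m r)); case: ifPn; lra.
pose h m (p : measurableTypeR R * T) := Y (q m p.1) p.2.
apply: (@measurable_fun_cvg _ _ _ _ h) => [m mD B mB|[r w] /= [rab _]].
- pose c (z : int) := Num.max a (Num.min b (z%:~R / m.+1%:R)).
  have cab z : c z \in `[a, b].
    by rewrite in_itv/= le_max lexx/= ge_max ab ge_min lexx.
  apply: measurableI => //.
  rewrite (_ : _ @^-1` _ = \bigcup_z ([set r : R | Num.floor (m.+1%:R * r) = z] `*` (Y (c z) @^-1` B))).
    apply: countable_bigcupT_measurable => // z.
    apply: measurableX; first exact: measurable_grid_cell.
    by rewrite -[X in measurable X]setTI; exact: mY.
  apply/seteqP; split => -[r w] /=.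
    by move=> Bw; exists (Num.floor (m.+1%:R * r)).
  by move=> [z _ [rz]]; rewrite /= /h /= /q /grid rz.
- move: (cY w) => /subspace_continuousP /(_ r rab) cYr.
  apply: (cvg_comp _ _ _ cYr).
  move=> A [e /= e0 Ae].
  near=> n.
  apply: Ae => /=; last exact: qab.
  rewrite /ball/= distrC (le_lt_trans (qdist _ _ rab))// .
  rewrite invf_plt ?posrE// (@lt_le_trans _ _ n%:R) ?ler_nat//.
  by near: n; exact: nbhs_infty_gtr.
Unshelve. all: by end_near. Qed.

End measurability_by_discretization.

(** * Averages measurable for a sub-sigma-algebra *)

Section averages_of_adapted_processes.
Context (R : realType) d (Om : measurableType d) (P : probability Om R)
  (H : set (set Om)).
Hypothesis H_meas : forall A, <<s H>> A -> measurable A.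
Hypothesis H_null : P.-negligible `<=` <<s H>>.

Notation Hmeas := (@measurable_fun _ _ (g_sigma_algebraType H) R setT).

Lemma Hmeas_measurable (Z : Om -> R) : Hmeas Z -> measurable_fun setT Z.
Proof. by move=> mZ _ B mB; apply: H_meas; exact: mZ. Qed.

Lemma Hmeas_ae (Z Z' : Om -> R) : Hmeas Z -> {ae P, forall w, Z w = Z' w} -> Hmeas Z'.
Proof.
move=> mZ [N [mN N0 ZN]] _ B mB.
have HN C : C `<=` N -> <<s H>> C.
  by move=> CN; apply: H_null; exists N.
have mgN : @measurable _ (g_sigma_algebraType H) N by exact: HN.
rewrite (_ : _ `&` _ = (Z @^-1` B `&` ~` N) `|` (Z' @^-1` B `&` N)).
  apply: (@measurableU _ (g_sigma_algebraType H)).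
    apply: (@measurableI _ (g_sigma_algebraType H)).
      by rewrite -[X in measurable X]setTI; exact: mZ.
    exact: (@measurableC _ (g_sigma_algebraType H)).
  by apply: HN; apply: subIsetr.
apply/seteqP; split => w /=.
  move=> [_ Bw]; have [Nw|Nw] := pselect (N w); first by right.
  left; split => //; suff -> : Z w = Z' w by [].
  by apply: contrapT => h; apply: Nw; exact: ZN.
move=> [[Bw Nw]|[]//]; split=> //; suff <- : Z w = Z' w by [].
by apply: contrapT => h; apply: Nw; exact: ZN.
Qed.

Lemma Hmeas_limit (Z : nat -> Om -> R) (I : Om -> R) : (forall n, Hmeas (Z n)) ->
  {ae P, forall w, Z n w @[n --> \oo] --> I w} -> Hmeas I.
Proof.
move=> mZ [N [mN N0 ZN]].
have HN C : C `<=` N -> <<s H>> C.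
  by move=> CN; apply: H_null; exists N.
have mgN : @measurable _ (g_sigma_algebraType H) (~` N).
  by apply: (@measurableC _ (g_sigma_algebraType H)); exact: HN.
apply: (@Hmeas_ae (I \* \1_(~` N))); last first.
  exists N; split => // w /=; apply: contra_notP => Nw.
  by rewrite indicE mem_set ?mulr1.
apply: (@measurable_fun_cvg _ (g_sigma_algebraType H) _ _ (fun n => Z n \* \1_(~` N))).
  move=> n; apply: measurable_funM => //.
move=> w _ /=; rewrite indicE; have [Nw|Nw] := boolP (w \in ~` N).
  apply: cvgM; last exact: cvg_cst.
  move: Nw; rewrite inE => Nw; apply: contrapT => h; apply: Nw; exact: ZN.
by rewrite mulr0; under eq_fun do rewrite mulr0; exact: cvg_cst.
Qed.

(** The mean square errors are summable, so the series of squared errors has finite expectation, is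
    finite almost everywhere, and its terms are dominated by tails tending to 0. *)
Lemma cvg_fast_L2 (Z : nat -> Om -> R) (I : Om -> R) :
  (forall n, measurable_fun setT (Z n)) -> measurable_fun setT I ->
  (forall n, \int[P]_w ((Z n w - I w) ^+ 2)%:E <= (1 / (2 ^ n.+1)%:R)%:E)%E ->
  {ae P, forall w, Z n w @[n --> \oo] --> I w}.
Proof.
move=> mZ mI ZI.
pose g n w := ((Z n w - I w) ^+ 2)%:E.
have mg n : measurable_fun setT (g n).
  by apply/measurable_EFinP; apply: measurable_funX; exact: measurable_funB.
have g0 n w : (0 <= g n w)%E by rewrite lee_fin sqr_ge0.
have fin : (\int[P]_w (\sum_(n <oo) g n w) < +oo)%E.
  rewrite integral_nneseries//.
  apply: (@le_lt_trans _ _ (\sum_(n <oo) (1 / (2 ^ n.+1)%:R : R)%:E)%E).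
    by apply: lee_nneseries => [n _ _|n _]; [exact: integral_ge0|exact: ZI].
  by apply: (le_lt_trans (@epsilon_trick0 R 1 xpredT ler01)); rewrite ltry.
have ig : P.-integrable setT (fun w => \sum_(n <oo) g n w)%E.
  apply/integrableP; split; first exact: ge0_emeasurable_sum.
  by under eq_integral do rewrite gee0_abs ?nneseries_ge0//.
apply: filterS (integrable_ae measurableT ig) => w /(_ Logic.I) fw.
have fw' : (\sum_(0 <= n <oo) g n w < +oo)%E by rewrite ltey_eq fw.
have /fine_cvgP[fint ct] := nneseries_tail_cvg fw' (fun k _ => g0 k w).
apply/cvgrPdist_le => e e0.
have e2 : 0 < e ^+ 2 by rewrite exprn_gt0.
move/cvgrPdist_lt : ct => /(_ _ e2) ct.
near=> n.
have fn : (\sum_(n <= k <oo) g k w)%E \is a fin_num by near: n.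
have tn : `|0 - fine (\sum_(n <= k <oo) g k w)%E| < e ^+ 2 by near: n.
have gn : (g n w <= \sum_(n <= k <oo) g k w)%E.
  have := @nneseries_lim_ge R (fun k => g k w) xpredT n n.+1 (fun k _ _ => g0 k w).
  by rewrite big_nat1.
rewrite distrC -(@ler_pXn2r _ 2) ?nnegrE ?(ltW e0)// -normrX ger0_norm ?sqr_ge0//.
rewrite -lee_fin (le_trans gn)// -[leLHS]fineK// lee_fin ltW// (le_lt_trans _ tn)//.
by rewrite sub0r normrN ler_norm.
Unshelve. all: by end_near. Qed.

Lemma integrable_section d1 (T : measurableType d1) (Q : probability T R)
    (Y : T * Om -> R) (M : R) :
  measurable_fun setT Y -> (forall p, `|Y p| <= M) ->
  forall w, Q.-integrable setT (EFin \o (fun u => Y (u, w))).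
Proof.
move=> mY YM w; apply: (@measurable_bounded_integrable _ _ _ Q) => //.
- by rewrite ltey_eq fin_num_measure.
- by apply: measurableT_comp => //; exact: pair2_measurable.
- exists `|M|; split => // x x1 u _ /=.
  by rewrite (le_trans (YM _))// (le_trans (ler_norm M))// ltW.
Qed.

(** Adding [M] makes the integrand nonnegative, so that Tonelli's theorem gives the measurability;
    the constant is then subtracted again. *)
Lemma measurable_average d1 (T : measurableType d1) (Q : probability T R)
    (Y : T * Om -> R) (M : R) :
  measurable_fun setT Y -> (forall p, `|Y p| <= M) ->
  measurable_fun setT (fun w => \int[Q]_u Y (u, w)).
Proof.
move=> mY YM; have iY := integrable_section Q mY YM.
have iM : Q.-integrable setT (EFin \o (fun _ => M)).
  apply: (@measurable_bounded_integrable _ _ _ Q) => //.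
    by rewrite ltey_eq fin_num_measure.
  by exists `|M|; split => // x x1 u _ /=; rewrite ltW.
rewrite (_ : (fun w => _) = (fun w => fine (\int[Q]_u (Y (u, w) + M)%:E)%E - M)).
  apply: measurable_funB => //; apply: measurableT_comp; first exact: fine_measurable.
  apply: (@measurable_fun_fubini_tonelli_G _ _ _ _ _ Q (fun p => (Y p + M)%:E)).
    by apply/measurable_EFinP; exact: measurable_funD.
  by move=> p; rewrite lee_fin -lerBlDr sub0r; have := YM p; rewrite ler_norml => /andP[].
apply/funext => w; rewrite -[X in X - _]/(\int[Q]_u (Y (u, w) + M)).
rewrite RintegralD// Rintegral_cst//= probability_setT/= mulr1 addrK//.
Qed.

(* Greedy choice of sample points [r]: at each step the [P]-mean square of
   [S + Y r - I] exceeds that of [S] by at most 2 for some [r], because it does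
   so on average over [r]. *)
Lemma average_greedy_step d1 (T : measurableType d1) (Q : probability T R)
    (Y : T * Om -> R) (S : Om -> R) :
  measurable_fun setT Y -> (forall p, `|Y p| <= 1) -> measurable_fun setT S ->
  (\int[P]_w (S w ^+ 2)%:E < +oo)%E ->
  exists r, (\int[P]_w ((S w + Y (r, w) - \int[Q]_u Y (u, w)) ^+ 2)%:E <=
    \int[P]_w (S w ^+ 2)%:E + 2%:E)%E.
Proof.
move=> mY Y1 mS Sfin.
have mYw w : measurable_fun setT (fun u => Y (u, w)).
  by apply: measurableT_comp => //; exact: pair2_measurable.
have iY w := integrable_section Q mY Y1 w.
have mI := measurable_average Q mY Y1.
apply: contrapT => /forallNP Hr.
pose F (p : T * Om) := ((S p.2 + Y p - \int[Q]_u Y (u, p.2)) ^+ 2)%:E.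
have mF : measurable_fun setT F.
  apply/measurable_EFinP/measurable_funX/measurable_funB; last first.
    by apply: (measurableT_comp mI).
  by apply: measurable_funD => //; exact: (measurableT_comp mS).
have F0 p : (0 <= F p)%E by rewrite lee_fin sqr_ge0.
have E1 : (\int[Q]_r \int[P]_w F (r, w) >= \int[P]_w (S w ^+ 2)%:E + 2%:E)%E.
  apply: (@le_trans _ _ (\int[Q]_r (cst (\int[P]_w (S w ^+ 2)%:E + 2%:E) r))%E).
    by rewrite integral_cst//= [X in (_ * X)%E]probability_setT mule1.
  apply: ge0_le_integral; first exact: measurableT.
  - by move=> r _; rewrite adde_ge0// integral_ge0// => w _; rewrite lee_fin sqr_ge0.
  - exact: measurable_cst.
  - exact: (measurable_fun_fubini_tonelli_F F mF F0).
  - by move=> r _; rewrite ltW// ltNge; apply/negP; exact: Hr.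
have mS2 : measurable_fun setT (fun w => (S w ^+ 2)%:E).
  by apply/measurable_EFinP; exact: measurable_funX.
(* With [I] the mean of [Y] and [c = S - I], the mean of [c ^+ 2 + 1 + 2 * c * Y] is
   [S ^+ 2 - I ^+ 2 + 1]. The excess 1 stays strictly below the 2 that the failure of every [r]
   would force. *)
have inner w : (\int[Q]_r F (r, w) <= (S w ^+ 2)%:E + 1%:E)%E.
  set I := \int[Q]_u Y (u, w); set c := S w - I.
  pose g u := c ^+ 2 + 1 + 2 * c * Y (u, w).
  have ic : Q.-integrable setT (EFin \o (fun=> c ^+ 2 + 1)).
    exact: finite_measure_integrable_cst.
  have iy : Q.-integrable setT (EFin \o (fun u => 2 * c * Y (u, w))).
    rewrite (_ : _ \o _ = fun u => ((2 * c)%:E * (EFin \o (fun u => Y (u, w))) u)%E) //.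
    exact: integrableZl.
  have ig : Q.-integrable setT (EFin \o g).
    by rewrite (_ : _ \o _ = (EFin \o (fun=> c ^+ 2 + 1)) \+ (EFin \o (fun u => 2 * c * Y (u, w))))//;
      exact: integrableD.
  have Fg u : (F (u, w) <= (g u)%:E)%E.
    rewrite lee_fin /g /= -/I (_ : S w + Y (u, w) - I = c + Y (u, w)); last by rewrite /c; ring.
    have : Y (u, w) ^+ 2 <= 1 by rewrite -real_normK ?num_real// exprn_ile1.
    by rewrite sqrrD; lra.
  apply: (@le_trans _ _ (\int[Q]_u (g u)%:E)%E).
    apply: ge0_le_integral => //.
    - by apply: measurableT_comp => //; exact: pair2_measurable.
    - by case/integrableP : ig.
  rewrite -[leLHS]fineK; last exact: integrable_fin_num.
  rewrite -[fine _]/(\int[Q]_u g u) RintegralD// RintegralZl// Rintegral_cst//=.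
  rewrite probability_setT/= mulr1 -/I -EFinD lee_fin /c.
  have := sqr_ge0 I; lra.
have E2 : (\int[P]_w \int[Q]_r F (r, w) <= \int[P]_w (S w ^+ 2)%:E + 1%:E)%E.
  apply: (@le_trans _ _ (\int[P]_w ((S w ^+ 2)%:E + 1%:E))%E).
    apply: ge0_le_integral; first exact: measurableT.
    - by move=> w _; exact: integral_ge0.
    - exact: (measurable_fun_fubini_tonelli_G F mF F0).
    - exact: emeasurable_funD.
    - by move=> w _; exact: inner.
  rewrite ge0_integralD//; last by move=> w _; rewrite lee_fin sqr_ge0.
  by rewrite integral_cst//= [X in (_ * X)%E]probability_setT mule1.
move: E1; rewrite (fubini_tonelli F)// => /le_trans/(_ E2).
rewrite leeD2lE ?ge0_fin_numE ?integral_ge0//; last by move=> w _; rewrite lee_fin sqr_ge0.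
by rewrite lee_fin leNgt ltr1n.
Qed.

(** [Z] is a sum of [k] samples [Y (r, _)], hence measurable for the small sigma-algebra. The mean
    square error grows only linearly in [k], so dividing by [k] leaves an error of at most
    [2 / k]. *)
Lemma average_approx d1 (T : measurableType d1) (Q : probability T R)
    (Y : T * Om -> R) :
  measurable_fun setT Y -> (forall p, `|Y p| <= 1) ->
  (forall r, Hmeas (fun w => Y (r, w))) ->
  forall k, exists Z : Om -> R, Hmeas Z /\
    (\int[P]_w ((Z w - k%:R * \int[Q]_u Y (u, w)) ^+ 2)%:E <= (k%:R * 2)%:E)%E.
Proof.
move=> mY Y1 hY; elim=> [|k [Z [mZ Zk]]].
  exists (cst 0); split; first exact: measurable_cst.
  under eq_integral do rewrite mul0r subrr expr0n /=.
  by rewrite integral0 mul0r.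
have mI := measurable_average Q mY Y1.
pose S w := Z w - k%:R * \int[Q]_u Y (u, w).
have mS : measurable_fun setT S.
  apply: measurable_funB; first exact: Hmeas_measurable.
  exact: measurable_funM.
have Sfin : (\int[P]_w (S w ^+ 2)%:E < +oo)%E by rewrite (le_lt_trans Zk)// ltry.
have [r Hr] := average_greedy_step Q mY Y1 mS Sfin.
exists (fun w => Z w + Y (r, w)); split; first exact: (@measurable_funD _ (g_sigma_algebraType H)).
rewrite (_ : k.+1%:R * 2 = k%:R * 2 + 2); last by rewrite -natr1; ring.
rewrite EFinD; apply: le_trans (leeD2r _ Zk); apply: le_trans Hr.
rewrite le_eqVlt; apply/orP; left; apply/eqP; apply: eq_integral => w _.
by rewrite -natr1 /S; congr (_ ^+ _)%:E; ring.
Qed.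

(** [Y] is jointly measurable for the full sigma-algebra of [Om], while only its sections are
    measurable for [H], so Tonelli's theorem does not apply with [H]. The average is obtained as an
    almost sure limit of averages over finitely many samples. *)
Lemma Hmeas_average1 d1 (T : measurableType d1) (Q : probability T R)
    (Y : T * Om -> R) :
  measurable_fun setT Y -> (forall p, `|Y p| <= 1) ->
  (forall r, Hmeas (fun w => Y (r, w))) ->
  Hmeas (fun w => \int[Q]_u Y (u, w)).
Proof.
move=> mY Y1 hY; have Zex := average_approx Q mY Y1 hY.
have mI := measurable_average Q mY Y1.
(* The mean square error [2 / k n] is then exactly the [1 / 2 ^ n.+1] of [cvg_fast_L2]. *)
pose k n := (2 ^ n.+2)%N.
have k0 n : (k n)%:R != 0 :> R by rewrite pnatr_eq0 expn_eq0.
pose Z n := sval (cid (Zex (k n))).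
have ZP n := svalP (cid (Zex (k n))).
have mZ n : Hmeas (fun w => Z n w / (k n)%:R).
  apply: (@measurable_funM _ (g_sigma_algebraType H)) => //; exact: (ZP n).1.
apply: (Hmeas_limit mZ); apply: cvg_fast_L2 => // n.
  exact: Hmeas_measurable.
have -> : (fun w => ((Z n w / (k n)%:R - \int[Q]_u Y (u, w)) ^+ 2)%:E) =
    (fun w => (((k n)%:R ^+ 2)^-1)%:E * ((Z n w - (k n)%:R * \int[Q]_u Y (u, w)) ^+ 2)%:E)%E.
  by apply/funext => w; rewrite -EFinM; congr _%:E; field.
have m2 : measurable_fun setT
    (fun w => ((Z n w - (k n)%:R * \int[Q]_u Y (u, w)) ^+ 2)%:E).
  apply/measurable_EFinP/measurable_funX/measurable_funB; last exact: measurable_funM.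
  exact: Hmeas_measurable (ZP n).1.
rewrite ge0_integralZl//; last by move=> w _; rewrite lee_fin sqr_ge0.
apply: (le_trans (lee_wpmul2l _ (ZP n).2)); first by rewrite lee_fin invr_ge0 sqr_ge0.
rewrite -EFinM lee_fin le_eqVlt; apply/orP; left; apply/eqP.
have := k0 n; rewrite /k expnS natrM; set a := (2 ^ n.+1)%:R => ka.
have a0 : a != 0 by rewrite /a pnatr_eq0 expn_eq0.
by field.
Qed.

(** Truncation at level [n.+1] and rescaling to [[-1, 1]] reduce to the bounded case; dominated
    convergence, for each [w], removes the truncation. *)
Lemma Hmeas_average d1 (T : measurableType d1) (Q : probability T R)
    (Y : T * Om -> R) :
  measurable_fun setT Y ->
  (forall r, Hmeas (fun w => Y (r, w))) ->
  (forall w, Q.-integrable setT (EFin \o (fun u => Y (u, w)))) ->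
  Hmeas (fun w => \int[Q]_u Y (u, w)).
Proof.
move=> mY hY iY.
pose c (n : nat) (y : R) := Num.max (- n.+1%:R) (Num.min n.+1%:R y) / n.+1%:R.
have mc n : measurable_fun setT (c n).
  apply: measurable_funM => //; apply: measurable_maxr => //; exact: measurable_minr.
have c1 n y : `|c n y| <= 1.
  rewrite normrM normfV (@ger0_norm _ n.+1%:R)// ler_pdivrMr ?ltr0n// mul1r.
  have n0 : 0 <= n.+1%:R :> R by [].
  by rewrite ler_norml /Num.max /Num.min; case: (ltP n.+1%:R y); case: ifPn; lra.
have hI n : Hmeas (fun w => n.+1%:R * \int[Q]_u c n (Y (u, w))).
  apply: (@measurable_funM _ (g_sigma_algebraType H)) => //.
  apply: (@Hmeas_average1 _ _ Q (c n \o Y)) => //.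
  - exact: measurableT_comp.
  - by move=> p; exact: c1.
  - by move=> r; exact: (@measurableT_comp _ _ _ (g_sigma_algebraType H) _ _ (c n)).
apply: (Hmeas_limit hI); apply: aeW => w.
have cE n y : n.+1%:R * c n y = Num.max (- n.+1%:R) (Num.min n.+1%:R y).
  by rewrite /c mulrC divfK// pnatr_eq0.
have cn n y : `|n.+1%:R * c n y| <= `|y|.
  rewrite cE; have n0 : 0 <= n.+1%:R :> R by [].
  have := ler_norm y; have := ler_norm (- y); rewrite normrN => y1 y2.
  by rewrite ler_norml /Num.max /Num.min; case: (ltP n.+1%:R y); case: ifPn; lra.
have c_id n y : `|y| <= n%:R -> n.+1%:R * c n y = y.
  rewrite cE -natr1 ler_norml => /andP[y1 y2].
  by rewrite /Num.max /Num.min; case: (ltP (n%:R + 1) y); case: ifPn; lra.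
have mYw : measurable_fun setT (fun u => Y (u, w)).
  by apply: measurableT_comp => //; exact: pair2_measurable.
have ic n : Q.-integrable setT (EFin \o (fun u => c n (Y (u, w)))).
  apply: (@integrable_section _ _ Q (c n \o Y) 1) => [|p]; [exact: measurableT_comp|exact: c1].
rewrite (_ : (fun n => _) =
    fine \o (fun n => \int[Q]_u ((n.+1%:R * c n (Y (u, w)))%:E))%E); last first.
  by apply/funext => n; rewrite -RintegralZl.
apply: fine_cvg; rewrite fineK; last exact: (integrable_fin_num measurableT (iY w)).
apply: (@dominated_cvg _ _ _ Q _ measurableT _ _ (fun u => `|Y (u, w)|%:E)) => //.
- move=> n; apply/measurable_EFinP/measurable_funM => //; exact: measurableT_comp.
- move=> u _; apply: cvg_near_cst; near=> n; congr _%:E; apply: c_id.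
  by near: n; exact: nbhs_infty_ger.
- exact: integrable_norm (iY w).
- by move=> n u _; rewrite lee_fin.
Unshelve. all: by end_near. Qed.

Lemma integrable_uniform (a b : R) (ab : a < b) (g : R -> R) :
  measurable_fun setT g -> lebesgue_measure.-integrable `[a, b] (EFin \o g) ->
  (uniform_prob ab).-integrable setT (EFin \o g) /\
  \int[uniform_prob ab]_r g r = (b - a)^-1 * \int[lebesgue_measure]_(r in `[a, b]) g r.
Proof.
move=> mg ig; have mEg : measurable_fun setT (EFin \o g) by exact/measurable_EFinP.
have ig' : (uniform_prob ab).-integrable setT (EFin \o g).
  apply/integrableP; split => //.
  rewrite integral_uniform//; last exact: measurableT_comp.
  by rewrite lte_mul_pinfty ?lee_fin ?invr_ge0 ?subr_ge0 ?ltW//; case/integrableP : ig.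
split => //.
rewrite /Rintegral integralE [in RHS]integralE.
rewrite !integral_uniform//; [|exact: measurable_funeneg|exact: measurable_funepos].
have mab : measurable (`[a, b]%classic : set (measurableTypeR R)).
  exact: measurable_itv.
have ip := integrable_pos_fin_num mab ig.
have im := integrable_neg_fin_num mab ig.
move: ip im; rewrite -[EFin \o g]/(fun x => (g x)%:E).
by set A := integral _ _ _; set B := integral _ _ _; case: A => // ? _; case: B => // ? _ /=; rewrite -mulrBr.
Qed.

(** The time integral is [b - a] times the average under the uniform law, after extension of [Y] by
    0 outside the interval. That law exists for [a < b], so a single point is treated apart. *)
Lemma Hmeas_time_integral (a b : R) (Y : R -> Om -> R) : a <= b ->
  measurable_fun (`[a, b] `*` setT) (fun p : measurableTypeR R * Om => Y p.1 p.2) ->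
  (forall r, r \in `[a, b] -> Hmeas (Y r)) ->
  (forall w, lebesgue_measure.-integrable `[a, b] (EFin \o Y ^~ w)) ->
  Hmeas (fun w => \int[lebesgue_measure]_(r in `[a, b]) Y r w).
Proof.
rewrite le_eqVlt => /predU1P[->|ab] mY hY iY.
  rewrite set_itv1; under eq_fun do rewrite Rintegral_set1; exact: measurable_cst.
pose D := `[a, b]%classic `*` [set: Om].
have mD : measurable (D : set (measurableTypeR R * Om)).
  by apply: measurableX => //; exact: measurable_itv.
pose Y' := (fun p : measurableTypeR R * Om => Y p.1 p.2) \_ D.
have mY' : measurable_fun setT Y' by exact/(measurable_restrictT _ mD).
have Y'E r w : r \in `[a, b] -> Y' (r, w) = Y r w.
  by move=> rab; rewrite /Y' patchE mem_set.
have Y'0 r w : r \notin `[a, b] -> Y' (r, w) = 0.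
  by move=> rab; rewrite /Y' patchE memNset// => -[/=]; rewrite (negbTE rab).
have mw w : measurable_fun setT (fun r => Y' (r, w)).
  by apply: measurableT_comp => //; exact: pair2_measurable.
have iw w : lebesgue_measure.-integrable `[a, b] (EFin \o (fun r => Y' (r, w))).
  apply: eq_integrable (iY w) => // r; rewrite inE => rab /=.
  by rewrite Y'E.
have U w := integrable_uniform ab (mw w) (iw w).
rewrite (_ : (fun w => _) = (fun w => (b - a) * \int[uniform_prob ab]_r Y' (r, w))).
  apply: (@measurable_funM _ (g_sigma_algebraType H)) => //.
  apply: Hmeas_average => //; last by move=> w; exact: (U w).1.
  move=> r; have [rab|rab] := boolP (r \in `[a, b]).
    by under eq_fun do rewrite Y'E//; exact: hY.
  by under eq_fun do rewrite Y'0//; exact: measurable_cst.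
apply/funext => w; rewrite (U w).2 mulVKf ?subr_eq0 ?gt_eqF//.
by apply: eq_Rintegral => r; rewrite inE => rab; rewrite Y'E.
Qed.

End averages_of_adapted_processes.

(** * Gronwall inequalities *)

Section integrable_EFin.
Context d (T : measurableType d) (R : realType) (m : {measure set T -> \bar R}).
Variables (D : set T) (mD : measurable D).

Lemma integrable_mull (k : R) (u : T -> R) :
  m.-integrable D (EFin \o u) -> m.-integrable D (EFin \o (fun r => k * u r)).
Proof.
move=> iu; rewrite (_ : _ \o _ = fun t => (k%:E * (EFin \o u) t)%E)//.
exact: integrableZl.
Qed.

Lemma integrable_add (u v : T -> R) :
  m.-integrable D (EFin \o u) -> m.-integrable D (EFin \o v) ->
  m.-integrable D (EFin \o (fun r => u r + v r)).
Proof.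
move=> iu iv; rewrite (_ : _ \o _ = (EFin \o u) \+ (EFin \o v))//.
exact: integrableD.
Qed.

Lemma integrable_bigsum (I : finType) (u : I -> T -> R) :
  (forall i, m.-integrable D (EFin \o u i)) ->
  m.-integrable D (EFin \o (fun r => \sum_i u i r)).
Proof.
move=> iu; rewrite (_ : _ \o _ = fun t => (\sum_i (EFin \o u i) t)%E).
  exact: integrable_sum.
by apply/funext => t /=; rewrite sumEFin.
Qed.

Lemma Rintegral_sum (I : finType) (u : I -> T -> R) :
  (forall i, m.-integrable D (EFin \o u i)) ->
  \int[m]_(r in D) (\sum_i u i r) = \sum_i \int[m]_(r in D) u i r.
Proof.
move=> iu; rewrite /Rintegral; under eq_integral do rewrite -sumEFin.
rewrite integral_sum//.
rewrite -sum_fine// => i _.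
exact: (integrable_fin_num mD (iu i)).
Qed.

End integrable_EFin.

Section gronwall.
Context (R : realType).
Notation mu := (@lebesgue_measure R).

Lemma integrable_subitv (a b t : R) (u : R -> R) : t <= b ->
  mu.-integrable `[a, b] (EFin \o u) -> mu.-integrable `[a, t] (EFin \o u).
Proof.
move=> tb; apply: integrableS => //; try exact: measurable_itv.
by move=> r /=; rewrite !in_itv/= => /andP[-> /le_trans->].
Qed.

Lemma Rintegral_subitv_le (a b t : R) (u : R -> R) : t <= b ->
  (forall r, r \in `[a, b] -> 0 <= u r) ->
  mu.-integrable `[a, b] (EFin \o u) ->
  \int[mu]_(r in `[a, t]) u r <= \int[mu]_(r in `[a, b]) u r.
Proof.
move=> tb u0 iu; have iu' := integrable_subitv tb iu.
rewrite /Rintegral fine_le//; [exact: integrable_fin_num|exact: integrable_fin_num|].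
apply: ge0_subset_integral => //=.
- by case/integrableP : iu.
- by move=> r /=; rewrite !in_itv/= => /andP[-> /le_trans->].
Qed.

Lemma is_derive_expR_affine (c a x : R) :
  is_derive x (1 : R) (fun r : R => expR (c * (r - a))) (c * expR (c * (x - a))).
Proof.
apply: is_derive_eq.
by rewrite subr0 [c *: _]mulr1 mulrC.
Qed.

Lemma continuous_expR_affine (c a : R) : continuous (fun r : R => expR (c * (r - a))).
Proof.
move=> x; apply: differentiable_continuous; apply/derivable1_diffP.
by have [] := is_derive_expR_affine c a x.
Qed.

Lemma integrable_expR_affine (c a b d : R) :
  mu.-integrable `[b, d] (EFin \o (fun r : R => expR (c * (r - a)))).
Proof.
apply: continuous_compact_integrable; first exact: segment_compact.
by apply: continuous_subspaceT; exact: continuous_expR_affine.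
Qed.

Lemma Rintegral_expR_le (c a b : R) : 0 < c -> a <= b ->
  \int[mu]_(r in `[a, b]) expR (c * (r - a)) <= c^-1 * expR (c * (b - a)).
Proof.
move=> c0; rewrite le_eqVlt => /predU1P[<-|ab].
  by rewrite set_itv1 Rintegral_set1 mulr_ge0 ?invr_ge0 ?ltW ?expR_gt0.
pose F r := c^-1 * expR (c * (r - a)).
have dF x : is_derive x (1 : R) F (expR (c * (x - a))).
  have := is_derive_expR_affine c a x => d.
  apply: is_derive_eq.
  by rewrite [_ *: _]mulrA mulVf ?gt_eqF// mul1r.
have cF : continuous F.
  by move=> x; apply: differentiable_continuous; apply/derivable1_diffP; have [] := dF x.
rewrite /Rintegral (@continuous_FTC2 _ _ F)//=.
- by rewrite lerBlDr lerDl /F mulr_ge0 ?invr_ge0 ?expR_ge0// ltW.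
- by apply: continuous_subspaceT; exact: continuous_expR_affine.
- split.
  + by move=> x _; have [] := dF x.
  + exact/cvg_at_right_filter/cF.
  + exact/cvg_at_left_filter/cF.
- by move=> x _; rewrite derive1E; have [_ ->] := dF x.
Qed.

(** With the weight [expR (2 * K * (r - a))], integration from [a] followed by multiplication by [K]
    halves a bound, however long the interval. Gronwall's inequality and the Picard iteration both
    rest on this contraction. *)
Lemma weighted_integral_le (K M a t : R) (u : R -> R) : 0 < K -> 0 <= M -> a <= t ->
  mu.-integrable `[a, t] (EFin \o u) ->
  (forall r, r \in `[a, t] -> u r <= M * expR (2 * K * (r - a))) ->
  K * \int[mu]_(r in `[a, t]) u r <= M / 2 * expR (2 * K * (t - a)).
Proof.
move=> K0 M0 at_ iu uM.
have K2 : 0 < 2 * K by rewrite mulr_gt0.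
have iE := integrable_expR_affine (2 * K) a a t.
apply: (@le_trans _ _ (K * (M * ((2 * K)^-1 * expR (2 * K * (t - a)))))); last first.
  by rewrite le_eqVlt; apply/orP; left; apply/eqP; field; rewrite gt_eqF.
apply: ler_wpM2l; first exact: ltW.
apply: le_trans (ler_wpM2l M0 (Rintegral_expR_le K2 at_)).
rewrite -RintegralZl//; apply: le_Rintegral => //.
  exact: (integrable_mull _ M iE).
Qed.

(** The a priori bound [M] is fed back into the inequality. Each round halves its contribution,
    while the contributions of [A] stay below [2 * A]; then the number of rounds tends to
    infinity. *)
Lemma gronwall_const (K A M a b : R) (u : R -> R) : 0 < K -> 0 <= A -> 0 <= M -> 
  mu.-integrable `[a, b] (EFin \o u) ->
  (forall t, t \in `[a, b] -> u t <= M) ->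
  (forall t, t \in `[a, b] -> u t <= A + K * \int[mu]_(r in `[a, t]) u r) ->
  forall t, t \in `[a, b] -> u t <= 2 * A * expR (2 * K * (t - a)).
Proof.
move=> K0 A0 M0 iu uM uI.
have E1 t : t \in `[a, b] -> 1 <= expR (2 * K * (t - a)).
  rewrite in_itv/= => /andP[at_ _].
  by rewrite -[leLHS]expR0 ler_expR mulr_ge0 ?subr_ge0// mulr_ge0// ltW.
have step k t : t \in `[a, b] ->
    u t <= (2 * A + M / 2 ^+ k) * expR (2 * K * (t - a)).
  elim: k t => [|k IH] t tab.
    rewrite expr0 divr1; apply: (le_trans (uM _ tab)).
    rewrite -[leLHS]mulr1; apply: ler_pM => //; last exact: E1.
    by rewrite lerDr mulr_ge0.
  have [at_ tb] : a <= t /\ t <= b by rewrite !(itvP tab).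
  apply: (le_trans (uI _ tab)).
  have M1 : 0 <= 2 * A + M / 2 ^+ k by rewrite addr_ge0 ?mulr_ge0 ?invr_ge0 ?exprn_ge0.
  have := weighted_integral_le K0 M1 at_ (integrable_subitv tb iu).
  have sub r : r \in `[a, t] -> r \in `[a, b].
    by rewrite !in_itv/= => /andP[-> /le_trans->].
  move=> /(_ (fun r rat => IH r (sub _ rat))) H.
  have AE : A <= A * expR (2 * K * (t - a)) by rewrite ler_peMr// E1.
  apply: (le_trans (lerD AE H)); rewrite -mulrDl ler_wpM2r ?expR_ge0//.
  by rewrite le_eqVlt exprS invfM; apply/orP; left; apply/eqP; field; rewrite expf_neq0.
move=> t tab; set e := expR _.
have e0 : 0 < e := expR_gt0 _.
apply/ler_addgt0Pr => d d0.
have Me : 0 <= M * e / d by rewrite divr_ge0 ?mulr_ge0 ?(ltW e0) ?(ltW d0).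
have [k Hk] : exists k : nat, M * e / d <= 2 ^+ k.
  exists (Num.truncn (M * e / d)).+1.
  have /andP[_ /ltW/le_trans->]// := truncn_itv Me.
  rewrite -natrX ler_nat; exact/ltnW/ltn_expl.
apply: (le_trans (step k t tab)); rewrite mulrDl lerD2l -/e mulrAC.
by rewrite ler_pdivrMr ?exprn_gt0// -ler_pdivrMl// mulrC.
Qed.

Lemma Rintegral_continuous_integrable (a b : R) (u : R -> R) : a <= b ->
  mu.-integrable `[a, b] (EFin \o u) ->
  mu.-integrable `[a, b] (EFin \o (fun t => \int[mu]_(r in `[a, t]) u r)).
Proof.
move=> ab iu; apply: continuous_compact_integrable; first exact: segment_compact.
exact: parameterized_integral_continuous.
Qed.

(* Gronwall with a variable forcing [phi]: apply [gronwall_const] to the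
   continuous function t |-> K * int_a^t u, which needs no bound on [u]. *)
Lemma gronwall_forcing (K a b : R) (u phi : R -> R) : 0 < K -> a <= b ->
  (forall t, t \in `[a, b] -> 0 <= u t) ->
  (forall t, t \in `[a, b] -> 0 <= phi t) ->
  mu.-integrable `[a, b] (EFin \o u) -> mu.-integrable `[a, b] (EFin \o phi) ->
  (forall t, t \in `[a, b] -> u t <= phi t + K * \int[mu]_(r in `[a, t]) u r) ->
  forall t, t \in `[a, b] ->
    u t <= phi t + 2 * K * expR (2 * K * (b - a)) * \int[mu]_(r in `[a, b]) phi r.
Proof.
move=> K0 ab u0 phi0 iu iphi H t tab.
pose v t := K * \int[mu]_(r in `[a, t]) u r.
have iU := Rintegral_continuous_integrable ab iu.
have iv : mu.-integrable `[a, b] (EFin \o v).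
  exact: (integrable_mull _ K iU).
have Iphi0 : 0 <= \int[mu]_(r in `[a, b]) phi r.
  by apply: Rintegral_ge0 => r; exact: phi0.
have vM r : r \in `[a, b] -> v r <= K * \int[mu]_(r in `[a, b]) u r.
  move=> rab; apply: ler_wpM2l; first exact: ltW.
  by apply: Rintegral_subitv_le => //; rewrite (itvP rab).
have := @gronwall_const K (K * \int[mu]_(r in `[a, b]) phi r)
  (K * \int[mu]_(r in `[a, b]) u r) a b v K0 _ _ iv vM _ t tab.
have Ku0 : 0 <= K * \int[mu]_(r in `[a, b]) u r.
  by rewrite mulr_ge0 ?(ltW K0)// Rintegral_ge0// => r; exact: u0.
move=> /(_ (mulr_ge0 (ltW K0) Iphi0) Ku0) G.
apply: (le_trans (H _ tab)); rewrite lerD2l; apply: le_trans (G _) _.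
  move=> r rab; rewrite -/(v r) {1}/v -mulrDr ler_wpM2l ?(ltW K0)//.
  have rb : r <= b by rewrite (itvP rab).
  have sub q : q \in `[a, r] -> q \in `[a, b].
    by rewrite !in_itv/= => /andP[-> /le_trans->].
  apply: (@le_trans _ _ (\int[mu]_(q in `[a, r]) (phi q + v q))).
    apply: le_Rintegral => //.
    - exact: integrable_subitv iu.
    - by apply: integrable_add => //; exact: integrable_subitv rb _.
    - by move=> q qar; apply: H; exact: sub.
  rewrite RintegralD//; try exact: integrable_subitv rb _.
  by rewrite lerD2r; exact: Rintegral_subitv_le.
rewrite mulrA mulrAC ler_wpM2r// ler_wpM2l ?mulr_ge0 ?(ltW K0)// ler_expR.
by rewrite ler_wpM2l ?mulr_ge0 ?(ltW K0)// lerD2r (itvP tab).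
Qed.

End gronwall.

(** * Existence for the state equation *)

Section adapted_processes.
Context (R : realType) d (Om : measurableType d) (P : probability Om R).
Variables (s T : R) (G : R -> set (set Om)).
Hypothesis sT : s <= T.
Hypothesis G_meas : forall t A, t \in `[s, T] -> <<s G t>> A -> measurable A.
Hypothesis G_null : forall t, P.-negligible `<=` <<s G t>>.
Hypothesis G_mono : forall r t, r <= t -> <<s G r>> `<=` <<s G t>>.
Notation mu := (@lebesgue_measure R).

Definition jointly_measurable (Y : R -> Om -> R) :=
  measurable_fun (`[s, T] `*` setT) (fun p : measurableTypeR R * Om => Y p.1 p.2).

Definition adapted_to (Y : R -> Om -> R) := forall t, t \in `[s, T] ->
  @measurable_fun _ _ (g_sigma_algebraType (G t)) R setT (Y t).

Definition continuous_paths (Y : R -> Om -> R) :=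
  forall w, {within `[s, T], continuous (Y ^~ w)}.

Lemma adapted_measurable Y t : adapted_to Y -> t \in `[s, T] -> measurable_fun setT (Y t).
Proof. by move=> aY tsT _ B mB; apply: (@G_meas t) => //; exact: aY. Qed.

Lemma continuous_jointly_measurable Y : continuous_paths Y -> adapted_to Y ->
  jointly_measurable Y.
Proof.
move=> cY aY; apply: measurable_within_continuous => // t tsT.
exact: adapted_measurable.
Qed.

Lemma continuous_paths_integrable Y w : continuous_paths Y ->
  mu.-integrable `[s, T] (EFin \o Y ^~ w).
Proof.
move=> cY; apply: continuous_compact_integrable; first exact: segment_compact.
exact: cY.
Qed.

Lemma jointly_measurable_section Y w : jointly_measurable Y ->
  measurable_fun `[s, T] (Y ^~ w).
Proof.
move=> mY.
have m1 : measurable_fun (`[s, T] : set (measurableTypeR R)) (fun r : measurableTypeR R => (r, w)).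
  by apply: measurable_funTS; exact: pair2_measurable.
apply: (measurable_comp (F := `[s, T] `*` setT) _ _ mY m1) => //.
  by apply: measurableX => //; exact: measurable_itv.
by move=> _ [r rsT <-].
Qed.

Lemma adapted_mono Y r t : adapted_to Y -> r \in `[s, T] -> r <= t ->
  @measurable_fun _ _ (g_sigma_algebraType (G t)) R setT (Y r).
Proof.
by move=> aY rsT rt mD B mB; apply: (G_mono rt); exact: aY.
Qed.

Lemma time_integral_process Y : jointly_measurable Y -> adapted_to Y ->
  (forall w, mu.-integrable `[s, T] (EFin \o Y ^~ w)) ->
  continuous_paths (fun t w => \int[mu]_(r in `[s, t]) Y r w) /\
  adapted_to (fun t w => \int[mu]_(r in `[s, t]) Y r w).
Proof.
move=> mY aY iY; split; first by move=> w; exact: parameterized_integral_continuous.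
move=> t tsT; have [st tT] : s <= t /\ t <= T by rewrite !(itvP tsT).
apply: Hmeas_time_integral => //.
- by move=> A; exact: G_meas.
- apply: measurable_funS mY; first by apply: measurableX => //; exact: measurable_itv.
  by move=> [r w] /= []; rewrite !in_itv/= => /andP[-> /le_trans->].
- move=> r; rewrite in_itv/= => /andP[sr rt]; apply: adapted_mono => //.
  by rewrite in_itv/= sr (le_trans rt).
- by move=> w; exact: integrable_subitv (iY w).
Qed.

End adapted_processes.

Section geometric_cauchy.
Context (R : realType).

Lemma geometric_increments_cvg (x : nat -> R) (C : R) :
  (forall k, `|x k.+1 - x k| <= C / 2 ^+ k) ->
  cvgn x /\ forall k, `|limn x - x k| <= 2 * C / 2 ^+ k.
Proof.
move=> H.
have C0 : 0 <= C by have := H 0%N; rewrite expr0 divr1; exact: le_trans.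
have H2 k m : `|x (k + m)%N - x k| <= 2 * C / 2 ^+ k.
  (* The tail still to come is subtracted so that the induction on [m] closes. *)
  suff : `|x (k + m)%N - x k| <= 2 * C / 2 ^+ k - 2 * C / 2 ^+ (k + m).
    move=> /le_trans; apply; rewrite gerBl// divr_ge0 ?mulr_ge0 ?exprn_ge0//.
  elim: m => [|m IH]; first by rewrite addn0 !subrr normr0.
  rewrite addnS -(subrKA (x (k + m)%N)).
  apply: (le_trans (ler_normD _ _)); apply: (le_trans (lerD (H _) IH)).
  rewrite [2 ^+ (k + m).+1]exprS invfM; set a := (2 ^+ (k + m))^-1.
  lra.
have cx : cvgn x.
  apply/cauchy_cvgP/cauchy_exP => e e0.
  have [k Hk] : exists k : nat, 2 * C / e < 2 ^+ k.
    have Ce : 0 <= 2 * C / e by rewrite divr_ge0 ?mulr_ge0// ltW.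
    exists (Num.truncn (2 * C / e)).+1.
    have /andP[_ /lt_le_trans->]// := truncn_itv Ce.
    rewrite -natrX ler_nat; exact/ltnW/ltn_expl.
  exists (x k); exists k => // m /= km.
  rewrite /ball/= distrC -(subnKC km) (le_lt_trans (H2 k _))//.
  by rewrite ltr_pdivrMr ?exprn_gt0// -ltr_pdivrMl// mulrC.
split => // k.
have cxk : `|x (m + k)%N - x k| @[m --> \oo] --> `|limn x - x k|.
  apply: cvg_norm; apply: cvgB; last exact: cvg_cst.
  by rewrite cvg_shiftn; exact: cx.
apply: (cvgr_to_le cxk); apply: nearW => m.
by rewrite addnC.
Qed.

Lemma le_geometric_le0 (a C : R) : (forall k, a <= C / 2 ^+ k) -> a <= 0.
Proof.
move=> H; rewrite leNgt; apply/negP => a0.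
have C0 : 0 < C by have := H 0%N; rewrite expr0 divr1; exact: lt_le_trans.
have [k Hk] : exists k : nat, C / a < 2 ^+ k.
  have Ca : 0 <= C / a by rewrite divr_ge0// ltW.
  exists (Num.truncn (C / a)).+1.
  have /andP[_ /lt_le_trans->]// := truncn_itv Ca.
  rewrite -natrX ler_nat; exact/ltnW/ltn_expl.
have := H k; rewrite leNgt => /negP; apply.
by rewrite ltr_pdivrMr ?exprn_gt0// -ltr_pdivrMl// mulrC.
Qed.

End geometric_cauchy.

(** * The drift along adapted processes *)

Section drift_process.
Context (R : realType) (T : R) (f : R -> R -> R -> P2 R -> R)
  (f_mu : R -> R -> R -> P2 R -> R -> R).
Hypothesis f_assum : drift_assumption T f f_mu.
Variable K : R.
Hypothesis K_ge0 : 0 <= K.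
Hypothesis f_lip : forall t s th th' n (x y : 'rV[R]_n.+1) i,
  t \in `[0, T] -> s \in `[0, T] ->
  `|f t th (x ord0 i) (empirical x) - f s th' (y ord0 i) (empirical y)| <=
  K * (`|t - s| + `|th - th'| + \sum_j `|x ord0 j - y ord0 j|).
Notation mu := (@lebesgue_measure R).

Definition drift n (i : 'I_n.+1) (t th : R) (x : 'rV[R]_n.+1) : R :=
  f t th (x ord0 i) (empirical x).

Lemma drift_growth n (i : 'I_n.+1) t th x : t \in `[0, T] ->
  `|drift i t th x| <= `|drift i 0 0 0| + K * (T + `|th| + \sum_j `|x ord0 j|).
Proof.
move=> t0T; have [t0 tT] : 0 <= t /\ t <= T by rewrite !(itvP t0T).
have z0T : 0 \in `[0, T] by rewrite in_itv/= lexx (le_trans t0).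
have := f_lip th 0 x 0 i t0T z0T; rewrite !subr0 (ger0_norm t0).
under eq_bigr do rewrite mxE subr0.
move=> H; have := lerB_normD (drift i t th x) (- drift i 0 0 0).
rewrite normrN => H2; rewrite -lerBlDl (le_trans H2)// (le_trans H)//.
by rewrite ler_wpM2l// lerD2r lerD2r.
Qed.

(** The drift is a Lipschitz function of the row made of time, control and positions, with time
    clamped to [[0, T]] where the Lipschitz bound holds. The source [S] is left arbitrary: taken as
    a product it gives joint measurability, taken as [Om] with a filtration it gives adaptedness. *)
Lemma measurable_drift n (i : 'I_n.+1) d (S : measurableType d) (D : set S)
    (tau th : S -> R) (X : S -> 'rV[R]_n.+1) : 0 <= T ->
  (forall p, D p -> tau p \in `[0, T]) ->
  measurable_fun D tau -> measurable_fun D th ->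
  (forall j, measurable_fun D (fun p => X p ord0 j)) ->
  measurable_fun D (fun p => drift i (tau p) (th p) (X p)).
Proof.
move=> T0 tauD mtau mth mX.
pose cl r := Num.max 0 (Num.min T r).
have cl0T r : cl r \in `[0, T].
  by rewrite in_itv/= le_max lexx/= ge_max T0 ge_min lexx.
have cl_lip r q : `|cl r - cl q| <= `|r - q|.
  have := ler_norm (r - q); have := ler_norm (- (r - q)); rewrite normrN => h1 h2.
  rewrite ler_norml /cl /Num.max /Num.min.
  by case: (ltP T r); case: (ltP T q); repeat case: ifPn; lra.
pose Phi (z : 'rV[R]_(2 + n.+1)) := drift i (cl (z ord0 (lshift _ ord0)))
  (z ord0 (lshift _ (lift ord0 ord0))) (\row_j z ord0 (rshift 2 j)).
pose Y (k : 'I_(2 + n.+1)) (p : S) : R := match fintype.split k with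
  | inl a => if a == ord0 then tau p else th p
  | inr j => X p ord0 j end.
have mY k : measurable_fun D (Y k).
  rewrite /Y; case: (fintype.split k) => [a|j]; last exact: mX.
  by case: (a == ord0).
have Phi_lip x y : `|Phi x - Phi y| <= K * \sum_k `|x ord0 k - y ord0 k|.
  apply: (le_trans (f_lip _ _ _ _ _ (cl0T _) (cl0T _))); apply: ler_wpM2l => //.
  rewrite [leRHS]big_split_ord/= [X in _ <= X + _]big_ord_recl.
  rewrite [X in _ <= _ + X + _]big_ord1; apply: lerD.
    by rewrite lerD2r; exact: cl_lip.
  by apply: ler_sum => j _; rewrite !mxE.
have := measurable_lipschitz_comp Phi_lip mY.
apply: eq_measurable_fun => p; rewrite inE => Dp.
have splitl (a : 'I_2) : fintype.split (lshift n.+1 a) = inl a := unsplitK (inl a).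
have splitr (j : 'I_n.+1) : fintype.split (rshift 2 j) = inr j := unsplitK (inr j).
rewrite /Phi !mxE /Y !splitl /=.
have -> : cl (tau p) = tau p.
  by have := tauD _ Dp; rewrite /cl in_itv/= => /andP[h1 h2]; rewrite min_r// max_r.
congr (drift _ _ _ _); apply/rowP => j; rewrite !mxE /Y.
by rewrite splitr.
Qed.

Context d (Om : measurableType d) (P : probability Om R).
Variables (s : R) (G : R -> set (set Om)).
Hypothesis s_ge0 : 0 <= s.
Hypothesis sT : s <= T.
Hypothesis G_meas : forall t A, t \in `[s, T] -> <<s G t>> A -> measurable A.
Hypothesis G_null : forall t, P.-negligible `<=` <<s G t>>.
Hypothesis G_mono : forall r t, r <= t -> <<s G r>> `<=` <<s G t>>.

Variable theta : R -> Om -> R.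
Hypothesis theta_jm : jointly_measurable s T theta.
Hypothesis theta_ad : adapted_to s T G theta.
Hypothesis theta_int : forall w, mu.-integrable `[s, T] (EFin \o theta ^~ w).

Let T_ge0 : 0 <= T. Proof. exact: le_trans s_ge0 sT. Qed.

Let in0T t : t \in `[s, T] -> t \in `[0, T].
Proof. by rewrite !in_itv/= => /andP[/(le_trans s_ge0)-> ->]. Qed.

Definition coord_process n (X : R -> Om -> 'rV[R]_n.+1) (j : 'I_n.+1) t w := X t w ord0 j.

Lemma drift_path_integrable n (i : 'I_n.+1) (th : R -> R) (X : R -> 'rV[R]_n.+1) :
  mu.-integrable `[s, T] (EFin \o th) ->
  (forall j, mu.-integrable `[s, T] (EFin \o (fun t => X t ord0 j))) ->
  mu.-integrable `[s, T] (EFin \o (fun t => drift i t (th t) (X t))).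
Proof.
move=> ith iX.
have mab : measurable (`[s, T]%classic : set (measurableTypeR R)).
  exact: measurable_itv.
have mEP (u : R -> R) : mu.-integrable `[s, T] (EFin \o u) -> measurable_fun `[s, T] u.
  by case/integrableP => /measurable_EFinP.
pose g t := `|drift i 0 0 0| + K * (T + `|th t| + \sum_j `|X t ord0 j|).
have ig : mu.-integrable `[s, T] (EFin \o g).
  have ic (c : R) : mu.-integrable `[s, T] (EFin \o cst c).
    apply: continuous_compact_integrable; first exact: segment_compact.
    by apply: continuous_subspaceT => ?; exact: cvg_cst.
  apply: (integrable_add mab (ic _)); apply: (integrable_mull mab).
  apply: (integrable_add mab).
    by apply: (integrable_add mab (ic _)); exact: integrable_norm.
  by apply: (integrable_bigsum mab) => j; exact: (integrable_norm (iX j)).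
apply: (le_integrable mab _ _ ig).
  apply/measurable_EFinP; apply: measurable_drift => //.
  - exact: mEP.
  - by move=> j; apply: mEP.
move=> t tsT; rewrite lee_fin [leRHS]ger0_norm; last first.
  by rewrite addr_ge0// mulr_ge0// addr_ge0// ?addr_ge0// sumr_ge0.
by apply: drift_growth; exact: in0T.
Qed.

Lemma drift_process n (i : 'I_n.+1) (X : R -> Om -> 'rV[R]_n.+1) :
  (forall j, jointly_measurable s T (coord_process X j)) ->
  (forall j, adapted_to s T G (coord_process X j)) ->
  jointly_measurable s T (fun t w => drift i t (theta t w) (X t w)) /\
  adapted_to s T G (fun t w => drift i t (theta t w) (X t w)).
Proof.
move=> mX aX; split.
  apply: (@measurable_drift _ i _ (measurableTypeR R * Om)%type _ fst) => //.
  - by move=> [t w] [/= tsT _]; exact: in0T.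
  - by apply: measurable_funTS; exact: measurable_fst.
move=> t tsT; apply: (@measurable_drift _ i _ (g_sigma_algebraType (G t)) _ (cst t)) => //.
- by move=> w _; exact: in0T.
- exact: theta_ad.
- by move=> j; exact: aX.
Qed.

Lemma drift_sum_lip n t th (x y : 'rV[R]_n.+1) : t \in `[0, T] ->
  \sum_i `|drift i t th x - drift i t th y| <=
  n.+1%:R * K * \sum_j `|x ord0 j - y ord0 j|.
Proof.
move=> tT; apply: (@le_trans _ _ (\sum_(i < n.+1) K * \sum_j `|x ord0 j - y ord0 j|)).
  apply: ler_sum => i _; apply: (le_trans (f_lip _ _ _ _ _ tT tT)).
  by rewrite !subrr normr0 !add0r.
by rewrite sumr_const card_ord -mulrA mulr_natl.
Qed.

(** * Picard iteration *)

Section picard.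
Variables (n : nat) (F : R -> Om -> 'rV[R]_n.+1).
Hypothesis F_ct : forall i, continuous_paths s T (coord_process F i).
Hypothesis F_ad : forall i, adapted_to s T G (coord_process F i).

Let b (X : R -> Om -> 'rV[R]_n.+1) i t w := drift i t (theta t w) (X t w).

(** [F] gathers the initial position and the noise, which enter additively, so the iteration runs
    for each [w] separately. *)
Fixpoint picard (k : nat) : R -> Om -> 'rV[R]_n.+1 := fun t w => match k with
  | 0 => F t w
  | k'.+1 => \row_i (F t w ord0 i + \int[mu]_(r in `[s, t]) b (picard k') i r w)
  end.

Lemma jm_integrable_ct X : (forall i, continuous_paths s T (coord_process X i)) ->
  forall i w, mu.-integrable `[s, T] (EFin \o b X i ^~ w).
Proof.
move=> cX i w; apply: drift_path_integrable => // j.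
exact: continuous_paths_integrable (cX j).
Qed.

Lemma picard_process k : (forall i, continuous_paths s T (coord_process (picard k) i)) /\
  (forall i, adapted_to s T G (coord_process (picard k) i)).
Proof.
elim: k => [|k [ck ak]]; first by split; [exact: F_ct | exact: F_ad].
have jk i : jointly_measurable s T (coord_process (picard k) i).
  exact: (continuous_jointly_measurable sT G_meas).
have bk i := drift_process i jk ak.
have Ik i := time_integral_process sT G_meas G_null G_mono (bk i).1 (bk i).2
  (jm_integrable_ct ck i).
have E i : coord_process (picard k.+1) i =
    fun t w => coord_process F i t w + \int[mu]_(r in `[s, t]) b (picard k) i r w.
  by apply/funext => t; apply/funext => w; rewrite /coord_process/= mxE.
split=> i; rewrite E.
  move=> w x; apply: (@continuousD _ _ (subspace `[s, T])); first exact: F_ct.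
  exact: (Ik i).1.
move=> t tsT; apply: (@measurable_funD _ (g_sigma_algebraType (G t))).
  exact: F_ad.
exact: (Ik i).2.
Qed.

(** In the sum norm the drift of the whole system is [n.+1%:R * K]-Lipschitz; the added 1 keeps the
    constant positive when [K = 0]. *)
Let Kn := n.+1%:R * K + 1.
Let Kn_gt0 : 0 < Kn. Proof. by rewrite ltr_wpDl// mulr_ge0. Qed.
Let E t := expR (2 * Kn * (t - s)).

Let mab : measurable (`[s, T]%classic : set (measurableTypeR R)).
Proof. exact: measurable_itv. Qed.

Let dist (X Y : R -> Om -> 'rV[R]_n.+1) t w := \sum_i `|X t w ord0 i - Y t w ord0 i|.

(** The Picard map halves the distance weighted by [E]. *)
Lemma drift_integral_dist (X Y : R -> Om -> 'rV[R]_n.+1) w M :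
  (forall i, mu.-integrable `[s, T] (EFin \o coord_process X i ^~ w)) ->
  (forall i, mu.-integrable `[s, T] (EFin \o coord_process Y i ^~ w)) ->
  0 <= M -> (forall t, t \in `[s, T] -> dist X Y t w <= M * E t) ->
  forall t, t \in `[s, T] ->
  \sum_i `|\int[mu]_(r in `[s, t]) b X i r w - \int[mu]_(r in `[s, t]) b Y i r w| <=
    M / 2 * E t.
Proof.
move=> iX iY M0 H t tsT; have [st tT] : s <= t /\ t <= T by rewrite !(itvP tsT).
have mst : measurable (`[s, t]%classic : set (measurableTypeR R)).
  exact: measurable_itv.
have ib Z i : (forall i, mu.-integrable `[s, T] (EFin \o coord_process Z i ^~ w)) ->
    mu.-integrable `[s, t] (EFin \o b Z i ^~ w).
  move=> iZ; apply: (integrable_subitv tT).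
  by apply: (@drift_path_integrable _ _ (theta ^~ w) (Z ^~ w)).
have iB i : mu.-integrable `[s, t] (EFin \o (fun r => b X i r w - b Y i r w)).
  have := integrableB mst (ib X i iX) (ib Y i iY).
  by apply: eq_integrable => // r _ /=; rewrite EFinB.
have iD : mu.-integrable `[s, t] (EFin \o (fun r => dist X Y r w)).
  apply: (integrable_subitv tT); apply: (integrable_bigsum mab) => i.
  have := integrable_norm (integrableB mab (iX i) (iY i)).
  by apply: eq_integrable => // r _ /=.
apply: (@le_trans _ _ (\int[mu]_(r in `[s, t]) \sum_i `|b X i r w - b Y i r w|)).
  rewrite Rintegral_sum//; last by move=> i; exact: (integrable_norm (iB i)).
  apply: ler_sum => i _; rewrite -RintegralB//; [|exact: ib|exact: ib].
  exact: le_normr_Rintegral.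
have sub r : r \in `[s, t] -> r \in `[s, T].
  by rewrite !in_itv/= => /andP[-> /le_trans->].
apply: le_trans (weighted_integral_le Kn_gt0 M0 st iD (fun r rst => H _ (sub _ rst))).
rewrite -RintegralZl//; apply: le_Rintegral => //.
- by apply: (integrable_bigsum mst) => i; exact: (integrable_norm (iB i)).
- exact: (integrable_mull mst).
- move=> r rst; apply: (le_trans (drift_sum_lip _ _ _ (in0T (sub _ rst)))).
  by rewrite ler_wpM2r ?sumr_ge0// /Kn lerDl.
Qed.

Lemma picard_step w : exists2 M, 0 <= M & forall k t, t \in `[s, T] ->
  dist (picard k.+1) (picard k) t w <= M / 2 ^+ k * E t.
Proof.
have E1 t : t \in `[s, T] -> 1 <= E t.
  rewrite in_itv/= => /andP[at_ _].
  by rewrite -[leLHS]expR0 ler_expR mulr_ge0 ?subr_ge0// mulr_ge0// ltW.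
have ip k i : mu.-integrable `[s, T] (EFin \o coord_process (picard k) i ^~ w).
  exact: continuous_paths_integrable ((picard_process k).1 i).
pose g i t := `|\int[mu]_(r in `[s, t]) b (picard 0) i r w|.
have gle i t : t \in `[s, T] -> g i t <= \int[mu]_(r in `[s, T]) `|b (picard 0) i r w|.
  move=> tsT; have [st tT] : s <= t /\ t <= T by rewrite !(itvP tsT).
  have ib := jm_integrable_ct (picard_process 0).1 i w.
  apply: (le_trans (le_normr_Rintegral _ (integrable_subitv tT ib))).
    exact: measurable_itv.
  by apply: Rintegral_subitv_le => //; exact: (integrable_norm ib).
exists (\sum_i \int[mu]_(r in `[s, T]) `|b (picard 0) i r w|).
  by apply: sumr_ge0 => i _; apply: Rintegral_ge0.
elim=> [|k IH] t tsT.
  rewrite expr0 divr1; apply: (@le_trans _ _ (\sum_i g i t)).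
    by apply: ler_sum => i _; rewrite /= mxE addrAC subrr add0r.
  rewrite -[leLHS]mulr1; apply: ler_pM => //; last exact: E1.
    by apply: sumr_ge0 => i _; rewrite /g.
  by apply: ler_sum => i _; exact: gle.
set M := \sum_i _ in IH *.
have M0 : 0 <= M / 2 ^+ k.
  by rewrite divr_ge0 ?exprn_ge0// sumr_ge0// => i _; apply: Rintegral_ge0.
rewrite exprSr invfM mulrA.
apply: le_trans (drift_integral_dist (ip k.+1) (ip k) M0 IH tsT).
by apply: ler_sum => i _; rewrite /= !mxE opprD addrACA subrr add0r.
Qed.

(** The iterates converge for all [t] and [w], so the limit inherits adaptedness and joint
    measurability. Its continuity is read off the integral equation once that is established. *)
Lemma sde_exists : exists X : R -> Om -> 'rV[R]_n.+1,
  [/\ forall i, continuous_paths s T (coord_process X i),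
      forall i, adapted_to s T G (coord_process X i) &
      forall w i t, t \in `[s, T] ->
        X t w ord0 i = F t w ord0 i + \int[mu]_(r in `[s, t]) b X i r w].
Proof.
pose X t w : 'rV[R]_n.+1 := \row_i limn (fun k => picard k t w ord0 i).
have Xcvg w : exists2 M, 0 <= M & forall i t, t \in `[s, T] ->
    picard k t w ord0 i @[k --> \oo] --> X t w ord0 i /\
    forall k, `|X t w ord0 i - picard k t w ord0 i| <= 2 * (M * E t) / 2 ^+ k.
  have [M M0 HM] := picard_step w; exists M => // i t tsT.
  have Hk k : `|picard k.+1 t w ord0 i - picard k t w ord0 i| <= M * E t / 2 ^+ k.
    rewrite mulrAC; apply: le_trans (HM k t tsT); rewrite /dist (bigD1 i)//=.
    by rewrite lerDl sumr_ge0.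
  have [cx lx] := geometric_increments_cvg Hk.
  by rewrite /X mxE; split.
have aX i : adapted_to s T G (coord_process X i).
  move=> t tsT; apply: (@measurable_fun_cvg _ (g_sigma_algebraType (G t)) _ _
    (fun k w => coord_process (picard k) i t w)) => [k|w _].
    exact: (picard_process k).2.
  by have [M _ /(_ i t tsT)[]] := Xcvg w.
have jX i : jointly_measurable s T (coord_process X i).
  apply: (@measurable_fun_cvg _ _ _ _ (fun k p => coord_process (picard k) i p.1 p.2)) =>
    [k|[t w] /= [tsT _]].
    exact: (continuous_jointly_measurable sT G_meas ((picard_process k).1 i) ((picard_process k).2 i)).
  by have [M _ /(_ i t tsT)[]] := Xcvg w.
have ip k i w : mu.-integrable `[s, T] (EFin \o coord_process (picard k) i ^~ w).
  exact: continuous_paths_integrable ((picard_process k).1 i).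
have iX i w : mu.-integrable `[s, T] (EFin \o coord_process X i ^~ w).
  have [M M0 HM] := Xcvg w.
  have ig : mu.-integrable `[s, T] (EFin \o (fun t => `|coord_process (picard 0) i t w| + 2 * M * E t)).
    apply: (integrable_add mab); first exact: (integrable_norm (ip 0%N i w)).
    by apply: (integrable_mull mab); exact: integrable_expR_affine.
  apply: (le_integrable mab _ _ ig).
    by apply/measurable_EFinP; exact: jointly_measurable_section.
  move=> t tsT; rewrite lee_fin [leRHS]ger0_norm; last first.
    by rewrite addr_ge0// mulr_ge0 ?mulr_ge0// expR_ge0.
  have := (HM i t tsT).2 0%N; rewrite expr0 divr1 mulrA /coord_process => H.
  by rewrite -lerBlDl (le_trans (lerB_dist _ _)).
have eqX w i t : t \in `[s, T] ->
    X t w ord0 i = F t w ord0 i + \int[mu]_(r in `[s, t]) b X i r w.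
  move=> tsT; have [M M0 HM] := Xcvg w.
  apply/eqP; rewrite -subr_eq0 -normr_le0.
  (* The defect in the equation splits into the distance of [X] to the iterate [k.+1] and the
     distance of the drift integrals of [X] and of the iterate [k]. Both are geometric in [k], so
     the defect is 0. *)
  apply: (@le_geometric_le0 _ _ (2 * (M * E t) + n.+1%:R * (2 * M) * E t)) => k.
  have M1 : 0 <= n.+1%:R * (2 * M) / 2 ^+ k.
    by rewrite divr_ge0 ?mulr_ge0 ?exprn_ge0.
  have Dk r : r \in `[s, T] -> dist X (picard k) r w <= n.+1%:R * (2 * M) / 2 ^+ k * E r.
    move=> rsT; apply: (@le_trans _ _ (\sum_(i < n.+1) (2 * (M * E r) / 2 ^+ k))).
      by apply: ler_sum => j _; exact: (HM j r rsT).2.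
    rewrite sumr_const card_ord -mulr_natl le_eqVlt; apply/orP; left; apply/eqP; ring.
  have := drift_integral_dist (fun i => iX i w) (ip k ^~ w) M1 Dk tsT.
  have := (HM i t tsT).2 k.+1.
  set BX := fun i => \int[mu]_(r in `[s, t]) b X i r w.
  set Bk := fun i => \int[mu]_(r in `[s, t]) b (picard k) i r w.
  rewrite -[\int[mu]_(r in `[s, t]) b X i r w]/(BX i) => H1 H2.
  have {}H2 : `|BX i - Bk i| <= n.+1%:R * (2 * M) / 2 ^+ k / 2 * E t.
    by apply: le_trans H2; rewrite (bigD1 i)//= lerDl sumr_ge0.
  rewrite [picard k.+1 _ _ _ _]mxE -[\int[mu]_(r in `[s, t]) _]/(Bk i) in H1.
  rewrite (_ : _ - _ = (X t w ord0 i - (F t w ord0 i + Bk i)) + (Bk i - BX i)); last by ring.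
  rewrite (le_trans (ler_normD _ _))// [`|Bk i - _|]distrC (le_trans (lerD H1 H2))//.
  rewrite exprS invfM; set c := (2 ^+ k)^-1.
  have c0 : 0 <= c by rewrite invr_ge0 exprn_ge0.
  have E0 : 0 <= E t := expR_ge0 _.
  have h1 := mulr_ge0 (mulr_ge0 M0 E0) c0.
  have h2 := mulr_ge0 (mulr_ge0 (mulr_ge0 (ler0n R n.+1) M0) E0) c0.
  lra.
exists X; split => // i w.
have : {within `[s, T], continuous (fun t => coord_process F i t w + \int[mu]_(r in `[s, t]) b X i r w)}.
  move=> x; apply: (@continuousD _ _ (subspace `[s, T])); first exact: F_ct.
  apply: parameterized_integral_continuous => //.
  by apply: (@drift_path_integrable _ _ (theta ^~ w) (X ^~ w)) => // j; exact: iX.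
apply: subspace_eq_continuous => t; rewrite inE => tsT.
exact/esym/(eqX w i t tsT).
Qed.

End picard.
End drift_process.

(** * Pathwise stability of the cost *)

Lemma derivable_lip_growth (R : realType) (phi : R -> R) (C11 C10 C20 : R) :
  cost_assumption phi C11 C10 C20 ->
  [/\ 0 <= C11, 0 <= C10, continuous phi &
    forall a b, `|phi a - phi b| <= (C11 * (`|a| + `|b|) + C10) * `|a - b|].
Proof.
move=> H; have C10_ge0 : 0 <= C10.
  by have := cost_d1 H 0; rewrite normr0 mulr0 add0r; exact: le_trans.
have C11_ge0 : 0 <= C11.
  (* A negative [C11] would bound the absolute value of the derivative by -1 at the point chosen
     below. *)
  rewrite leNgt; apply/negP => C11_lt0.
  have y0 : 0 <= (C10 + 1) / - C11.
    by rewrite divr_ge0 ?addr_ge0// oppr_ge0 ltW.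
  have := le_trans (normr_ge0 _) (cost_d1 H ((C10 + 1) / - C11)).
  rewrite (ger0_norm y0) invrN mulrN mulrN mulrCA mulfV ?lt_eqF// mulr1.
  lra.
have dphi (x : R) : is_derive x (1 : R) phi (phi^`()%classic x).
  by rewrite derive1E; split => //; exact: cost_derivable H x.
split => //.
  move=> x; apply: differentiable_continuous; apply/derivable1_diffP.
  exact: cost_derivable H x.
suff Hlt a b : a <= b -> `|phi b - phi a| <= (C11 * (`|a| + `|b|) + C10) * (b - a).
  move=> a b; have [ab|ba] := leP a b.
    by rewrite distrC (distrC a) (ger0_norm (_ : 0 <= b - a)) ?subr_ge0// Hlt.
  by rewrite (gtr0_norm (_ : 0 < a - b)) ?subr_gt0// (addrC `|a|) Hlt// ltW.
move=> ab.
have [c cab ->] := MVT_segment ab (fun x _ => dphi x)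
  (derivable_within_continuous (fun x _ => @ex_derive _ _ _ _ _ _ _ (dphi x))).
rewrite normrM (ger0_norm (_ : 0 <= b - a)) ?subr_ge0// ler_wpM2r ?subr_ge0//.
apply: (le_trans (cost_d1 H c)); rewrite lerD2r ler_wpM2l//.
move: cab; rewrite in_itv/= => /andP[ac cb].
have h1 := ler_norm b; have h2 := ler_norm (- a); rewrite normrN in h2.
have h3 := normr_ge0 a; have h4 := normr_ge0 b.
by rewrite ler_norml; apply/andP; split; lra.
Qed.

Lemma EFin_Rintegral d (T : measurableType d) (R : realType)
    (m : {measure set T -> \bar R}) (D : set T) (u : T -> R) : measurable D ->
  m.-integrable D (EFin \o u) ->
  (\int[m]_(r in D) (u r)%:E)%E = (\int[m]_(r in D) u r)%:E.
Proof. by move=> mD iu; rewrite /Rintegral fineK//; exact: (integrable_fin_num mD iu). Qed.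

Section path_estimates.
Context (R : realType) (T : R) (f : R -> R -> R -> P2 R -> R) (K : R).
Hypothesis K_ge0 : 0 <= K.
Hypothesis f_lip : forall t s th th' n (x y : 'rV[R]_n.+1) i,
  t \in `[0, T] -> s \in `[0, T] ->
  `|f t th (x ord0 i) (empirical x) - f s th' (y ord0 i) (empirical y)| <=
  K * (`|t - s| + `|th - th'| + \sum_j `|x ord0 j - y ord0 j|).
Variables (sigma s : R).
Hypotheses (s_ge0 : 0 <= s) (sT : s <= T).
Notation mu := (@lebesgue_measure R).

Let T_ge0 : 0 <= T. Proof. exact: le_trans s_ge0 sT. Qed.
Let in0T t : t \in `[s, T] -> t \in `[0, T].
Proof. by rewrite !in_itv/= => /andP[/(le_trans s_ge0)-> ->]. Qed.
Let mab : measurable (`[s, T]%classic : set (measurableTypeR R)).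
Proof. exact: measurable_itv. Qed.

(** [solution] with [w] frozen. [W] and [th] become deterministic functions, so that the estimates
    of this section involve no probability. *)
Record path_solution (W : nat -> R -> R) (th : R -> R) (eps : R)
    n (x : 'rV[R]_n.+1) (X : R -> 'rV[R]_n.+1) : Prop := {
  path_cont : forall i, {within `[s, T], continuous (fun t => X t ord0 i)};
  path_integrable : forall i,
    mu.-integrable `[s, T] (EFin \o (fun r => drift f i r (th r) (X r)));
  path_eq : forall i t, t \in `[s, T] -> X t ord0 i = x ord0 i
    + \int[mu]_(r in `[s, t]) drift f i r (th r) (X r)
    + sigma * (W 0 t - W 0 s) + eps * (W i.+1 t - W i.+1 s) }.

Let Kn n := n.+1%:R * K + 1.
Let Kn_gt0 n : 0 < Kn n. Proof. by rewrite ltr_wpDl// mulr_ge0. Qed.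
Definition gronwall_cst n := 2 * Kn n * expR (2 * Kn n * T).

Lemma gronwall_cst_ge0 n : 0 <= gronwall_cst n.
Proof. by rewrite mulr_ge0 ?expR_ge0// mulr_ge0// ltW. Qed.

Lemma continuous_itv_integrable (u : R -> R) :
  {within `[s, T], continuous u} -> mu.-integrable `[s, T] (EFin \o u).
Proof. by move=> cu; apply: continuous_compact_integrable => //; exact: segment_compact. Qed.

Lemma gronwall_path n (u phi : R -> R) :
  (forall t, t \in `[s, T] -> 0 <= u t) ->
  (forall t, t \in `[s, T] -> 0 <= phi t) ->
  mu.-integrable `[s, T] (EFin \o u) -> mu.-integrable `[s, T] (EFin \o phi) ->
  (forall t, t \in `[s, T] -> u t <= phi t + n.+1%:R * K * \int[mu]_(r in `[s, t]) u r) ->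
  forall t, t \in `[s, T] ->
    u t <= phi t + gronwall_cst n * \int[mu]_(r in `[s, T]) phi r.
Proof.
move=> u0 phi0 iu iphi H t tsT.
have I0 : 0 <= \int[mu]_(r in `[s, T]) phi r by apply: Rintegral_ge0 => r; exact: phi0.
apply: (@le_trans _ _ (phi t + 2 * Kn n * expR (2 * Kn n * (T - s)) * \int[mu]_(r in `[s, T]) phi r)).
  apply: gronwall_forcing => // q qsT; apply: (le_trans (H q qsT)).
  rewrite lerD2l ler_wpM2r ?lerDl//; apply: Rintegral_ge0 => r rsq.
  apply: u0; move: rsq; rewrite /= !in_itv/= => /andP[-> /le_trans->]//.
  by rewrite (itvP qsT).
rewrite lerD2l ler_wpM2r// ler_wpM2l ?mulr_ge0 ?(ltW (Kn_gt0 n))// ler_expR.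
by rewrite ler_wpM2l ?mulr_ge0 ?(ltW (Kn_gt0 n))// gerBl.
Qed.

Section compare.
Variables (W : nat -> R -> R) (th : R -> R).
Hypothesis W_cont : forall i, {within `[s, T], continuous (W i)}.

(** The [n.+2] terms are the common noise, of index 0, and the individual noises of [n.+1]
    particles. *)
Definition noise_size n t := \sum_(i < n.+2) `|W i t - W i s|.

Lemma noise_size_ge0 n t : 0 <= noise_size n t.
Proof. exact: sumr_ge0. Qed.

Lemma noise_size_cont n : {within `[s, T], continuous (noise_size n)}.
Proof.
rewrite (_ : noise_size n = \sum_(i < n.+2) (fun t => `|W i t - W i s|)); last first.
  by apply/funext => t; rewrite fct_sumE.
elim/big_ind: _ => [|g h cg ch|i _].
- by apply: continuous_subspaceT => t; exact: cvg_cst.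
- by move=> t; apply: (@continuousD _ _ (subspace `[s, T])); [exact: cg|exact: ch].
move=> t; apply: cvg_norm; apply: cvgB; [exact: W_cont|exact: cvg_cst].
Qed.

Lemma noise_size_integrable n : mu.-integrable `[s, T] (EFin \o noise_size n).
Proof. exact/continuous_itv_integrable/noise_size_cont. Qed.

(** Initial positions and common noise cancel in the difference, which is forced by [eps1 - eps2]
    times the individual noise alone; Gronwall's inequality absorbs the drift. For equal noise
    levels this is uniqueness. *)
Lemma path_compare n (x : 'rV[R]_n.+1) eps1 eps2 X1 X2 :
  path_solution W th eps1 x X1 -> path_solution W th eps2 x X2 ->
  forall t, t \in `[s, T] -> \sum_i `|X1 t ord0 i - X2 t ord0 i| <=
    `|eps1 - eps2| * (noise_size n t + gronwall_cst n * \int[mu]_(r in `[s, T]) noise_size n r).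
Proof.
move=> [c1 i1 e1] [c2 i2 e2] t tsT.
pose u (t : R) : R := \sum_i `|X1 t ord0 i - X2 t ord0 i|.
pose phi (t : R) : R := `|eps1 - eps2| * noise_size n t.
have iphi : mu.-integrable `[s, T] (EFin \o phi).
  by apply: (integrable_mull mab); exact: noise_size_integrable.
have iu : mu.-integrable `[s, T] (EFin \o u).
  apply: (integrable_bigsum mab) => i.
  have := integrable_norm (integrableB mab (continuous_itv_integrable (c1 i))
     (continuous_itv_integrable (c2 i))).
  by apply: eq_integrable => // r _ /=.
rewrite mulrDr mulrCA -RintegralZl//; last exact: noise_size_integrable.
apply: (@gronwall_path n u phi) => //.
- by move=> r _; exact: sumr_ge0.
- by move=> r _; rewrite mulr_ge0// noise_size_ge0.
move=> q qsT; have [sq qT] : s <= q /\ q <= T by rewrite !(itvP qsT).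
have msq : measurable (`[s, q]%classic : set (measurableTypeR R)).
  exact: measurable_itv.
pose Dd i r := drift f i r (th r) (X1 r) - drift f i r (th r) (X2 r).
have i1q i := integrable_subitv qT (i1 i).
have i2q i := integrable_subitv qT (i2 i).
have iD i : mu.-integrable `[s, q] (EFin \o Dd i).
  have := integrableB msq (i1q i) (i2q i).
  by apply: eq_integrable => // r _ /=; rewrite EFinB.
have u1 : u q <= \sum_(i < n.+1) (`|eps1 - eps2| * `|W i.+1 q - W i.+1 s| +
    \int[mu]_(r in `[s, q]) `|Dd i r|).
  apply: ler_sum => i _; rewrite e1// e2//.
  rewrite (_ : _ - _ = (eps1 - eps2) * (W i.+1 q - W i.+1 s) + \int[mu]_(r in `[s, q]) Dd i r).
    by rewrite (le_trans (ler_normD _ _))// normrM lerD2l le_normr_Rintegral.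
  by rewrite /Dd RintegralB//; ring.
apply: (le_trans u1); rewrite big_split/= -mulr_sumr; apply: lerD.
  by rewrite ler_wpM2l// /noise_size [leRHS]big_ord_recl lerDr.
rewrite -Rintegral_sum//; last by move=> i; exact: (integrable_norm (iD i)).
rewrite -RintegralZl//; last exact: (integrable_subitv qT iu).
apply: le_Rintegral => //.
- by apply: (integrable_bigsum msq) => i; exact: (integrable_norm (iD i)).
- apply: (integrable_mull msq); exact: (integrable_subitv qT iu).
- move=> r; rewrite /= in_itv/= => /andP[sr rq]; apply: (drift_sum_lip f_lip).
  by rewrite in_itv/= (le_trans s_ge0 sr) (le_trans rq).
Qed.

Lemma path_growth n (x : 'rV[R]_n.+1) eps X : `|eps| <= 1 ->
  mu.-integrable `[s, T] (EFin \o th) ->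
  path_solution W th eps x X ->
  let phi t := \sum_i `|x ord0 i| + T * (\sum_(i < n.+1) `|drift f i 0 0 0| + n.+1%:R * K * T)
    + n.+1%:R * K * \int[mu]_(r in `[s, T]) `|th r| + (n.+1%:R * `|sigma| + 1) * noise_size n t in
  forall t, t \in `[s, T] -> \sum_i `|X t ord0 i| <=
    phi t + gronwall_cst n * \int[mu]_(r in `[s, T]) phi r.
Proof.
move=> eps1 ith [cX iX eX] phi t tsT.
have ic (c : R) q : mu.-integrable `[s, q] (EFin \o cst c).
  apply: continuous_compact_integrable; first exact: segment_compact.
  by apply: continuous_subspaceT => ?; exact: cvg_cst.
have nK : 0 <= n.+1%:R * K by rewrite mulr_ge0.
have nS : 0 <= n.+1%:R * `|sigma| + 1 by rewrite addr_ge0// mulr_ge0.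
have Ith : 0 <= \int[mu]_(r in `[s, T]) `|th r| by exact: Rintegral_ge0.
have D0 : 0 <= \sum_(i < n.+1) `|drift f i 0 0 0| by exact: sumr_ge0.
have iphi : mu.-integrable `[s, T] (EFin \o phi).
  apply: (integrable_add mab); first exact: ic.
  by apply: (integrable_mull mab); exact: noise_size_integrable.
have iu : mu.-integrable `[s, T] (EFin \o (fun t => \sum_i `|X t ord0 i|)).
  apply: (integrable_bigsum mab) => i.
  exact: (integrable_norm (continuous_itv_integrable (cX i))).
apply: (@gronwall_path n (fun t => \sum_i `|X t ord0 i|) phi) => //.
- by move=> r _; exact: sumr_ge0.
- move=> r _; rewrite /phi !addr_ge0 ?sumr_ge0 ?mulr_ge0 ?addr_ge0 ?mulr_ge0//.
  exact: noise_size_ge0.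
move=> q qsT; have [sq qT] : s <= q /\ q <= T by rewrite !(itvP qsT).
have msq : measurable (`[s, q]%classic : set (measurableTypeR R)).
  exact: measurable_itv.
have iXq i := integrable_subitv qT (iX i).
have iuq := integrable_subitv qT iu.
have ithq := integrable_norm (integrable_subitv qT ith).
apply: (@le_trans _ _ (\sum_i (`|x ord0 i| + `|sigma| * `|W 0 q - W 0 s| +
    `|W i.+1 q - W i.+1 s| + \int[mu]_(r in `[s, q]) `|drift f i r (th r) (X r)|))).
  apply: ler_sum => i _; rewrite eX//.
  have h1 := le_normr_Rintegral msq (iXq i).
  have h2 : `|eps * (W i.+1 q - W i.+1 s)| <= `|W i.+1 q - W i.+1 s|.
    by rewrite normrM ler_piMl.
  have h3 := normrM sigma (W 0 q - W 0 s).
  rewrite (le_trans (ler_normD _ _))// (le_trans (lerD (ler_normD _ _) h2))//.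
  have := ler_normD (x ord0 i) (\int[mu]_(r in `[s, q]) drift f i r (th r) (X r)).
  by rewrite h3; lra.
rewrite !big_split/=; set S1 := \sum_i `|x ord0 i|.
rewrite sumr_const card_ord.
have N1 : `|W 0 q - W 0 s| + \sum_(i < n.+1) `|W i.+1 q - W i.+1 s| <= noise_size n q.
  by rewrite /noise_size [leRHS]big_ord_recl.
have N2 : 0 <= \sum_(i < n.+1) `|W i.+1 q - W i.+1 s| by exact: sumr_ge0.
have main : \sum_i \int[mu]_(r in `[s, q]) `|drift f i r (th r) (X r)| <=
    T * (\sum_(i < n.+1) `|drift f i 0 0 0| + n.+1%:R * K * T) +
    n.+1%:R * K * \int[mu]_(r in `[s, T]) `|th r| +
    n.+1%:R * K * \int[mu]_(r in `[s, q]) \sum_i `|X r ord0 i|.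
  set c0 := (\sum_(i < n.+1) `|drift f i 0 0 0| + n.+1%:R * K * T).
  have c00 : 0 <= c0 by rewrite addr_ge0// mulr_ge0.
  rewrite -Rintegral_sum//; last by move=> i; exact: (integrable_norm (iXq i)).
  apply: (@le_trans _ _ (\int[mu]_(r in `[s, q]) (c0 + n.+1%:R * K * `|th r| +
      n.+1%:R * K * \sum_i `|X r ord0 i|))).
    apply: le_Rintegral => //.
    - by apply: (integrable_bigsum msq) => i; exact: (integrable_norm (iXq i)).
    - apply: (integrable_add msq); last exact: (integrable_mull msq).
      by apply: (integrable_add msq); [exact: ic|exact: (integrable_mull msq)].
    - move=> r; rewrite /= in_itv/= => /andP[sr rq].
      have r0T : r \in `[0, T] by rewrite in_itv/= (le_trans s_ge0 sr) (le_trans rq).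
      apply: (le_trans (ler_sum _ (fun i _ => drift_growth K_ge0 f_lip i (th r) (X r) r0T))).
      rewrite big_split/= sumr_const card_ord -[_ *+ _]mulr_natl /c0.
      by rewrite le_eqVlt; apply/orP; left; apply/eqP; ring.
  rewrite RintegralD//; last 2 first.
    - by apply: (integrable_add msq); [exact: ic|exact: (integrable_mull msq)].
    - exact: (integrable_mull msq).
  rewrite RintegralD//; last 2 first.
    - exact: ic.
    - exact: (integrable_mull msq).
  rewrite !RintegralZl//.
  rewrite lerD2r; apply: lerD.
    rewrite Rintegral_cst// [X in fine X](_ : _ = (q - s)%:E); last first.
      have := @lebesgue_measure_itv R `[s, q]; rewrite /= lte_fin => E.
      apply: (etrans E); case: ltP => // qs.
      by rewrite (_ : q = s) ?subrr//; apply/eqP; rewrite eq_le qs sq.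
    rewrite -[fine _]/(q - s) [leRHS]mulrC ler_wpM2l//.
    by rewrite lerBlDr (le_trans qT)// lerDl.
  rewrite ler_wpM2l//; apply: Rintegral_subitv_le => //.
  exact: (integrable_norm ith).
have nw : n.+1%:R * `|sigma| * `|W 0 q - W 0 s| <= n.+1%:R * `|sigma| * noise_size n q.
  by rewrite ler_wpM2l ?mulr_ge0//; lra.
have nq := noise_size_ge0 n q.
rewrite -[_ *+ _]mulr_natl mulrA /phi -/S1.
have := normr_ge0 (W 0 q - W 0 s).
lra.
Qed.

Lemma Rintegral_cst_itv (c : R) : \int[mu]_(r in `[s, T]) c = c * (T - s).
Proof.
rewrite Rintegral_cst//; congr (_ * _).
have := @lebesgue_measure_itv R `[s, T]; rewrite /= lte_fin => E.
rewrite [X in fine X]E; case: ltP => //= Ts.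
by rewrite (_ : T = s) ?subrr//; apply/eqP; rewrite eq_le Ts sT.
Qed.

Lemma integrable_cst_itv (c : R) : mu.-integrable `[s, T] (EFin \o cst c).
Proof.
apply: continuous_itv_integrable.
by apply: continuous_subspaceT => ?; exact: cvg_cst.
Qed.

(** Integrates [(u - m) ^+ 2 >= 0], where [m] is the mean of [u]; this needs an interval of positive
    length, hence the separate case [s = T]. *)
Lemma sqr_Rintegral_le (u : R -> R) : mu.-integrable `[s, T] (EFin \o u) ->
  mu.-integrable `[s, T] (EFin \o (fun r => u r ^+ 2)) ->
  (\int[mu]_(r in `[s, T]) u r) ^+ 2 <= T * \int[mu]_(r in `[s, T]) u r ^+ 2.
Proof.
move=> iu iu2.
have I2 : 0 <= \int[mu]_(r in `[s, T]) u r ^+ 2.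
  by apply: Rintegral_ge0 => r _; exact: sqr_ge0.
apply: (@le_trans _ _ ((T - s) * \int[mu]_(r in `[s, T]) u r ^+ 2)); last first.
  by rewrite ler_wpM2r// gerBl.
have [sT0|sT0] := eqVneq s T.
  have -> : \int[mu]_(r in `[s, T]) u r = 0 by rewrite sT0 set_itv1 Rintegral_set1.
  by rewrite expr0n/= mulr_ge0// subr_ge0.
have l0 : 0 < T - s by rewrite subr_gt0 lt_neqAle sT0.
set I := \int[mu]_(r in `[s, T]) u r; pose m := I / (T - s).
have : 0 <= \int[mu]_(r in `[s, T]) (u r ^+ 2 + (- 2 * m) * u r + m ^+ 2).
  apply: Rintegral_ge0 => r _.
  by rewrite (_ : _ + _ = (u r - m) ^+ 2) ?sqr_ge0//; ring.
have i1 := integrable_mull mab (- 2 * m) iu.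
rewrite RintegralD//; last 2 first.
- exact: (integrable_add mab).
- exact: integrable_cst_itv.
rewrite RintegralD// RintegralZl// Rintegral_cst_itv -/I.
rewrite (_ : _ + _ + _ = \int[mu]_(r in `[s, T]) u r ^+ 2 - I ^+ 2 / (T - s)); last first.
  by rewrite /m; field; rewrite gt_eqF.
by rewrite subr_ge0 ler_pdivrMr// mulrC.
Qed.

Section path_cost.
Variables (lambda : R) (L U : R -> R).

Definition path_cost n (X : R -> 'rV[R]_n.+1) : \bar R :=
  ((n.+1%:R^-1)%:E *
        \sum_(i < n.+1) \int[mu]_(t in `[s, T]) (L (X t ord0 i))%:E
      + (n.+1%:R^-1)%:E * \sum_(i < n.+1) (U (X T ord0 i))%:E
      + (lambda / 2)%:E * \int[mu]_(t in `[s, T]) (`|th t| ^+ 2)%:E)%E.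

Definition real_path_cost n (X : R -> 'rV[R]_n.+1) : R :=
  n.+1%:R^-1 * (\sum_(i < n.+1) \int[mu]_(t in `[s, T]) L (X t ord0 i))
  + n.+1%:R^-1 * (\sum_(i < n.+1) U (X T ord0 i))
  + lambda / 2 * \int[mu]_(t in `[s, T]) (th t ^+ 2).

Hypothesis L_cont : continuous L.
Hypothesis th2 : mu.-integrable `[s, T] (EFin \o (fun r => th r ^+ 2)).

Lemma continuous_within_comp (g u : R -> R) : continuous g ->
  {within `[s, T], continuous u} -> {within `[s, T], continuous (g \o u)}.
Proof. by move=> cg cu t; apply: cvg_comp; [exact: cu|exact: cg]. Qed.

Lemma path_costE n (X : R -> 'rV[R]_n.+1) :
  (forall i, {within `[s, T], continuous (fun t => X t ord0 i)}) ->
  path_cost X = (real_path_cost X)%:E.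
Proof.
move=> cX; rewrite /path_cost /real_path_cost.
have iL i : mu.-integrable `[s, T] (EFin \o (fun t => L (X t ord0 i))).
  exact: (continuous_itv_integrable (continuous_within_comp L_cont (cX i))).
under eq_bigr do rewrite EFin_Rintegral//.
have -> : (\int[mu]_(t in `[s, T]) (`|th t| ^+ 2)%:E)%E =
    (\int[mu]_(t in `[s, T]) (th t ^+ 2))%:E.
  rewrite -EFin_Rintegral//.
  by apply: eq_integral => t _; rewrite real_normK ?num_real.
by rewrite !sumEFin -!EFinM -!EFinD.
Qed.

End path_cost.
End compare.

Definition moment_size (W : nat -> R -> R) (th : R -> R) n : R :=
  1 + \int[mu]_(r in `[s, T]) th r ^+ 2 + \int[mu]_(r in `[s, T]) noise_size W n r ^+ 2.

(* (p + q) q <= 3/2 (p^2 + q^2), with p = 1 + I and q = z + J *)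
Lemma growth_times_distance (I z J : R) : 0 <= I -> 0 <= z -> 0 <= J ->
  (1 + I + z + J) * (z + J) <= 3 * (1 + I ^+ 2 + z ^+ 2 + J ^+ 2).
Proof.
move=> I0 z0 J0; have h1 := sqr_ge0 (1 + I - (z + J)).
have h2 := sqr_ge0 (1 - I); have h3 := sqr_ge0 (z - J).
have h4 := sqr_ge0 I; have h5 := sqr_ge0 z; have h6 := sqr_ge0 J.
nra.
Qed.

(** The local Lipschitz constant of [phi] grows linearly with the positions, so the difference is
    bounded by growth times distance. The first factor is affine in the control and the noise, the
    second in the noise; [growth_times_distance] turns the product into squares, whose expectations
    are finite. [B] does not depend on the path, the control or the noise levels, as passing to
    infima requires. *)
Lemma path_phi_compare (phi : R -> R) C11 C10 n (x : 'rV[R]_n.+1) :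
  0 <= C11 -> 0 <= C10 ->
  (forall a b, `|phi a - phi b| <= (C11 * (`|a| + `|b|) + C10) * `|a - b|) ->
  exists2 B, 0 <= B & forall W th eps1 eps2 X1 X2,
    (forall i, {within `[s, T], continuous (W i)}) ->
    mu.-integrable `[s, T] (EFin \o th) ->
    mu.-integrable `[s, T] (EFin \o (fun r => th r ^+ 2)) ->
    `|eps1| <= 1 -> `|eps2| <= 1 ->
    path_solution W th eps1 x X1 -> path_solution W th eps2 x X2 ->
    forall t, t \in `[s, T] ->
    \sum_i `|phi (X1 t ord0 i) - phi (X2 t ord0 i)| <=
      `|eps1 - eps2| * B * (moment_size W th n + noise_size W n t ^+ 2).
Proof.
move=> C110 C100 phi_lip.
set g := gronwall_cst n; have g0 : 0 <= g := gronwall_cst_ge0 n.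
pose a := \sum_i `|x ord0 i| + T * (\sum_(i < n.+1) `|drift f i 0 0 0| + n.+1%:R * K * T).
pose b := n.+1%:R * K.
pose c := n.+1%:R * `|sigma| + 1.
have b0 : 0 <= b by rewrite mulr_ge0.
have a0 : 0 <= a by rewrite addr_ge0 ?sumr_ge0// mulr_ge0// addr_ge0 ?sumr_ge0 ?mulr_ge0.
have c0 : 0 <= c by rewrite addr_ge0// mulr_ge0.
pose A := (1 + g * T) * (a + b) + c + g * c.
have A0 : 0 <= A.
  have h1 := mulr_ge0 g0 T_ge0; have h2 := mulr_ge0 g0 c0.
  have h3 := mulr_ge0 h1 (addr_ge0 a0 b0); rewrite /A; lra.
pose B := (2 * C11 * A + C10) * (1 + g).
have CA0 : 0 <= 2 * C11 * A + C10.
  by apply: addr_ge0 => //; apply: mulr_ge0 => //; exact: mulr_ge0.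
have B0 : 0 <= B by apply: mulr_ge0 => //; exact: addr_ge0.
exists (3 * (1 + T) * B) => [|W th eps1 eps2 X1 X2 cW ith ith2 eps11 eps21 sol1 sol2 t tsT].
  by rewrite mulr_ge0// mulr_ge0 ?addr_ge0.
have iz := noise_size_integrable cW n.
have iz2 : mu.-integrable `[s, T] (EFin \o (fun r => noise_size W n r ^+ 2)).
  apply: continuous_itv_integrable.
  apply: (continuous_within_comp (g := fun y => y ^+ 2)); first exact: exprn_continuous.
  exact: noise_size_cont.
set z := noise_size W n t.
set Iz := \int[mu]_(r in `[s, T]) noise_size W n r.
set Ith := \int[mu]_(r in `[s, T]) `|th r|.
have z0 : 0 <= z := noise_size_ge0 W n t.
have Iz0 : 0 <= Iz by apply: Rintegral_ge0 => r _; exact: noise_size_ge0.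
have Ith0 : 0 <= Ith by exact: Rintegral_ge0.
set e := `|eps1 - eps2|; have e0 : 0 <= e by exact: normr_ge0.
have D_le := path_compare cW sol1 sol2 tsT.
have S_le eps X : `|eps| <= 1 -> path_solution W th eps x X ->
    \sum_i `|X t ord0 i| <= A * (1 + Ith + z + Iz).
  move=> eps1' sol; apply: (le_trans (path_growth cW eps1' ith sol tsT)).
  rewrite -/a -/b -/c -/z -/Ith -/g.
  have -> : \int[mu]_(r in `[s, T]) (a + b * Ith + c * noise_size W n r) =
      (a + b * Ith) * (T - s) + c * Iz.
    rewrite RintegralD//; last 2 first.
    - exact: integrable_cst_itv.
    - exact: (integrable_mull mab).
    by rewrite Rintegral_cst_itv RintegralZl.
  have h1 : (a + b * Ith) * (T - s) <= (a + b * Ith) * T.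
    by rewrite ler_wpM2l ?gerBl// addr_ge0// mulr_ge0.
  have h2 := ler_wpM2l g0 h1.
  apply: (@le_trans _ _ ((1 + g * T) * (a + b * Ith) + c * z + g * c * Iz)); first by lra.
  have gT : 0 <= 1 + g * T by rewrite addr_ge0// mulr_ge0.
  have gc : 0 <= g * c by rewrite mulr_ge0.
  (* [k1] to [k4] are the terms by which the expanded right-hand side exceeds the left one. *)
  have k1 : 0 <= (1 + g * T) * a * (Ith + z + Iz) by rewrite !mulr_ge0// !addr_ge0.
  have k2 : 0 <= (1 + g * T) * b * (1 + z + Iz) by rewrite !mulr_ge0// !addr_ge0.
  have k3 : 0 <= c * (1 + Ith + Iz) by rewrite mulr_ge0// !addr_ge0.
  have k4 : 0 <= g * c * (1 + Ith + z) by rewrite mulr_ge0// !addr_ge0.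
  rewrite /A -subr_ge0; apply: le_trans (addr_ge0 (addr_ge0 k1 k2) (addr_ge0 k3 k4)) _.
  by rewrite le_eqVlt; apply/orP; left; apply/eqP; ring.
have S1 := S_le _ _ eps11 sol1; have S2 := S_le _ _ eps21 sol2.
set G := 1 + Ith + z + Iz in S1 S2.
have G0 : 0 <= G by rewrite !addr_ge0.
have coordle (X : R -> 'rV[R]_n.+1) (i : 'I_n.+1) : `|X t ord0 i| <= \sum_i `|X t ord0 i|.
  by rewrite (bigD1 i)//= lerDl sumr_ge0.
apply: (@le_trans _ _ (\sum_i (2 * C11 * A + C10) * G * `|X1 t ord0 i - X2 t ord0 i|)).
  apply: ler_sum => i _; apply: (le_trans (phi_lip _ _)); rewrite ler_wpM2r//.
  have h1 := le_trans (coordle X1 i) S1; have h2 := le_trans (coordle X2 i) S2.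
  have := ler_wpM2l C110 (lerD h1 h2).
  have : C10 <= C10 * G by rewrite ler_peMr// /G -!addrA lerDl !addr_ge0.
  lra.
rewrite -mulr_sumr.
have CG0 : 0 <= (2 * C11 * A + C10) * G by rewrite mulr_ge0// addr_ge0// !mulr_ge0.
apply: (le_trans (ler_wpM2l CG0 D_le)); rewrite -/e -/z -/Iz -/g.
have zg : z + g * Iz <= (1 + g) * (z + Iz).
  have := mulr_ge0 g0 z0; lra.
apply: (@le_trans _ _ (e * B * (G * (z + Iz)))).
  have := ler_wpM2l (mulr_ge0 CG0 e0) zg; rewrite /B; lra.
have h := growth_times_distance Ith0 z0 Iz0.
have hth : Ith ^+ 2 <= T * \int[mu]_(r in `[s, T]) th r ^+ 2.
  apply: (le_trans (sqr_Rintegral_le (integrable_norm ith) _)).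
    by apply: eq_integrable ith2 => // r _ /=; rewrite real_normK ?num_real.
  rewrite ler_wpM2l// le_eqVlt; apply/orP; left; apply/eqP.
  by apply: eq_Rintegral => r _; rewrite real_normK ?num_real.
have hz := sqr_Rintegral_le iz iz2.
rewrite -/Iz in hz.
have I1 : 0 <= \int[mu]_(r in `[s, T]) th r ^+ 2 by apply: Rintegral_ge0 => r _; exact: sqr_ge0.
have I2 : 0 <= \int[mu]_(r in `[s, T]) noise_size W n r ^+ 2.
  by apply: Rintegral_ge0 => r _; exact: sqr_ge0.
apply: (@le_trans _ _ (e * B * (3 * (1 + T) * (moment_size W th n + z ^+ 2)))); last first.
  by rewrite le_eqVlt; apply/orP; left; apply/eqP; ring.
apply: ler_wpM2l; first exact: mulr_ge0.
apply: (le_trans h); rewrite -mulrA ler_wpM2l// /moment_size.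
have h1 := T_ge0; have h2 := mulr_ge0 T_ge0 (sqr_ge0 z).
move: h1 h2 hth hz I1 I2; move: (Ith ^+ 2) (Iz ^+ 2) (z ^+ 2) (Rintegral _ _ _) (Rintegral _ _ _).
by move=> *; lra.
Qed.

Lemma path_cost_compare (lambda : R) (L U : R -> R) CL11 CL10 CL20 CU11 CU10 CU20
    n (x : 'rV[R]_n.+1) :
  cost_assumption L CL11 CL10 CL20 -> cost_assumption U CU11 CU10 CU20 ->
  exists2 B, 0 <= B & forall W th eps1 eps2 X1 X2,
    (forall i, {within `[s, T], continuous (W i)}) ->
    mu.-integrable `[s, T] (EFin \o th) ->
    mu.-integrable `[s, T] (EFin \o (fun r => th r ^+ 2)) ->
    `|eps1| <= 1 -> `|eps2| <= 1 ->
    path_solution W th eps1 x X1 -> path_solution W th eps2 x X2 ->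
    (path_cost th lambda L U X1 <= path_cost th lambda L U X2 +
      (`|eps1 - eps2| * B * (moment_size W th n + noise_size W n T ^+ 2))%:E)%E.
Proof.
move=> /derivable_lip_growth[CL110 CL100 L_cont L_lip].
move=> /derivable_lip_growth[CU110 CU100 U_cont U_lip].
have [BL BL0 HL] := path_phi_compare x CL110 CL100 L_lip.
have [BU BU0 HU] := path_phi_compare x CU110 CU100 U_lip.
exists ((T + 1) * BL + BU) => [|W th eps1 eps2 X1 X2 cW ith ith2 e1 e2 sol1 sol2].
  by rewrite addr_ge0// mulr_ge0// addr_ge0.
rewrite !path_costE//; try exact: path_cont sol1; try exact: path_cont sol2.
rewrite -EFinD lee_fin /real_path_cost.
have iL (X : R -> 'rV[R]_n.+1) i : {within `[s, T], continuous (fun t => X t ord0 i)} ->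
    mu.-integrable `[s, T] (EFin \o (fun t => L (X t ord0 i))).
  by move=> cX; exact: (continuous_itv_integrable (continuous_within_comp L_cont cX)).
have [cX1 _ _] := sol1; have [cX2 _ _] := sol2.
have iL1 i := iL X1 i (cX1 i); have iL2 i := iL X2 i (cX2 i).
set e := `|eps1 - eps2|; have e0 : 0 <= e by exact: normr_ge0.
have iz2 : mu.-integrable `[s, T] (EFin \o (fun r => noise_size W n r ^+ 2)).
  apply: continuous_itv_integrable.
  apply: (continuous_within_comp (g := fun y => y ^+ 2)); first exact: exprn_continuous.
  exact: noise_size_cont.
set M := moment_size W th n.
have I1 : 0 <= \int[mu]_(r in `[s, T]) th r ^+ 2 by apply: Rintegral_ge0 => r _; exact: sqr_ge0.
have I2 : 0 <= \int[mu]_(r in `[s, T]) noise_size W n r ^+ 2.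
  by apply: Rintegral_ge0 => r _; exact: sqr_ge0.
have M0 : 0 <= M by rewrite /M /moment_size !addr_ge0.
have TsT : T \in `[s, T] by rewrite in_itv/= sT lexx.
have n1 : 0 <= (n.+1%:R^-1 : R) <= 1 by rewrite invr_ge0 ler0n invf_le1 ?ler1n.
have avg (u v w : R) : u <= v + w -> 0 <= w -> n.+1%:R^-1 * u <= n.+1%:R^-1 * v + w.
  move: (n.+1%:R^-1) n1 => k /andP[k0 k1] uv w0.
  have := ler_wpM2l k0 uv; have := ler_wpM2r w0 k1; lra.
have HU1 : \sum_(i < n.+1) U (X1 T ord0 i) <= \sum_(i < n.+1) U (X2 T ord0 i) +
    e * BU * (M + noise_size W n T ^+ 2).
  rewrite -lerBlDl -sumrB; apply: le_trans (HU _ _ _ _ _ _ cW ith ith2 e1 e2 sol1 sol2 T TsT).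
  by apply: ler_sum => i _; exact: ler_norm.
have HL1 : \sum_(i < n.+1) \int[mu]_(t in `[s, T]) L (X1 t ord0 i) <=
    \sum_(i < n.+1) \int[mu]_(t in `[s, T]) L (X2 t ord0 i) +
    e * BL * ((T + 1) * M).
  rewrite -lerBlDl -sumrB.
  have iD i : mu.-integrable `[s, T] (EFin \o (fun t => L (X1 t ord0 i) - L (X2 t ord0 i))).
    have := integrableB mab (iL1 i) (iL2 i).
    by apply: eq_integrable => // r _ /=; rewrite EFinB.
  under eq_bigr do rewrite -RintegralB//.
  rewrite -Rintegral_sum//.
  apply: (@le_trans _ _ (\int[mu]_(t in `[s, T]) (e * BL * M + e * BL * noise_size W n t ^+ 2))).
    apply: le_Rintegral => //.
    - exact: (integrable_bigsum mab).
    - by apply: (integrable_add mab); [exact: integrable_cst_itv|exact: (integrable_mull mab)].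
    - move=> t tsT; rewrite -mulrDr.
      apply: le_trans (HL _ _ _ _ _ _ cW ith ith2 e1 e2 sol1 sol2 t tsT).
      by apply: ler_sum => i _; exact: ler_norm.
  rewrite RintegralD//; last 2 first.
  - exact: integrable_cst_itv.
  - exact: (integrable_mull mab).
  rewrite Rintegral_cst_itv RintegralZl// -[e * BL * M * _]mulrA -mulrDr.
  rewrite ler_wpM2l ?mulr_ge0//.
  have h1 : M * (T - s) <= M * T by rewrite ler_wpM2l// gerBl.
  have h2 : \int[mu]_(r in `[s, T]) noise_size W n r ^+ 2 <= M.
    by rewrite /M /moment_size lerDr addr_ge0.
  lra.
have w1 : 0 <= e * BU * (M + noise_size W n T ^+ 2) by rewrite !mulr_ge0// addr_ge0// sqr_ge0.
have w2 : 0 <= e * BL * ((T + 1) * M) by rewrite !mulr_ge0// addr_ge0.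
have := avg _ _ _ HU1 w1; have := avg _ _ _ HL1 w2.
have : 0 <= e * BL * ((T + 1) * noise_size W n T ^+ 2).
  apply: mulr_ge0; first exact: mulr_ge0.
  by apply: mulr_ge0; [exact: addr_ge0|exact: sqr_ge0].
move: (n.+1%:R^-1 * _) (n.+1%:R^-1 * _) (n.+1%:R^-1 * _) (n.+1%:R^-1 * _) => a1 a2 a3 a4.
by move=> *; lra.
Qed.

End path_estimates.

(** * Second moments of the noise *)

Section second_moment.
Context (R : realType).
Notation mu := (@lebesgue_measure R).

(** The Radon-Nikodym derivative of the normal law has the integrals of [normal_pdf] over all
    measurable sets, so the two agree almost everywhere. *)
Lemma integral_normal_prob (m sg : R) (g : measurableTypeR R -> \bar R) :
  measurable_fun setT g -> (forall y, 0 <= g y)%E ->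
  (\int[normal_prob m sg]_y g y = \int[mu]_y (g y * (normal_pdf m sg y)%:E))%E.
Proof.
move=> mg g0; have dom := normal_prob_dominates m sg.
rewrite -(Radon_Nikodym_SigmaFinite.change_of_variables dom g0 measurableT mg).
have mpdf : measurable_fun setT (EFin \o normal_pdf m sg).
  by apply/measurable_EFinP; exact: measurable_normal_pdf.
have iRN := Radon_Nikodym_SigmaFinite.f_integrable dom.
have ae : ae_eq mu setT
    (Radon_Nikodym_SigmaFinite.f (normal_prob m sg) mu) (EFin \o normal_pdf m sg).
  apply: integral_ae_eq => // E _ mE.
  by rewrite -Radon_Nikodym_SigmaFinite.f_integral.
apply: ge0_ae_eq_integral => //.
- by apply: emeasurable_funM => //; case/integrableP : iRN.
- exact: emeasurable_funM.
- by move=> y _; rewrite mule_ge0// Radon_Nikodym_SigmaFinite.f_ge0.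
- by move=> y _; rewrite mule_ge0// lee_fin normal_pdf_ge0.
- by apply: filterS ae => y /= h _; rewrite h.
Qed.

(** For [u = y ^+ 2 / (8 * sg ^+ 2)] the claim reads [u * expR (- (4 * u)) <= expR (- u)], which
    follows from [1 + 3 * u <= expR (3 * u)]. The constant 16 is 8 times the ratio 2 of the two
    peaks. It bounds a second moment by the total mass of another normal law. *)
Lemma sqr_normal_pdf_le (sg y : R) : sg != 0 ->
  y ^+ 2 * normal_pdf 0 sg y <= 16 * sg ^+ 2 * normal_pdf 0 (2 * sg) y.
Proof.
move=> sg0; have sg20 : 2 * sg != 0 by rewrite mulf_neq0.
rewrite !normal_pdfE// /normal_fun !subr0.
have -> : normal_peak (2 * sg) = normal_peak sg / 2.
  rewrite /normal_peak exprMn.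
  rewrite (_ : 2 ^+ 2 * sg ^+ 2 * pi *+ 2 = sg ^+ 2 * pi *+ 2 * 2 ^+ 2); last by ring.
  rewrite sqrtrM; last by rewrite mulrn_wge0// mulr_ge0 ?sqr_ge0// pi_ge0.
  by rewrite sqrtr_sqr ger0_norm// invfM.
have p0 := normal_peak_ge0 sg.
set u := y ^+ 2 / (8 * sg ^+ 2).
have s20 : sg ^+ 2 != 0 by rewrite expf_neq0.
have u0 : 0 <= u.
  by apply: divr_ge0; [exact: sqr_ge0|apply: mulr_ge0 => //; exact: sqr_ge0].
have -> : - y ^+ 2 / (sg ^+ 2 *+ 2) = - (4 * u) by rewrite /u; field.
have -> : - y ^+ 2 / ((2 * sg) ^+ 2 *+ 2) = - u by rewrite /u; field.
have -> : y ^+ 2 = 8 * sg ^+ 2 * u by rewrite /u; field.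
rewrite (_ : 8 * sg ^+ 2 * u * _ = 8 * sg ^+ 2 * normal_peak sg * (u * expR (- (4 * u)))); last by ring.
rewrite (_ : 16 * sg ^+ 2 * _ = 8 * sg ^+ 2 * normal_peak sg * expR (- u)); last by field.
apply: ler_wpM2l.
  by apply: mulr_ge0 => //; apply: mulr_ge0 => //; exact: sqr_ge0.
rewrite (_ : - u = 3 * u + - (4 * u)); last by ring.
rewrite expRD ler_wpM2r ?expR_ge0//.
have := expR_ge1Dx (3 * u); lra.
Qed.

Lemma normal_second_moment_le (sg : R) : sg != 0 ->
  (\int[normal_prob 0 sg]_y (y ^+ 2)%:E <= (16 * sg ^+ 2)%:E)%E.
Proof.
move=> sg0; rewrite integral_normal_prob//; last 2 first.
- by apply/measurable_EFinP; apply: measurable_funX.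
- by move=> y; rewrite lee_fin sqr_ge0.
have sg20 : 2 * sg != 0 by rewrite mulf_neq0.
apply: (@le_trans _ _ (\int[mu]_y ((16 * sg ^+ 2)%:E * (normal_pdf 0 (2 * sg) y)%:E))%E).
  apply: ge0_le_integral => //.
  - by move=> y _; rewrite -EFinM lee_fin mulr_ge0 ?sqr_ge0 ?normal_pdf_ge0.
  - apply/measurable_EFinP; apply: measurable_funM; last exact: measurable_normal_pdf.
    exact: measurable_funX.
  - by apply/measurable_EFinP; apply: measurable_funM => //; exact: measurable_normal_pdf.
  - by move=> y _; rewrite -EFinM -EFinM lee_fin sqr_normal_pdf_le.
rewrite ge0_integralZl//.
- by rewrite integral_normal_pdf mule1.
- by apply/measurable_EFinP; exact: measurable_normal_pdf.
- by move=> y _; rewrite lee_fin normal_pdf_ge0.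
- by rewrite lee_fin mulr_ge0 ?sqr_ge0.
Qed.

Lemma has_law_integral d (Om : measurableType d) (P : probability Om R) (Y : Om -> R)
    (m : probability (measurableTypeR R) R) (g : measurableTypeR R -> \bar R) :
  @measurable_fun _ _ Om (measurableTypeR R) setT Y -> has_law P Y m ->
  measurable_fun setT g ->
  (forall y, 0 <= g y)%E -> (\int[P]_w g (Y w) = \int[m]_y g y)%E.
Proof.
move=> mY law mg g0.
pose X : {RV P >-> measurableTypeR R} :=
  @mfun_Sub _ _ Om (measurableTypeR R) Y (mem_set mY).
rewrite -[LHS]/(integral P setT (g \o X)) -ge0_integral_distribution//.
by apply: eq_measure_integral => A mA _; exact: law.
Qed.

Lemma brownian_increment_sqr d (Om : measurableType d) (P : probability Om R)
    (s : R) (B : R -> Om -> R) (t : R) : brownian P s B -> s <= t ->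
  (\int[P]_w ((B t w - B s w) ^+ 2)%:E <= (16 * (t - s))%:E)%E.
Proof.
move=> [mB _ _ nB _]; rewrite le_eqVlt => /predU1P[<-|st].
  under eq_integral do rewrite subrr expr0n/=.
  by rewrite integral0 subrr mulr0.
have mD : measurable_fun setT (fun w => B t w - B s w).
  by apply: measurable_funB; apply: mB => //; exact: ltW.
have law := nB s t; rewrite lexx st in law.
have sg0 : Num.sqrt (t - s) != 0 by rewrite gt_eqF// sqrtr_gt0 subr_gt0.
have := normal_second_moment_le sg0; rewrite sqr_sqrtr ?subr_ge0 ?(ltW st)// => H.
apply: le_trans H.
rewrite (has_law_integral (g := fun y => (y ^+ 2)%:E) mD (law isT))//.
- by apply/measurable_EFinP; apply: measurable_funX.
- by move=> y; rewrite lee_fin sqr_ge0.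
Qed.

Lemma sqr_sum_le (I : finType) (a : I -> R) :
  (\sum_i a i) ^+ 2 <= #|I|%:R * \sum_i a i ^+ 2.
Proof.
rewrite expr2 mulr_suml.
apply: (@le_trans _ _ (\sum_i \sum_j (a i ^+ 2 / 2 + a j ^+ 2 / 2))).
  apply: ler_sum => i _; rewrite mulr_sumr; apply: ler_sum => j _.
  have := sqr_ge0 (a i - a j); lra.
under eq_bigr do rewrite big_split/= sumr_const.
have E : \sum_i a i ^+ 2 / 2 = (\sum_i a i ^+ 2) / 2 by rewrite mulr_suml.
rewrite big_split/= E sumr_const sumrMnl E -[_ *+ _]mulr_natl.
rewrite le_eqVlt; apply/orP; left; apply/eqP; by field.
Qed.

End second_moment.

(** * Vanishing individual noise *)

Section filtration.
Context (R : realType) d (Om : measurableType d) (P : probability Om R).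
Variables (W : nat -> R -> Om -> R) (s : R).

Definition filtration_gen (t : R) : set (set Om) :=
  generated (setT `*` `[s, t]) (fun ir : nat * R => W ir.1 ir.2) `|` P.-negligible.

Lemma filtration_null t : P.-negligible `<=` <<s filtration_gen t >>.
Proof. by move=> A A0; apply: sub_sigma_algebra; right. Qed.

Lemma filtration_mono r t : r <= t -> <<s filtration_gen r >> `<=` <<s filtration_gen t >>.
Proof.
move=> rt; apply: sub_smallest2r; first exact: smallest_sigma_algebra.
apply: setUSS => // A [[i q] [_ /= qsr] Aq].
exists (i, q) => //; split => //=; move: qsr; rewrite !in_itv/= => /andP[-> /le_trans->]//.
Qed.

Hypothesis P_complete : measure_is_complete P.
Hypothesis W_meas : forall i t, s <= t -> measurable_fun setT (W i t).

Lemma filtration_meas t A : <<s filtration_gen t >> A -> measurable A.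
Proof.
apply: smallest_sub; first exact: sigma_algebra_measurable.
move=> B [[[i q] [_ /=]]|]; last exact: P_complete.
rewrite in_itv/= => /andP[sq _] [C mC <-]; exact: W_meas.
Qed.

Lemma filtration_noise i t : s <= t ->
  @measurable_fun _ _ (g_sigma_algebraType (filtration_gen t)) R setT (W i t).
Proof.
move=> st _ B mB; apply: sub_sigma_algebra; left; exists (i, t).
  by split => //=; rewrite in_itv/= st lexx.
by exists B.
Qed.

End filtration.

Section cutoff.
Context (R : realType) d (Om : measurableType d) (P : probability Om R).
Variables (s T : R) (G : R -> set (set Om)).
Hypothesis G_null : forall t, P.-negligible `<=` <<s G t>>.
Variable N : set Om.
Hypotheses (mN : measurable N) (PN : P N = 0%E).

(* Resets the paths on a null set, on which they may be irregular. Adaptedness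
   survives because the filtration contains the null sets. *)
Definition cutoff (Y : R -> Om -> R) t w := Y t w * \1_(~` N) w.

Lemma cutoffE Y t w : ~ N w -> cutoff Y t w = Y t w.
Proof. by move=> Nw; rewrite /cutoff indicE mem_set ?mulr1. Qed.

Lemma cutoff0 Y t w : N w -> cutoff Y t w = 0.
Proof. by move=> Nw; rewrite /cutoff indicE memNset ?mulr0// => /(_ Nw). Qed.

Lemma cutoff_jm Y : jointly_measurable s T Y -> jointly_measurable s T (cutoff Y).
Proof.
move=> mY; apply: measurable_funM => //.
have m1 : measurable_fun setT (\1_(~` N) : Om -> R).
  by apply: measurable_indic; exact: measurableC.
by apply: measurable_funTS; apply: (measurableT_comp m1); exact: measurable_snd.
Qed.

Lemma cutoff_ad Y : adapted_to s T G Y -> adapted_to s T G (cutoff Y).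
Proof.
move=> aY t tsT; apply: (@measurable_funM _ (g_sigma_algebraType (G t))); first exact: aY.
have mgN : @measurable _ (g_sigma_algebraType (G t)) (~` N).
  by apply: (@measurableC _ (g_sigma_algebraType (G t))); apply: G_null; exists N; split.
exact: (@measurable_indic _ (g_sigma_algebraType (G t))).
Qed.

Lemma cutoff_ct Y : (forall w, ~ N w -> {within `[s, T], continuous (Y ^~ w)}) ->
  continuous_paths s T (cutoff Y).
Proof.
move=> cY w; have [Nw|Nw] := pselect (N w).
  rewrite (_ : (cutoff Y) ^~ w = cst 0); last by apply/funext => t; exact: cutoff0.
  by apply: continuous_subspaceT => ?; exact: cvg_cst.
rewrite (_ : (cutoff Y) ^~ w = Y ^~ w); first exact: cY.
by apply/funext => t; exact: cutoffE.
Qed.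

Lemma cutoff_integrable Y :
  (forall w, ~ N w -> lebesgue_measure.-integrable `[s, T] (EFin \o Y ^~ w)) ->
  forall w, lebesgue_measure.-integrable `[s, T] (EFin \o (cutoff Y) ^~ w).
Proof.
move=> cY w; have [Nw|Nw] := pselect (N w).
  rewrite (_ : _ \o _ = cst 0%E); last by apply/funext => t; rewrite /= cutoff0.
  exact: integrable0.
rewrite (_ : (cutoff Y) ^~ w = Y ^~ w); first exact: cY.
by apply/funext => t; exact: cutoffE.
Qed.

End cutoff.

(** * The system under a given control *)

Section controlled_system.
Context (R : realType) (T sigma : R) (f : R -> R -> R -> P2 R -> R).
Variable K : R.
Hypothesis K_ge0 : 0 <= K.
Hypothesis f_lip : forall t s th th' n (x y : 'rV[R]_n.+1) i,
  t \in `[0, T] -> s \in `[0, T] ->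
  `|f t th (x ord0 i) (empirical x) - f s th' (y ord0 i) (empirical y)| <=
  K * (`|t - s| + `|th - th'| + \sum_j `|x ord0 j - y ord0 j|).
Variable s : R.
Hypotheses (s_ge0 : 0 <= s) (sT : s <= T).
Notation mu := (@lebesgue_measure R).

Context d (Om : measurableType d) (P : probability Om R).
Variables (W : nat -> R -> Om -> R) (theta : R -> Om -> R).
Hypothesis P_complete : measure_is_complete P.
Hypothesis W_brownian : forall i, brownian P s (W i).
Hypothesis theta_jm : jointly_measurable s T theta.
Hypothesis theta_ad : adapted P W s T theta.

Let G := filtration_gen P W s.
Let W_meas i t : s <= t -> measurable_fun setT (W i t).
Proof. by have [m _ _ _ _] := W_brownian i; exact: m. Qed.

Lemma adaptedP Y : adapted P W s T Y <-> adapted_to s T G Y.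
Proof.
split=> aY t.
  by rewrite in_itv/= => tsT _ B mB; rewrite setTI; exact: aY.
move=> tsT B mB; rewrite -[X in augmented_filtration _ _ _ _ X]setTI.
by apply: (aY t) => //; rewrite in_itv.
Qed.

Lemma noise_cont_ae : {ae P, forall w, forall i, {within `[s, T], continuous (W i ^~ w)}}.
Proof.
apply/ae_foralln => i; apply: filterS (brownian_cont (W_brownian i)) => w.
apply: continuous_subspaceW => t /=; rewrite !in_itv/= => /andP[->]//.
Qed.

Lemma solution_path eps n (x : 'rV[R]_n.+1) X :
  solution T sigma f P W theta eps s x X ->
  {ae P, forall w, path_solution T f sigma s (fun i => W i ^~ w) (theta ^~ w) eps x (X ^~ w)}.
Proof.
move=> [_ c i e]; apply: filterS3 c i e => w cw iw ew; by split.
Qed.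

(** Picard iteration asks for regular paths at every [w], so noise and control are set to 0 on a
    null set [N]. Outside [N] nothing changes, and [solution] states its path conditions almost
    surely. *)
Lemma solution_exists eps n (x : 'rV[R]_n.+1) :
  {ae P, forall w, mu.-integrable `[s, T] (EFin \o theta ^~ w)} ->
  exists X, solution T sigma f P W theta eps s x X.
Proof.
move=> ith; have /(filterI ith)[N [mN N0 subN]] := noise_cont_ae.
have good w : ~ N w -> mu.-integrable `[s, T] (EFin \o theta ^~ w) /\
    forall i, {within `[s, T], continuous (W i ^~ w)}.
  by move=> Nw; apply: contrapT => h; apply: Nw; exact: subN.
pose W' i := cutoff N (W i); pose th' := cutoff N theta.
have G_null t : P.-negligible `<=` <<s G t >> by exact: filtration_null.
have G_meas t A : t \in `[s, T] -> <<s G t >> A -> measurable A.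
  by move=> _; exact: (filtration_meas P_complete W_meas).
have G_mono r t : r <= t -> <<s G r >> `<=` <<s G t >> by exact: filtration_mono.
have cW' i : continuous_paths s T (W' i).
  by apply: cutoff_ct => w /good[].
have aW' i : adapted_to s T G (W' i).
  apply: cutoff_ad => // t; rewrite in_itv/= => /andP[st _].
  exact: filtration_noise.
have jth' : jointly_measurable s T th' by exact: cutoff_jm.
have ath' : adapted_to s T G th' by apply: cutoff_ad => //; exact/adaptedP.
have ith' : forall w, mu.-integrable `[s, T] (EFin \o th' ^~ w).
  by apply: cutoff_integrable => w /good[].
have ssT : s \in `[s, T] by rewrite in_itv/= lexx.
pose F t w : 'rV[R]_n.+1 := \row_i (x ord0 i + sigma * (W' 0 t w - W' 0 s w)
  + eps * (W' i.+1 t w - W' i.+1 s w)).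
have FE i : coord_process F i = fun t w => x ord0 i + sigma * (W' 0 t w - W' 0 s w)
  + eps * (W' i.+1 t w - W' i.+1 s w).
  by apply/funext => t; apply/funext => w; rewrite /coord_process mxE.
have cF i : continuous_paths s T (coord_process F i).
  rewrite FE => w t; apply: cvgD.
    apply: cvgD; first exact: cvg_cst.
    by apply: cvgM; [exact: cvg_cst|apply: cvgB; [exact: cW'|exact: cvg_cst]].
  by apply: cvgM; [exact: cvg_cst|apply: cvgB; [exact: cW'|exact: cvg_cst]].
have aF i : adapted_to s T G (coord_process F i).
  rewrite FE => t tsT; have [st tT] : s <= t /\ t <= T by rewrite !(itvP tsT).
  have aWs j : @measurable_fun _ _ (g_sigma_algebraType (G t)) R setT (W' j s).
    exact: (adapted_mono G_mono (aW' j) ssT st).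
  have aD j : @measurable_fun _ _ (g_sigma_algebraType (G t)) R setT (fun w => W' j t w - W' j s w).
    apply: (@measurable_funB _ (g_sigma_algebraType (G t))); last exact: aWs.
    exact: aW'.
  have aM c j : @measurable_fun _ _ (g_sigma_algebraType (G t)) R setT
      (fun w => c * (W' j t w - W' j s w)).
    by apply: (@measurable_funM _ (g_sigma_algebraType (G t))).
  apply: (@measurable_funD _ (g_sigma_algebraType (G t))); last exact: aM.
  by apply: (@measurable_funD _ (g_sigma_algebraType (G t))); last exact: aM.
have [X [cX aX eX]] := sde_exists K_ge0 f_lip s_ge0 sT G_meas G_null G_mono jth' ath' ith' cF aF.
have Nae (Q : Om -> Prop) : (forall w, ~ N w -> Q w) -> {ae P, forall w, Q w}.
  by move=> NQ; exists N; split => // w /=; apply: contra_notP => /NQ.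
exists X; split.
- by move=> i; apply/adaptedP; exact: aX.
- by apply: Nae => w _ i; exact: cX.
- apply: Nae => w Nw i; apply: (drift_path_integrable K_ge0 f_lip s_ge0 sT i (good w Nw).1) => j.
  exact: (continuous_paths_integrable w (cX j)).
- apply: Nae => w Nw i t tsT.
  rewrite eX ?in_itv//= mxE.
  have -> : (fun r => drift f i r (th' r w) (X r w)) =
     (fun r => f r (theta r w) (X r w ord0 i) (empirical (X r w))).
    by apply/funext => r; rewrite /th' cutoffE.
  rewrite /W' !cutoffE//; ring.
Qed.

(** For equal noise levels the bound of [path_compare] is 0. *)
Lemma solution_unique eps n (x : 'rV[R]_n.+1) X Y :
  solution T sigma f P W theta eps s x X -> solution T sigma f P W theta eps s x Y ->
  {ae P, forall w, forall t, s <= t <= T -> X t w = Y t w}.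
Proof.
move=> /solution_path solX /solution_path solY.
apply: filterS3 noise_cont_ae solX solY => w cW sX sY t tsT.
have {}tsT : t \in `[s, T] by rewrite in_itv.
have := path_compare K_ge0 f_lip s_ge0 sT cW sX sY tsT.
rewrite subrr normr0 mul0r => H; apply/rowP => i; apply/eqP.
rewrite -subr_eq0 -normr_le0; apply: le_trans H.
by rewrite (bigD1 i)//= lerDl sumr_ge0.
Qed.

(** The noise level enters [admissible] only through existence and uniqueness of solutions, and
    these hold at any level once the control is integrable in time. *)
Lemma admissible_transfer eps eps' :
  {ae P, forall w, mu.-integrable `[s, T] (EFin \o theta ^~ w)} ->
  admissible T sigma f P W theta eps s -> admissible T sigma f P W theta eps' s.
Proof.
move=> ith [? ? ? ? ? _ _]; split=> // n x; first exact: solution_exists.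
exact: solution_unique.
Qed.

Section cost.
Variables (lambda : R) (L U : R -> R).
Hypotheses (lambda_gt0 : 0 < lambda) (L_cont : continuous L) (U_cont : continuous U)
  (L_ge0 : forall x, 0 <= L x) (U_ge0 : forall x, 0 <= U x).

Let Lm : measurable_fun setT L. Proof. exact: continuous_measurable_fun. Qed.
Let Um : measurable_fun setT U. Proof. exact: continuous_measurable_fun. Qed.

Lemma measurable_time_integral (h : R -> Om -> R) : jointly_measurable s T h ->
  (forall t w, 0 <= h t w) ->
  measurable_fun setT (fun w => (\int[mu]_(t in `[s, T]) (h t w)%:E)%E).
Proof.
move=> mh h0.
pose D : set (measurableTypeR R * Om) := `[s, T]%classic `*` [set: Om].
have mD : measurable D.
  by apply: measurableX => //; exact: measurable_itv.
pose h' : measurableTypeR R * Om -> \bar R := (fun p => (h p.1 p.2)%:E) \_ D.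
have mh' : measurable_fun setT h'.
  by apply/(measurable_restrictT _ mD); apply/measurable_EFinP.
have h'0 p : (0 <= h' p)%E by rewrite /h' patchE; case: ifPn => // _; rewrite lee_fin.
rewrite (_ : (fun w => _) = fubini_G mu h').
  exact: measurable_fun_fubini_tonelli_G.
apply/funext => w; rewrite /fubini_G [LHS]integral_mkcond.
apply: (eq_integral (fun t : measurableTypeR R => h' (t, w))) => t _.
rewrite /h' !patchE; congr (if _ then _ else _).
by apply/idP/idP; rewrite !inE => // -[].
Qed.

Lemma ae_measurable (g h : Om -> \bar R) : {ae P, forall w, g w = h w} ->
  measurable_fun setT g -> measurable_fun setT h.
Proof.
move=> gh; apply: (ae_measurable_fun P_complete).
by apply: filterS gh => w gw _.
Qed.

Let cost_of n (X : R -> Om -> 'rV[R]_n.+1) (w : Om) : \bar R :=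
  path_cost T s (theta ^~ w) lambda L U (X ^~ w).

Lemma total_costE n (X : R -> Om -> 'rV[R]_n.+1) :
  total_cost T lambda L U P theta s X = (\int[P]_w cost_of X w)%E.
Proof. by []. Qed.

Lemma cost_of_ge0 n (X : R -> Om -> 'rV[R]_n.+1) w : (0 <= cost_of X w)%E.
Proof.
rewrite /cost_of /path_cost !adde_ge0//.
- rewrite mule_ge0 ?lee_fin ?invr_ge0// sume_ge0// => i _.
  by apply: integral_ge0 => t _; rewrite lee_fin.
- by rewrite mule_ge0 ?lee_fin ?invr_ge0// sume_ge0// => i _; rewrite lee_fin.
- rewrite mule_ge0 ?lee_fin ?divr_ge0 ?(ltW lambda_gt0)//.
  by apply: integral_ge0 => t _; rewrite lee_fin sqr_ge0.
Qed.

Lemma measurable_theta_sqr :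
  measurable_fun setT (fun w => (\int[mu]_(t in `[s, T]) (`|theta t w| ^+ 2)%:E)%E).
Proof.
apply: measurable_time_integral => [|t w]; last exact: sqr_ge0.
by apply: measurable_funX; apply: measurableT_comp.
Qed.

(** The paths of [X] are continuous almost surely only, which does not make [X] jointly measurable.
    The cost is computed with a modification continuous at every [w], and completeness of [P]
    carries the measurability back. *)
Lemma measurable_cost eps n (x : 'rV[R]_n.+1) X :
  solution T sigma f P W theta eps s x X -> measurable_fun setT (cost_of X).
Proof.
move=> [aX cX _ _]; have [N [mN N0 subN]] := cX.
have good w : ~ N w -> forall i, {within `[s, T], continuous (fun t => X t w ord0 i)}.
  by move=> Nw; apply: contrapT => h; apply: Nw; exact: subN.
pose X' i := cutoff N (coord_process X i).
have cX' i : continuous_paths s T (X' i) by apply: cutoff_ct => w Nw; exact: (good w Nw i).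
have aX' i : adapted_to s T G (X' i).
  have G_null r : P.-negligible `<=` <<s G r>> by exact: filtration_null.
  apply: (cutoff_ad G_null mN N0); apply/adaptedP; exact: aX.
have G_meas t A : t \in `[s, T] -> <<s G t>> A -> measurable A.
  by move=> _; exact: (filtration_meas P_complete W_meas).
have mX' i : jointly_measurable s T (X' i).
  exact: (continuous_jointly_measurable sT G_meas).
have TsT : T \in `[s, T] by rewrite in_itv/= sT lexx.
pose X2 t w : 'rV[R]_n.+1 := \row_i X' i t w.
apply: (@ae_measurable (cost_of X2)).
  exists N; split => // w /=; apply: contra_notP => Nw; congr path_cost.
  by apply/funext => t; apply/rowP => i; rewrite mxE /X' cutoffE.
rewrite /cost_of /path_cost; apply: emeasurable_funD; first apply: emeasurable_funD.
- apply: measurable_funeM; apply: emeasurable_sum => i.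
  apply: measurable_time_integral => // .
  rewrite /jointly_measurable (_ : (fun p => _) = L \o (fun p => X' i p.1 p.2)).
    exact: (measurableT_comp Lm (mX' i)).
  by apply/funext => p; rewrite /= mxE.
- apply: measurable_funeM; apply: emeasurable_sum => i; apply/measurable_EFinP.
  rewrite (_ : (fun w => _) = U \o X' i T).
    by apply: measurableT_comp => //; exact: (adapted_measurable G_meas (aX' i) TsT).
  by apply/funext => w; rewrite /= mxE.
- by apply: measurable_funeM; exact: measurable_theta_sqr.
Qed.

(** [L] and [U] being nonnegative, the control term alone is at most the total cost. *)
Lemma theta_energy_le_cost eps n (x : 'rV[R]_n.+1) X :
  solution T sigma f P W theta eps s x X ->
  (\int[P]_w \int[mu]_(t in `[s, T]) (`|theta t w| ^+ 2)%:E <=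
    (2 / lambda)%:E * total_cost T lambda L U P theta s X)%E.
Proof.
move=> sol; have mc := measurable_cost sol.
have l2 : 0 <= lambda / 2 by rewrite divr_ge0// ltW.
have th0 w : (0 <= \int[mu]_(t in `[s, T]) (`|theta t w| ^+ 2)%:E)%E.
  by apply: integral_ge0 => t _; rewrite lee_fin sqr_ge0.
have H : ((lambda / 2)%:E * \int[P]_w \int[mu]_(t in `[s, T]) (`|theta t w| ^+ 2)%:E <=
    total_cost T lambda L U P theta s X)%E.
  rewrite -ge0_integralZl//; last exact: measurable_theta_sqr.
  apply: ge0_le_integral => //.
  - by move=> w _; rewrite mule_ge0// lee_fin.
  - by apply: measurable_funeM; exact: measurable_theta_sqr.
  - move=> w _; rewrite leeDr// adde_ge0//.
    + rewrite mule_ge0 ?lee_fin ?invr_ge0// sume_ge0// => i _.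
      by apply: integral_ge0 => t _; rewrite lee_fin.
    + by rewrite mule_ge0 ?lee_fin ?invr_ge0// sume_ge0// => i _; rewrite lee_fin.
have := lee_wpmul2l (_ : (0 <= (2 / lambda)%:E)%E) H.
rewrite lee_fin divr_ge0 ?(ltW lambda_gt0)// => /(_ isT); apply: le_trans.
rewrite muleA -EFinM (_ : 2 / lambda * (lambda / 2) = 1) ?mul1e//.
by field; rewrite gt_eqF.
Qed.

(** [admissible] does not ask that controls be integrable in time. A finite cost makes the energy
    finite almost surely, and [|theta| <= 1 + theta ^+ 2] on a bounded interval does the rest. *)
Lemma theta_integrable_ae eps n (x : 'rV[R]_n.+1) X :
  solution T sigma f P W theta eps s x X ->
  (total_cost T lambda L U P theta s X < +oo)%E ->
  {ae P, forall w, mu.-integrable `[s, T] (EFin \o theta ^~ w) /\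
    mu.-integrable `[s, T] (EFin \o (fun t => theta t w ^+ 2))}.
Proof.
move=> sol fin; have th0 w : (0 <= \int[mu]_(t in `[s, T]) (`|theta t w| ^+ 2)%:E)%E.
  by apply: integral_ge0 => t _; rewrite lee_fin sqr_ge0.
have i2 : P.-integrable setT (fun w => \int[mu]_(t in `[s, T]) (`|theta t w| ^+ 2)%:E)%E.
  apply/integrableP; split; first exact: measurable_theta_sqr.
  under eq_integral do rewrite gee0_abs//.
  apply: le_lt_trans (theta_energy_le_cost sol) _.
  by rewrite lte_mul_pinfty// lee_fin divr_ge0 ?(ltW lambda_gt0).
apply: filterS (integrable_ae measurableT i2) => w /(_ Logic.I) fw.
have mab : measurable (`[s, T]%classic : set (measurableTypeR R)).
  exact: measurable_itv.
have mth : measurable_fun `[s, T] (theta ^~ w) by exact: jointly_measurable_section.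
have ith2 : mu.-integrable `[s, T] (EFin \o (fun t => theta t w ^+ 2)).
  apply/integrableP; split; first by apply/measurable_EFinP; exact: measurable_funX.
  have -> : (\int[mu]_(t in `[s, T]) `|((theta t w ^+ 2)%R)%:E| =
      \int[mu]_(t in `[s, T]) (`|theta t w| ^+ 2)%:E)%E.
    by apply: eq_integral => t _; rewrite /= normrX.
  by rewrite ltey_eq fw.
split => //.
have ig : mu.-integrable `[s, T] (EFin \o (fun t => 1 + theta t w ^+ 2)).
  by apply: (integrable_add mab) => //; exact: integrable_cst_itv.
apply: (le_integrable mab _ _ ig); first exact/measurable_EFinP.
move=> t _; rewrite lee_fin [leRHS]ger0_norm; last by rewrite addr_ge0 ?sqr_ge0.
have := sqr_ge0 (`|theta t w| - 1); have := normr_ge0 (theta t w).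
have : `|theta t w| ^+ 2 = theta t w ^+ 2 by rewrite real_normK ?num_real.
nra.
Qed.

(** One factor [n.+2] comes from Cauchy-Schwarz for the sum of the noises, the other from adding
    their second moments, each at most [16 * (T - s)]. *)
Definition noise_cst n : R := n.+2%:R * (n.+2%:R * (16 * (T - s))).

(** Bounds the expectation of the random factor in the pathwise comparison, control energy excepted:
    the constant 1, the squared noise at [T] and its time integral. *)
Definition cost_cst n : R := 1 + noise_cst n * (1 + (T - s)).

(** [Z] is a jointly measurable version of the noise size, which allows expectation and time
    integral to be exchanged. *)
Lemma expected_noise (Z : R -> Om -> R) n : jointly_measurable s T Z ->
  (forall t, t \in `[s, T] ->
    {ae P, forall w, Z t w = noise_size s (fun i => W i ^~ w) n t}) ->
  (forall t, t \in `[s, T] -> measurable_fun setT (Z t)) ->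
  (\int[P]_w (Z T w ^+ 2)%:E <= (noise_cst n)%:E)%E /\
  (\int[P]_w \int[mu]_(t in `[s, T]) (Z t w ^+ 2)%:E <= (noise_cst n * (T - s))%:E)%E.
Proof.
move=> jZ aeZ mZ; set C := noise_cst n.
have EZ t : t \in `[s, T] -> (\int[P]_w (Z t w ^+ 2)%:E <= C%:E)%E.
  move=> tsT; have [st tT] : s <= t /\ t <= T by rewrite !(itvP tsT).
  have mW i : measurable_fun setT (fun w => W i t w - W i s w).
    by apply: measurable_funB; apply: W_meas.
  have mW2 i : measurable_fun setT (fun w => ((W i t w - W i s w) ^+ 2)%:E).
    by apply/measurable_EFinP; exact: measurable_funX.
  apply: (@le_trans _ _ (\int[P]_w (n.+2%:R%:E * \sum_(i < n.+2) ((W i t w - W i s w) ^+ 2)%:E)))%E.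
    apply: ae_ge0_le_integral => //.
    - by move=> w _; rewrite lee_fin sqr_ge0.
    - by apply/measurable_EFinP; apply: measurable_funX; exact: mZ.
    - by move=> w _; rewrite mule_ge0 ?lee_fin// sume_ge0// => i _; rewrite lee_fin sqr_ge0.
    - by apply: measurable_funeM; apply: emeasurable_sum => i.
    - apply: filterS (aeZ t tsT) => w -> _.
      rewrite sumEFin -EFinM lee_fin /noise_size.
      apply: le_trans (sqr_sum_le _) _; rewrite card_ord ler_wpM2l//.
      by apply: ler_sum => i _; rewrite real_normK ?num_real.
  rewrite ge0_integralZl//; last 2 first.
  - by apply: emeasurable_sum => i.
  - by move=> w _; rewrite sume_ge0// => i _; rewrite lee_fin sqr_ge0.
  rewrite ge0_integral_sum//; last by move=> i w _; rewrite lee_fin sqr_ge0.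
  rewrite /C /noise_cst EFinM lee_pmul2l// ?lte_fin ?ltr0n//.
  apply: (@le_trans _ _ (\sum_(i < n.+2) (16 * (T - s))%:E)%E).
    apply: lee_sum => i _; apply: le_trans (brownian_increment_sqr (W_brownian i) st) _.
    by rewrite lee_fin ler_wpM2l// lerD2r.
  rewrite (eq_bigr (fun=> (16 * (T - s))%:E))// sumEFin.
  by rewrite lee_fin sumr_const card_ord -[leLHS]mulr_natl.
have TsT : T \in `[s, T] by rewrite in_itv/= sT lexx.
split; first exact: EZ.
pose D : set (measurableTypeR R * Om) := `[s, T]%classic `*` [set: Om].
have mD : measurable D by apply: measurableX => //; exact: measurable_itv.
pose h' : measurableTypeR R * Om -> \bar R := (fun p => (Z p.1 p.2 ^+ 2)%:E) \_ D.
have mh' : measurable_fun setT h'.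
  by apply/(measurable_restrictT _ mD); apply/measurable_EFinP; exact: measurable_funX.
have h'0 p : (0 <= h' p)%E.
  by rewrite /h' patchE; case: ifPn => // _; rewrite lee_fin sqr_ge0.
have h'E t w : h' (t, w) = if t \in `[s, T]%classic then (Z t w ^+ 2)%:E else 0%E.
  rewrite /h' !patchE; congr (if _ then _ else _).
  by apply/idP/idP; rewrite !inE => // -[].
have -> : (\int[P]_w \int[mu]_(t in `[s, T]) (Z t w ^+ 2)%:E =
    \int[P]_w \int[mu]_t h' (t, w))%E.
  apply: eq_integral => w _; rewrite [LHS]integral_mkcond.
  by apply: (eq_integral (fun t : measurableTypeR R => h' (t, w))) => t _; rewrite h'E patchE.
have -> : (\int[P]_w \int[mu]_t h' (t, w) = \int[mu]_t \int[P]_w h' (t, w))%E.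
  exact/esym/(@fubini_tonelli _ _ _ _ R mu P h' mh' h'0).
have -> : (\int[mu]_t \int[P]_w h' (t, w) =
   \int[mu]_(t in `[s, T]) \int[P]_w (Z t w ^+ 2)%:E)%E.
  rewrite [RHS]integral_mkcond; apply: eq_integral => t _; rewrite patchE.
  case: ifPn => tD; first by apply: eq_integral => w _; rewrite h'E tD.
  by rewrite integral0_eq// => w _; rewrite h'E (negbTE tD).
apply: (@le_trans _ _ (\int[mu]_(t in `[s, T]) C%:E)%E).
  apply: ge0_le_integral => //.
  - by move=> t _; apply: integral_ge0 => w _; rewrite lee_fin sqr_ge0.
  - have := measurable_fun_fubini_tonelli_F (m2 := P) h' mh' h'0.
    move=> /(measurable_funS (measurableT) (@subsetT _ `[s, T]%classic)).
    apply: eq_measurable_fun => t tD; rewrite /fubini_F.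
    by apply: eq_integral => w _; rewrite h'E tD.
rewrite EFin_Rintegral; [|exact: measurable_itv|exact: integrable_cst_itv].
by rewrite Rintegral_cst_itv.
Qed.

(** The pathwise comparison is integrated. Its random factor involves the energy of the control,
    whose expectation is bounded by the cost of [X2] itself, so the estimate holds uniformly over
    controls of any size. *)
Lemma expected_cost_compare B n (x : 'rV[R]_n.+1) eps1 eps2 X1 X2 : 0 <= B ->
  (forall W th X1 X2,
    (forall i, {within `[s, T], continuous (W i)}) ->
    mu.-integrable `[s, T] (EFin \o th) ->
    mu.-integrable `[s, T] (EFin \o (fun r => th r ^+ 2)) ->
    path_solution T f sigma s W th eps1 x X1 -> path_solution T f sigma s W th eps2 x X2 ->
    (path_cost T s th lambda L U X1 <= path_cost T s th lambda L U X2 +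
      (`|eps1 - eps2| * B * (moment_size T s W th n + noise_size s W n T ^+ 2))%:E)%E) ->
  solution T sigma f P W theta eps1 s x X1 -> solution T sigma f P W theta eps2 s x X2 ->
  (total_cost T lambda L U P theta s X1 <= total_cost T lambda L U P theta s X2 +
    (`|eps1 - eps2| * B)%:E *
      ((cost_cst n)%:E + (2 / lambda)%:E * total_cost T lambda L U P theta s X2))%E.
Proof.
move=> B0 cmp sol1 sol2; set C := cost_cst n.
have mc1 := measurable_cost sol1; have mc2 := measurable_cost sol2.
have eB0 : 0 <= `|eps1 - eps2| * B by rewrite mulr_ge0.
have l2 : 0 <= 2 / lambda by rewrite divr_ge0// ltW.
have C0 : 0 <= C.
  have Ts : 0 <= T - s by rewrite subr_ge0.
  apply: addr_ge0 => //; apply: mulr_ge0; last exact: addr_ge0.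
  by do 3 apply: mulr_ge0 => //.
have cost0 m (X : R -> Om -> 'rV[R]_m.+1) : (0 <= total_cost T lambda L U P theta s X)%E.
  by rewrite total_costE; apply: integral_ge0 => w _; exact: cost_of_ge0.
have [fin|] := ltP (total_cost T lambda L U P theta s X2) +oo%E; last first.
  rewrite leye_eq => /eqP E; rewrite [X in (_ <= X + _)%E]E addye ?leey//.
  by rewrite gt_eqF// (@lt_le_trans _ _ 0%E)// mule_ge0 ?lee_fin// adde_ge0 ?lee_fin// mule_ge0// lee_fin.
have ith := theta_integrable_ae sol2 fin.
have [N [mN N0 subN]] := noise_cont_ae.
have good w : ~ N w -> forall i, {within `[s, T], continuous (W i ^~ w)}.
  by move=> Nw; apply: contrapT => h; apply: Nw; exact: subN.
pose W' i := cutoff N (W i).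
have G_null t : P.-negligible `<=` <<s G t >> by exact: filtration_null.
have G_meas t A : t \in `[s, T] -> <<s G t >> A -> measurable A.
  by move=> _; exact: (filtration_meas P_complete W_meas).
have G_mono r t : r <= t -> <<s G r >> `<=` <<s G t >> by exact: filtration_mono.
have cW' i : continuous_paths s T (W' i).
  by apply: cutoff_ct => w Nw; exact: good.
have aW' i : adapted_to s T G (W' i).
  apply: cutoff_ad => // t; rewrite in_itv/= => /andP[st _].
  exact: filtration_noise.
have jW' i : jointly_measurable s T (W' i) := continuous_jointly_measurable sT G_meas (cW' i) (aW' i).
have mW' i t : t \in `[s, T] -> measurable_fun setT (W' i t).
  by move=> tsT; exact: (adapted_measurable G_meas (aW' i) tsT).
have ssT : s \in `[s, T] by rewrite in_itv/= lexx.
have TsT : T \in `[s, T] by rewrite in_itv/= sT lexx.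
pose Z t w := noise_size s (fun i => W' i ^~ w) n t.
have WE w : ~ N w -> (fun i => W' i ^~ w) = (fun i => W i ^~ w).
  by move=> Nw; apply/funext => i; apply/funext => t; rewrite /W' cutoffE.
have Nae (Q : Om -> Prop) : (forall w, ~ N w -> Q w) -> {ae P, forall w, Q w}.
  by move=> NQ; exists N; split => // w /=; apply: contra_notP => /NQ.
have mZ t : t \in `[s, T] -> measurable_fun setT (Z t).
  move=> tsT; rewrite /Z /noise_size; apply: measurable_sum => i.
  by apply: measurableT_comp => //; apply: measurable_funB; exact: mW'.
have jZ : jointly_measurable s T Z.
  rewrite /jointly_measurable /Z /noise_size; apply: measurable_sum => i.
  apply: measurableT_comp => //; apply: measurable_funB; first exact: jW'.
  by apply: measurable_funTS; apply: (measurableT_comp (mW' i s ssT)); exact: measurable_snd.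
have aeZ t : t \in `[s, T] -> {ae P, forall w, Z t w = noise_size s (fun i => W i ^~ w) n t}.
  by move=> _; apply: Nae => w Nw; rewrite /Z WE.
have [E1 E2] := expected_noise jZ aeZ mZ.
have mI : measurable_fun setT (fun w => (\int[mu]_(t in `[s, T]) (Z t w ^+ 2)%:E)%E).
  apply: measurable_time_integral => [|t w]; last exact: sqr_ge0.
  exact: measurable_funX.
have mT2 := measurable_theta_sqr.
have mZT : measurable_fun setT (fun w => (Z T w ^+ 2)%:E).
  by apply/measurable_EFinP; apply: measurable_funX; exact: mZ.
have iZ0 w : (0 <= \int[mu]_(t in `[s, T]) (Z t w ^+ 2)%:E)%E.
  by apply: integral_ge0 => t _; rewrite lee_fin sqr_ge0.
have th0 w : (0 <= \int[mu]_(t in `[s, T]) (`|theta t w| ^+ 2)%:E)%E.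
  by apply: integral_ge0 => t _; rewrite lee_fin sqr_ge0.
have ZT0 w : (0 <= (Z T w ^+ 2)%:E)%E by rewrite lee_fin sqr_ge0.
pose M w : \bar R := (1%:E + \int[mu]_(t in `[s, T]) (`|theta t w| ^+ 2)%:E
   + \int[mu]_(t in `[s, T]) (Z t w ^+ 2)%:E + (Z T w ^+ 2)%:E)%E.
have M0 w : (0 <= M w)%E by rewrite /M; do 3 (apply: adde_ge0 => //).
have mM : measurable_fun setT M.
  by rewrite /M; do 3 (apply: emeasurable_funD => //).
have EM : (\int[P]_w M w <= C%:E + (2 / lambda)%:E * total_cost T lambda L U P theta s X2)%E.
  rewrite /M ge0_integralD//; last 2 first.
  - by move=> w _; do 2 (apply: adde_ge0 => //).
  - by do 2 (apply: emeasurable_funD => //).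
  rewrite ge0_integralD//; last 2 first.
  - by move=> w _; do 2 (apply: adde_ge0 => //).
  - by apply: emeasurable_funD => //.
  rewrite ge0_integralD//.
  have -> : (\int[P]_(w in setT) 1 = 1%:E)%E.
    by rewrite integral_cst// mul1e; exact: probability_setT.
  apply: (@le_trans _ _ (1%:E + (2 / lambda)%:E * total_cost T lambda L U P theta s X2 +
     (noise_cst n * (T - s))%:E + (noise_cst n)%:E)%E).
    apply: leeD => //; apply: leeD => //; apply: leeD => //.
    exact: (theta_energy_le_cost sol2).
  rewrite [X in (X + _ + _)%E]addeC -!addeA [leRHS]addeC leeD2l//.
  by rewrite -!EFinD lee_fin /C /cost_cst; lra.
have Hae : {ae P, forall w, setT w -> (cost_of X1 w <= cost_of X2 w + (`|eps1 - eps2| * B)%:E * M w)%E}.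
  have HN : {ae P, forall w, ~ N w} by exact: Nae.
  have sol12 : {ae P, forall w,
    path_solution T f sigma s (fun i => W i ^~ w) (theta ^~ w) eps1 x (X1 ^~ w) /\
    path_solution T f sigma s (fun i => W i ^~ w) (theta ^~ w) eps2 x (X2 ^~ w)}.
    by apply: filterS2 (solution_path sol1) (solution_path sol2) => w; split.
  apply: filterS3 HN ith sol12 => w /[dup] /good gw /WE eW [i1 i2] [p1 p2] _.
  apply: le_trans (cmp _ _ _ _ gw i1 i2 p1 p2) _.
  rewrite leeD2l// EFinM lee_wpmul2l ?lee_fin// /M /moment_size.
  have iz2 : mu.-integrable `[s, T] (EFin \o (fun t => Z t w ^+ 2)).
    apply: continuous_itv_integrable => t.
    rewrite /Z eW; apply: (@continuousM _ (subspace `[s, T])); exact: noise_size_cont.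
  have -> : (\int[mu]_(t in `[s, T]) (`|theta t w| ^+ 2)%:E =
     \int[mu]_(t in `[s, T]) (theta t w ^+ 2)%:E)%E.
    by apply: eq_integral => t _; rewrite real_normK ?num_real.
  have mI' : measurable (`[s, T]%classic : set (measurableTypeR R)).
    exact: measurable_itv.
  rewrite (EFin_Rintegral mI' i2) (EFin_Rintegral mI' iz2).
  by rewrite -!EFinD /Z eW.
rewrite !total_costE.
apply: (@le_trans _ _ (\int[P]_w (cost_of X2 w + (`|eps1 - eps2| * B)%:E * M w))%E).
  apply: ae_ge0_le_integral => //.
  - by move=> w _; exact: cost_of_ge0.
  - by move=> w _; rewrite adde_ge0 ?cost_of_ge0// mule_ge0// lee_fin.
  - by apply: emeasurable_funD => //; exact: measurable_funeM.
rewrite ge0_integralD//; last 3 first.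
- by move=> w _; exact: cost_of_ge0.
- by move=> w _; rewrite mule_ge0// lee_fin.
- exact: measurable_funeM.
rewrite ge0_integralZl// leeD2l// lee_wpmul2l ?lee_fin//.
Qed.

End cost.

End controlled_system.

(** * Values at different noise levels *)

Section vanishing_noise.
Context (R : realType) (T lambda sigma : R) (f : R -> R -> R -> P2 R -> R)
  (f_mu : R -> R -> R -> P2 R -> R -> R) (L U : R -> R)
  (CL11 CL10 CL20 CU11 CU10 CU20 : R).
Hypotheses (lambda_gt0 : 0 < lambda) (f_assum : drift_assumption T f f_mu)
  (L_assum : cost_assumption L CL11 CL10 CL20) (U_assum : cost_assumption U CU11 CU10 CU20).
Variable s : R.
Hypothesis s0T : s \in `[0, T].

Definition cost_set (eps : R) n (x : 'rV[R]_n.+1) : set (\bar R) :=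
  [set c | exists d (Om : measurableType d)
    (P : probability Om R) (W : nat -> R -> Om -> R) (theta : R -> Om -> R) X,
    [/\ admissible T sigma f P W theta eps s,
        solution T sigma f P W theta eps s x X &
        c = total_cost T lambda L U P theta s X]].

Lemma valueE eps n (x : 'rV[R]_n.+1) :
  value T lambda sigma f L U eps s x = fine (ereal_inf (cost_set eps x)).
Proof. by []. Qed.

Let s_ge0 : 0 <= s. Proof. by rewrite (itvP s0T). Qed.
Let sT : s <= T. Proof. by rewrite (itvP s0T). Qed.

Lemma cost_set_ge0 eps n (x : 'rV[R]_n.+1) c : cost_set eps x c -> (0 <= c)%E.
Proof.
move=> [d [Om [P [W [theta [X [_ _ ->]]]]]]]; rewrite total_costE.
apply: integral_ge0 => w _; apply: (cost_of_ge0 T s theta lambda_gt0).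
- by move=> y; exact: (cost_ge0 L_assum).
- by move=> y; exact: (cost_ge0 U_assum).
Qed.

(** Finiteness of [c] makes the control integrable in time, hence usable at the other noise level.
    [B] and [C] are chosen before the control and the noise levels. *)
Lemma cost_set_transfer n (x : 'rV[R]_n.+1) : exists B C, [/\ 0 <= B, 0 <= C &
  forall eps1 eps2, `|eps1| <= 1 -> `|eps2| <= 1 -> forall c, cost_set eps2 x c ->
  (c < +oo)%E -> exists2 c', cost_set eps1 x c' &
  (c' <= c + (`|eps1 - eps2| * B)%:E * (C%:E + (2 / lambda)%:E * c))%E].
Proof.
have [K K0 f_lip] := drift_lipschitz f_assum.
have [CL0 _ Lc _] := derivable_lip_growth L_assum.
have [CU0 _ Uc _] := derivable_lip_growth U_assum.
have [B B0 cmp] := path_cost_compare K0 f_lip sigma s_ge0 sT lambda x L_assum U_assum.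
exists B, (cost_cst T s n); split => //.
  rewrite /cost_cst /noise_cst; have Ts : 0 <= T - s by rewrite subr_ge0.
  apply: addr_ge0 => //; apply: mulr_ge0; last exact: addr_ge0.
  by do 3 apply: mulr_ge0 => //.
move=> eps1 eps2 e1 e2 _ [d [Om [P [W [theta [X [adm sol ->]]]]]]] fin.
have [Pc Wb Wi thm tha _ _] := adm.
have L0 := cost_ge0 L_assum; have U0 := cost_ge0 U_assum.
have ith : {ae P, forall w, lebesgue_measure.-integrable `[s, T] (EFin \o theta ^~ w)}.
  have := theta_integrable_ae sT Pc Wb thm lambda_gt0 Lc Uc L0 U0 sol fin.
  by apply: filterS => w [].
have adm1 := admissible_transfer K0 f_lip s_ge0 sT Pc Wb thm tha eps1 ith adm.
have [Y solY] := admissible_exists adm1 x.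
exists (total_cost T lambda L U P theta s Y).
  by exists d, Om, P, W, theta, Y; split.
apply: (expected_cost_compare sT Pc Wb thm lambda_gt0 Lc Uc L0 U0 B0 _ solY sol).
move=> W' th X1 X2 Wc i1 i2 p1 p2; exact: cmp.
Qed.

Lemma value_compare n (x : 'rV[R]_n.+1) : exists B C, [/\ 0 <= B, 0 <= C &
  forall eps1 eps2, `|eps1| <= 1 -> `|eps2| <= 1 ->
  value T lambda sigma f L U eps1 s x <= value T lambda sigma f L U eps2 s x
    + `|eps1 - eps2| * B * (C + 2 / lambda * value T lambda sigma f L U eps2 s x)].
Proof.
have [B [C [B0 C0 tr]]] := cost_set_transfer x; exists B, C; split => //.
move=> e1 e2 e11 e21; rewrite !valueE.
have inf0 e : (0 <= ereal_inf (cost_set e x))%E.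
  by apply: le_ereal_inf_tmp => c; exact: cost_set_ge0.
have eB : 0 <= `|e1 - e2| * B by rewrite mulr_ge0.
have l2 : 0 <= 2 / lambda by rewrite divr_ge0// ltW.
have [fin|] := ltP (ereal_inf (cost_set e2 x)) +oo%E; last first.
  (* An infinite infimum is read as the value 0. Transfer in the opposite direction shows that the
     other infimum is infinite as well, so both values are 0. *)
  rewrite leye_eq => /eqP E2; rewrite E2 /= mulr0 addr0 add0r.
  suff -> : ereal_inf (cost_set e1 x) = +oo%E by rewrite mulr_ge0.
  apply/eqP; rewrite -leye_eq; apply: le_ereal_inf_tmp => c cS.
  rewrite leNgt; apply/negP => cfin.
  have cfn : c \is a fin_num by rewrite ge0_fin_numE// (cost_set_ge0 cS).
  have [c' c'S] := tr e2 e1 e21 e11 c cS cfin.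
  have : (+oo <= c')%E by rewrite -E2; exact: ereal_inf_lbound.
  by rewrite leye_eq => /eqP ->; rewrite -(fineK cfn) -!(EFinM, EFinD) leye_eq.
have fn : ereal_inf (cost_set e2 x) \is a fin_num by rewrite ge0_fin_numE.
set m := ereal_inf _ in fn *.
have mE : m = (fine m)%:E by rewrite fineK.
have m0 : 0 <= fine m by rewrite fine_ge0// inf0.
have key e : 0 < e -> (ereal_inf (cost_set e1 x) <=
   (fine m + e + `|e1 - e2| * B * (C + 2 / lambda * (fine m + e)))%:E)%E.
  move=> e0; have [c cS cm] := lb_ereal_inf_adherent e0 fn.
  rewrite -/m mE -EFinD in cm.
  have [c' c'S] := tr e1 e2 e11 e21 c cS (lt_trans cm (ltry _)).
  have c0 := cost_set_ge0 cS.
  have cfin : c \is a fin_num by rewrite ge0_fin_numE// (lt_trans cm (ltry _)).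
  rewrite -(fineK cfin) -!(EFinM, EFinD) => le.
  apply: le_trans (ereal_inf_lbound c'S) _; apply: le_trans le _.
  rewrite lee_fin; have cr : fine c <= fine m + e by rewrite -lee_fin fineK// ltW.
  by rewrite lerD// ler_wpM2l// lerD2l ler_wpM2l.
have fin1 : ereal_inf (cost_set e1 x) \is a fin_num.
  by rewrite ge0_fin_numE// (le_lt_trans (key 1 ltr01) (ltry _)).
rewrite -lee_fin fineK//; apply/lee_addgt0Pr => e e0.
(* [a] is the slope of the bound as a function of the cost, so an error [e / a] in the infimum costs
   exactly [e]. *)
set a := 1 + `|e1 - e2| * B * (2 / lambda).
have a0 : 0 < a by rewrite ltr_wpDr// mulr_ge0.
apply: le_trans (key (e / a) _) _; first by rewrite divr_gt0.
rewrite -EFinD lee_fin.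
have -> : fine m + e / a + `|e1 - e2| * B * (C + 2 / lambda * (fine m + e / a)) =
   fine m + `|e1 - e2| * B * (C + 2 / lambda * fine m) + a * (e / a).
  by rewrite /a; ring.
by rewrite mulrCA divff ?mulr1 ?gt_eqF.
Qed.

Lemma value_vanishing_noise n (x : 'rV[R]_n.+1) : exists D, forall eps, 0 < eps <= 1 ->
  `|value T lambda sigma f L U eps s x - value T lambda sigma f L U 0 s x| <= eps * D.
Proof.
have [B [C [B0 C0 cmp]]] := value_compare x.
set v := fun eps => value T lambda sigma f L U eps s x.
have v0 e : 0 <= v e.
  rewrite /v valueE fine_ge0//; apply: le_ereal_inf_tmp => c; exact: cost_set_ge0.
have l2 : 0 <= 2 / lambda by rewrite divr_ge0// ltW.
set k := 2 / lambda in l2 cmp *.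
(* [M] bounds [v e] for all [e <= 1], so the rate obtained does not involve [v e]. *)
pose M := v 0 + B * (C + k * v 0).
exists (B * (C + k * M)) => e /andP[e0 e1].
have ne : `|e| <= 1 by rewrite gtr0_norm.
have := cmp 0 e _ ne; have := cmp e 0 ne; rewrite normr0 ler01 => /(_ isT) /= h1 /(_ isT) /= h2.
rewrite subr0 in h1; rewrite sub0r normrN in h2; rewrite !(gtr0_norm e0) in h1 h2.
rewrite -/(v 0) -/(v e) in h1 h2 *.
have kv : 0 <= B * (C + k * v 0) by rewrite mulr_ge0// addr_ge0// mulr_ge0.
have veM : v e <= M.
  apply: le_trans h1 _; rewrite /M lerD2l -mulrA ler_piMl//.
have v0M : v 0 <= M by rewrite /M lerDl.
have mono a : a <= M -> e * B * (C + k * a) <= e * (B * (C + k * M)).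
  by move=> aM; rewrite -mulrA !ler_wpM2l ?(ltW e0)// lerD2l ler_wpM2l.
rewrite ler_norml lerBlDr lerBrDr; have := mono _ veM; have := mono _ v0M.
lra.
Qed.

End vanishing_noise.

(** * The lift to empirical measures *)

Section balanced.
Context (R : realType).

(** All fibres of [phi] have the same size, stated through the consequence that is used: averages of
    nonnegative extended functions are preserved. It covers duplications and permutations, and
    applies to measures and costs alike. *)
Definition balanced n m (phi : 'I_m.+1 -> 'I_n.+1) := forall g : 'I_n.+1 -> \bar R,
  (forall i, 0 <= g i)%E ->
  ((m.+1%:R^-1)%:E * \sum_j g (phi j) = (n.+1%:R^-1)%:E * \sum_i g i)%E.

Lemma balanced_perm n (p : 'S_n.+1) : balanced p.
Proof. by move=> g _; congr (_ * _)%E; rewrite [RHS](reindex_inj (@perm_inj _ p)). Qed.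

Lemma balanced_prod k (I : finType) n (psi : I -> 'I_n.+1) (e : 'I_k.+1 -> I) m :
  bijective e -> k.+1 = (n.+1 * m.+1)%N ->
  (forall i, #|[pred a | psi a == i]| = m.+1) -> balanced (psi \o e).
Proof.
move=> be kE fib g g0.
have -> : (\sum_j g ((psi \o e) j) = \sum_a g (psi a))%E.
  by rewrite [RHS](reindex e) //=; exact: onW_bij.
rewrite (partition_big psi xpredT)//=.
have -> : (\sum_i \sum_(a | psi a == i) g (psi a) = \sum_i (m.+1%:R)%:E * g i)%E.
  apply: eq_bigr => i _; rewrite (eq_bigr (fun=> g i)); last by move=> a /eqP ->.
  rewrite big_const fib iter_addr_0.
  by rewrite muleC mule_natr.
rewrite -ge0_sume_distrr// muleA -EFinM; congr (_%:E * _)%E.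
by rewrite kE natrM invfM -mulrA mulVf ?mulr1 ?pnatr_eq0.
Qed.

(** The common index set consists of the pairs, and the two projections have fibres of constant
    size. *)
Lemma common_refinement n m : exists k (phi : 'I_k.+1 -> 'I_n.+1) (psi : 'I_k.+1 -> 'I_m.+1),
  balanced phi /\ balanced psi.
Proof.
have kE : (n.+1 * m.+1).-1.+1 = #|{: 'I_n.+1 * 'I_m.+1}| by rewrite card_prod !card_ord.
pose e (j : 'I_(n.+1 * m.+1).-1.+1) : 'I_n.+1 * 'I_m.+1 := enum_val (cast_ord kE j).
have be : bijective e.
  exists (fun a => cast_ord (esym kE) (enum_rank a)) => a; rewrite /e.
    by rewrite enum_valK cast_ordK.
  by rewrite cast_ordKV enum_rankK.
exists (n.+1 * m.+1).-1, (fst \o e), (snd \o e); split.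
  apply: (balanced_prod (m := m)) => //= i.
  rewrite (eq_card (B := [predX pred1 i & 'I_m.+1])); last first.
    by move=> [a b]; rewrite !inE andbT.
  by rewrite cardX card1 card_ord mul1n.
apply: (balanced_prod (m := n)) => //; first exact: (mulnC n.+1 m.+1).
move=> i /=. rewrite (eq_card (B := [predX 'I_n.+1 & pred1 i])); last first.
  by move=> [a b]; rewrite !inE.
by rewrite cardX card1 card_ord muln1.
Qed.

Lemma empirical_balanced n m (phi : 'I_m.+1 -> 'I_n.+1) (x : 'rV[R]_n.+1) :
  balanced phi -> empirical x ≡μ empirical (colsub phi x).
Proof.
move=> bal A mA.
apply: (etrans (empirical_measureE x A)); apply/esym/(etrans (empirical_measureE _ A)).
rewrite -(bal (fun i => \d_(x ord0 i) A)); last by move=> i; rewrite lee_fin.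
by congr (_ * _)%E; apply: eq_bigr => j _; rewrite mxE.
Qed.

(** The masses of singletons give the multiplicity of each value. *)
Lemma empirical_perm n (x y : 'rV[R]_n.+1) : empirical x ≡μ empirical y ->
  exists p : 'S_n.+1, y = colsub p x.
Proof.
move=> xy; pose tx := [tuple x ord0 i | i < n.+1]; pose ty := [tuple y ord0 i | i < n.+1].
suff /tuple_permP[p E] : perm_eq ty tx.
  exists p; apply/rowP => i; rewrite mxE.
  have := congr1 (fun s => nth 0 s i) E; by rewrite -!tnth_nth !tnth_mktuple.
have cnt (z : 'rV[R]_n.+1) v :
    empirical z [set v] = (n.+1%:R^-1 * (count_mem v [tuple z ord0 i | i < n.+1])%:R)%:E.
  rewrite EFinM; apply: (etrans (empirical_measureE z _)); congr (_ * _)%E.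
  rewrite -sum1_count big_tuple natr_sum -sumEFin [RHS]big_mkcond/=.
  apply: eq_bigr => i _; rewrite tnth_mktuple diracE.
  by case: eqP => [->|ne]; [rewrite mem_set|rewrite memNset].
apply/allP => v _ /=; have := etrans (esym (cnt x v)) (etrans (xy [set v] (measurable_set1 v)) (cnt y v)).
case=> /mulfI; rewrite invr_eq0 pnatr_eq0 => /(_ isT) /eqP.
by rewrite eqr_nat eq_sym.
Qed.

End balanced.

Arguments balanced R {n m} phi.

(** * Dependence of the value on the empirical measure alone *)

Section lift.
Context (R : realType) (T lambda sigma : R) (f : R -> R -> R -> P2 R -> R)
  (f_mu : R -> R -> R -> P2 R -> R -> R) (L U : R -> R)
  (CL11 CL10 CL20 CU11 CU10 CU20 : R).
Hypotheses (lambda_gt0 : 0 < lambda) (f_assum : drift_assumption T f f_mu)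
  (L_assum : cost_assumption L CL11 CL10 CL20) (U_assum : cost_assumption U CU11 CU10 CU20).
Variable s : R.
Hypothesis s0T : s \in `[0, T].

Let s_ge0 : 0 <= s. Proof. by rewrite (itvP s0T). Qed.
Let sT : s <= T. Proof. by rewrite (itvP s0T). Qed.

(** At noise level 0 the particles share all their noise and the drift sees only position and
    empirical measure, so copies of a particle follow the same path. *)
Lemma solution_reindex d (Om : measurableType d) (P : probability Om R) W theta
    n m (phi : 'I_m.+1 -> 'I_n.+1) (x : 'rV[R]_n.+1) X : balanced R phi ->
  solution T sigma f P W theta 0 s x X ->
  solution T sigma f P W theta 0 s (colsub phi x) (fun t w => colsub phi (X t w)).
Proof.
move=> bal [aX cX iX eX].
have fE r w j : r \in `[s, T] ->
    f r (theta r w) ((colsub phi (X r w)) ord0 j) (empirical (colsub phi (X r w))) =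
    f r (theta r w) (X r w ord0 (phi j)) (empirical (X r w)).
  rewrite in_itv/= => /andP[sr rT]; rewrite mxE; apply: (drift_eqmeas f_assum).
    by rewrite in_itv/= rT (le_trans s_ge0 sr).
  by move=> A mA; rewrite -(empirical_balanced (X r w) bal).
split.
- move=> j; rewrite (_ : (fun t w => _) = fun t w => X t w ord0 (phi j)); first exact: aX.
  by apply/funext => t; apply/funext => w; rewrite mxE.
- apply: filterS cX => w cX j.
  rewrite (_ : (fun t => _) = fun t => X t w ord0 (phi j)); first exact: cX.
  by apply/funext => t; rewrite mxE.
- apply: filterS iX => w iX j.
  apply: (eq_integrable _ _ _ _ (iX (phi j))); first exact: measurable_itv.
  by move=> r; rewrite inE => rsT; rewrite fE.
- apply: filterS eX => w eX j t tsT; rewrite !mxE eX// !mul0r !addr0.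
  congr (_ + _ + _); apply: eq_Rintegral => r; rewrite inE/= => rst.
  rewrite -fE ?mxE//; move: rst tsT; rewrite !in_itv/= => /andP[-> rt] /andP[_ tT].
  exact: le_trans rt tT.
Qed.

Lemma total_cost_reindex d (Om : measurableType d) (P : probability Om R) (theta : R -> Om -> R)
    n m (phi : 'I_m.+1 -> 'I_n.+1) X : balanced R phi ->
  total_cost T lambda L U P theta s (fun t w => colsub phi (X t w)) =
  total_cost T lambda L U P theta s X.
Proof.
have L0 := cost_ge0 L_assum; have U0 := cost_ge0 U_assum.
move=> bal; apply: eq_integral => w _; congr (_ + _ + _)%E.
  rewrite -(bal (fun i => \int[lebesgue_measure]_(t in `[s, T]) (L (X t w ord0 i))%:E)%E).
    by congr (_ * _)%E; apply: eq_bigr => j _; apply: eq_integral => t _; rewrite mxE.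
  by move=> i; apply: integral_ge0 => t _; rewrite lee_fin.
rewrite -(bal (fun i => (U (X T w ord0 i))%:E)).
  by congr (_ * _)%E; apply: eq_bigr => j _; rewrite mxE.
by move=> i; rewrite lee_fin.
Qed.

(** A solution of the reindexed system comes with a control admissible for every number of
    particles, hence with a solution of the original system. Reindexing the latter gives back the
    former by pathwise uniqueness, so both systems realise the same costs. *)
Lemma value_reindex n m (phi : 'I_m.+1 -> 'I_n.+1) (x : 'rV[R]_n.+1) : balanced R phi ->
  value T lambda sigma f L U 0 s (colsub phi x) = value T lambda sigma f L U 0 s x.
Proof.
move=> bal; rewrite !valueE; congr (fine (ereal_inf _)); apply/seteqP; split => c.
  move=> [d [Om [P [W [theta [Y [adm solY ->]]]]]]].
  have [X solX] := admissible_exists adm x.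
  exists d, Om, P, W, theta, X; split; [exact: adm|exact: solX|].
  rewrite -(total_cost_reindex P theta X bal).
  have solX' := solution_reindex bal solX.
  have [Pc Wb _ thm tha _ un] := adm.
  have eYX := un _ _ _ _ solY solX'.
  have [_ _ Lc _] := derivable_lip_growth L_assum.
  have [_ _ Uc _] := derivable_lip_growth U_assum.
  have mc := measurable_cost sT Pc Wb thm lambda Lc Uc (cost_ge0 L_assum).
  rewrite !total_costE; apply: ae_eq_integral => //.
  - exact: (mc _ _ _ _ _ _ solY).
  - exact: (mc _ _ _ _ _ _ solX').
  apply: filterS eYX => w eYX _; have TsT : s <= T <= T by rewrite sT lexx.
  rewrite /path_cost eYX//; congr (_ * _ + _ + _)%E; apply: eq_bigr => i _.
  by apply: eq_integral => t; rewrite inE/= in_itv/= => tsT; rewrite eYX.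
move=> [d [Om [P [W [theta [X [adm solX ->]]]]]]].
exists d, Om, P, W, theta, (fun t w => colsub phi (X t w)); split.
- exact: adm.
- exact: solution_reindex.
by rewrite total_cost_reindex.
Qed.

Lemma value_empirical n m (x : 'rV[R]_n.+1) (y : 'rV[R]_m.+1) :
  empirical x ≡μ empirical y ->
  value T lambda sigma f L U 0 s x = value T lambda sigma f L U 0 s y.
Proof.
move=> xy; have [k [phi [psi [bphi bpsi]]]] := common_refinement R n m.
have [A mA|p E] := @empirical_perm R k (colsub phi x) (colsub psi y).
  by rewrite -(empirical_balanced x bphi)// xy// (empirical_balanced y bpsi).
rewrite -(value_reindex x bphi) -(value_reindex y bpsi) E.
by rewrite [RHS](value_reindex _ (balanced_perm p)).
Qed.

Lemma lifted_valueE n (x : 'rV[R]_n.+1) (mu : P2 R) : mu ≡μ empirical x ->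
  lifted_value T lambda sigma f L U s mu = value T lambda sigma f L U 0 s x.
Proof.
move=> mux; rewrite /lifted_value.
set S := [set v | _]; have : S (xget 0 S).
  by apply: xgetPex; exists (value T lambda sigma f L U 0 s x), n, x.
move=> [m [y [muy ->]]]; apply: value_empirical => A mA.
by rewrite -muy// mux.
Qed.

End lift.

(** * The Lipschitz estimate in finite dimension *)

Section lipschitz_from_gradient.
Context (R : realType) (n : nat).
Implicit Types (x y u v M : 'rV[R]_n.+1).

Definition msq x : R := n.+1%:R^-1 * \sum_(j < n.+1) x ord0 j ^+ 2.

Definition dsq x y : R := msq (x - y).

Lemma msq_ge0 x : 0 <= msq x.
Proof. by rewrite mulr_ge0// sumr_ge0// => j _; rewrite sqr_ge0. Qed.

(** Symmetrising the double sum in [i] and [j] reduces the claim to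
    [0 <= (a i * b j - a j * b i) ^+ 2]. *)
Lemma cauchy_schwarz_sum (I : finType) (a b : I -> R) :
  \sum_i a i * b i <= Num.sqrt (\sum_i a i ^+ 2) * Num.sqrt (\sum_i b i ^+ 2).
Proof.
have a0 : 0 <= \sum_i a i ^+ 2 by rewrite sumr_ge0// => i _; rewrite sqr_ge0.
rewrite -sqrtrM//; apply: le_trans (ler_norm _) _; rewrite -sqrtr_sqr ler_wsqrtr//.
rewrite expr2 !mulr_suml.
under eq_bigr do rewrite mulr_sumr.
under [leRHS]eq_bigr do rewrite mulr_sumr.
rewrite -(ler_pM2l (ltr0n R 2)) !mulr_natl mulr2n [leRHS]mulr2n.
rewrite [X in _ <= _ + X]exchange_big/= -!big_split/=; apply: ler_sum => i _.
rewrite -!big_split/=; apply: ler_sum => j _.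
have := sqr_ge0 (a i * b j - a j * b i); rewrite !expr2; lra.
Qed.

(** The conditions on [h] say that it lies between 0 and [d], for either sign of [d]. *)
Lemma partial_lipschitz (V : 'rV[R]_n.+1 -> R) (i : 'I_n.+1) (z : 'rV[R]_n.+1) (d C : R) :
  let e : 'rV[R]_n.+1 := delta_mx ord0 i in
  (forall h, derivable V (z + h *: e) e) ->
  (forall h, `|h| <= `|d| -> h * d >= 0 -> `|'D_e V (z + h *: e)| <= C) ->
  `|V (z + d *: e) - V z| <= C * `|d|.
Proof.
move=> e dV bV; pose g (h : R) := V (z + h *: e).
have gE h : (fun k : R => k^-1 *: (g (k *: (1 : R) + h) - g h)) =
    (fun k : R => k^-1 *: (V (k *: e + (z + h *: e)) - V (z + h *: e))).
  apply/funext => k; rewrite /g; congr (_ *: (V _ - _)).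
  by rewrite [k *: (1 : R)]mulr1 scalerDl addrCA.
have dg h : derivable g h (1 : R) by rewrite /derivable gE; exact: dV.
have Dg h : 'D_(1 : R) g h = 'D_e V (z + h *: e) by rewrite /derive gE.
have id h : is_derive h (1 : R) g ('D_e V (z + h *: e)).
  by rewrite -Dg; exact: (@derivableP _ _ _ g h 1 (dg h)).
have cg a b : {within `[a, b], continuous g}.
  by apply: derivable_within_continuous => h _; exact: dg.
have -> : V (z + d *: e) - V z = g d - g 0 by rewrite /g scale0r addr0.
have [d0|d0] := leP 0 d.
  have [c c0d ->] := MVT_segment d0 (fun h _ => id h) (cg _ _).
  rewrite subr0 normrM ler_wpM2r// bV//.
    by rewrite !ger0_norm ?(itvP c0d).
  by rewrite mulr_ge0 ?(itvP c0d).
have [c c0d E] := MVT_segment (ltW d0) (fun h _ => id h) (cg _ _).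
rewrite distrC E sub0r normrM normrN ler_wpM2r// bV//.
  by rewrite !ler0_norm ?lerN2 ?(itvP c0d)// ltW.
by rewrite mulr_le0 ?(itvP c0d)// ltW.
Qed.

Section gradient.
Variables (V : 'rV[R]_n.+1 -> R) (A B : R).
Hypotheses (A_ge0 : 0 <= A) (B_ge0 : 0 <= B).
Hypothesis V_grad : forall i x, let e : 'rV[R]_n.+1 := delta_mx ord0 i in
  derivable V x e /\
  `|'D_e V x| <= A / n.+1%:R * Num.sqrt (1 + `|x ord0 i| ^+ 2 + msq x) + B / n.+1%:R.

(** Coordinates pass from [u] to [v] one at a time. All intermediate points stay in the box given by
    [M], where the partial derivatives are bounded, and Cauchy-Schwarz sums the increments. *)
Lemma gradient_step u v M :
  (forall i, `|u ord0 i| <= M ord0 i) -> (forall i, `|v ord0 i| <= M ord0 i) ->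
  `|V u - V v| <= (A * (1 + msq M) + B) * Num.sqrt (dsq u v).
Proof.
move=> uM vM; pose K : R := n.+1%:R; have K0 : 0 < K by rewrite ltr0n.
pose z k : 'rV[R]_n.+1 := \row_j (if (j < k)%N then v ord0 j else u ord0 j).
have zM k j : `|z k ord0 j| <= M ord0 j by rewrite mxE; case: ifP.
have MM x : (forall j, `|x ord0 j| <= M ord0 j) -> msq x <= msq M.
  move=> xM; rewrite ler_wpM2l// ler_sum// => j _.
  by rewrite -[X in X <= _]real_normK ?num_real// ler_sqr// nnegrE// (le_trans _ (xM j)).
pose c i := A / K * Num.sqrt (1 + M ord0 i ^+ 2 + msq M) + B / K.
have step (k : 'I_n.+1) : `|V (z k.+1) - V (z k)| <= c k * `|v ord0 k - u ord0 k|.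
  have -> : z k.+1 = z k + (v ord0 k - u ord0 k) *: delta_mx ord0 k.
    apply/rowP => j; rewrite !mxE eqxx/= ltnS leq_eqVlt.
    have [<-|ne] /= := eqVneq j k; first by rewrite eqxx ltnn/= mulr1 addrC subrK.
    by rewrite (negbTE ne : (j == k :> nat) = false) /= mulr0 addr0.
  apply: partial_lipschitz => h; first exact: (V_grad _ _).1.
  move=> hd hd0; apply: le_trans (V_grad _ _).2 _; rewrite /c lerD2r ler_wpM2l//.
    by rewrite divr_ge0// ltW.
  have zh j : `|(z k + h *: delta_mx ord0 k) ord0 j| <= M ord0 j.
    have [->|ne] := eqVneq j k; last first.
      suff -> : (z k + h *: delta_mx ord0 k) ord0 j = z k ord0 j by exact: zM.
      by rewrite !mxE (negbTE ne) andbF mulr0 addr0.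
    rewrite !mxE ltnn !eqxx/= mulr1.
    have := uM k; have := vM k; rewrite !ler_norml => /andP[v1 v2] /andP[u1 u2].
    have [d0|d0] := leP 0 (v ord0 k - u ord0 k).
      have h0 : 0 <= h.
        rewrite leNgt; apply/negP => hn; move: hd0; rewrite nmulr_rge0// => d0'.
        by move: hd; rewrite ltr0_norm// ger0_norm//; lra.
      by move: hd; rewrite !ger0_norm//; lra.
    have h0 : h <= 0.
      by rewrite leNgt; apply/negP => hn; move: hd0; rewrite pmulr_rge0//; lra.
    by move: hd; rewrite (ltr0_norm d0) ler0_norm//; lra.
  rewrite ler_wsqrtr// lerD ?MM// lerD2l ler_sqr ?nnegrE//.
  exact: le_trans (zh k).
have tele : `|V u - V v| <= \sum_(k < n.+1) c k * `|v ord0 k - u ord0 k|.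
  have -> : V u - V v = - \sum_(k < n.+1) (V (z k.+1) - V (z k)).
    rewrite -(big_mkord xpredT (fun k => V (z k.+1) - V (z k))) telescope_sumr//.
    rewrite opprB; congr (V _ - V _); apply/rowP => j; rewrite mxE ?ltn_ord//.
  by rewrite normrN (le_trans (ler_norm_sum _ _ _))// ler_sum.
apply: le_trans tele _.
pose d k := `|v ord0 k - u ord0 k|.
have dE : \sum_k d k ^+ 2 = K * dsq u v.
  rewrite /dsq /msq mulrA divff ?gt_eqF// mul1r; apply: eq_bigr => k _.
  by rewrite /d real_normK ?num_real// !mxE -sqrrN opprB.
have dS0 : 0 <= dsq u v by exact: msq_ge0.
have W0 := sqrtr_ge0 (dsq u v).
set W := Num.sqrt (dsq u v) in W0 *.
have s1 : \sum_k Num.sqrt (1 + M ord0 k ^+ 2 + msq M) * d k <= K * ((1 + msq M) * W).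
  apply: le_trans (cauchy_schwarz_sum _ _) _.
  have -> : \sum_k Num.sqrt (1 + M ord0 k ^+ 2 + msq M) ^+ 2 = K * (1 + msq M *+ 2).
    under eq_bigr do rewrite sqr_sqrtr ?addr_ge0 ?sqr_ge0 ?msq_ge0//.
    rewrite !big_split/= !sumr_const card_ord mulrDr mulr1 -/K mulr2n mulrDr addrA.
    congr (_ + _ + _); last by rewrite mulr_natl.
    by rewrite /msq mulrA divff ?mul1r ?gt_eqF.
  rewrite dE -sqrtrM; last by rewrite mulr_ge0 ?(ltW K0)// addr_ge0// mulrn_wge0// msq_ge0.
  have m0 := msq_ge0 M.
  (* After squaring, the claim is [1 + 2 * msq M <= (1 + msq M) ^+ 2]. Here the square root in the
     gradient bound turns into [1 + msq M]. *)
  have -> : K * ((1 + msq M) * W) = Num.sqrt ((K * ((1 + msq M) * W)) ^+ 2).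
    by rewrite sqrtr_sqr ger0_norm// !mulr_ge0 ?addr_ge0// ltW.
  rewrite ler_wsqrtr// !exprMn /W sqr_sqrtr//.
  rewrite mulrACA -expr2 ler_wpM2l ?sqr_ge0// ler_wpM2r//.
  rewrite mulr2n; have := sqr_ge0 (msq M); lra.
have s2 : \sum_k d k <= K * W.
  have := cauchy_schwarz_sum (fun=> 1) d.
  under eq_bigr do rewrite mul1r.
  move=> /le_trans; apply; under eq_bigr do rewrite expr1n.
  rewrite sumr_const card_ord dE -/K -sqrtrM ?(ltW K0)//.
  by rewrite mulrA -expr2 sqrtrM ?sqr_ge0// sqrtr_sqr gtr0_norm.
have -> : \sum_k c k * `|v ord0 k - u ord0 k| =
   A / K * \sum_k Num.sqrt (1 + M ord0 k ^+ 2 + msq M) * d k + B / K * \sum_k d k.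
  by rewrite !mulr_sumr -big_split/=; apply: eq_bigr => k _; rewrite mulrDl mulrA.
have AK : 0 <= A / K by rewrite divr_ge0// ltW.
have BK : 0 <= B / K by rewrite divr_ge0// ltW.
apply: le_trans (lerD (ler_wpM2l AK s1) (ler_wpM2l BK s2)) _.
by rewrite !mulrA !divfK ?gt_eqF// -mulrDl.
Qed.

End gradient.

Section segment.
Variables (V : 'rV[R]_n.+1 -> R) (A B : R).
Hypotheses (A_ge0 : 0 <= A) (B_ge0 : 0 <= B).
Hypothesis V_step : forall u v M,
  (forall i, `|u ord0 i| <= M ord0 i) -> (forall i, `|v ord0 i| <= M ord0 i) ->
  `|V u - V v| <= (A * (1 + msq M) + B) * Num.sqrt (dsq u v).

(** Squares are convex, so on each piece the box may be taken with a second moment that interpolates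
    linearly between those of [x] and [y], up to [D / q]. The mean of the left end parameters
    [k / q] is 1/2 up to [O(1 / q)], which gives [(msq x + msq y) / 2] in the limit. *)
Lemma segment_lipschitz x y :
  `|V x - V y| <= (A * (1 + (msq x + msq y) / 2) + B) * Num.sqrt (dsq x y).
Proof.
pose K : R := n.+1%:R; have K0 : 0 < K by rewrite ltr0n.
set W := Num.sqrt (dsq x y); have W0 : 0 <= W := sqrtr_ge0 _.
(* [D / q] is the mean enlargement that lets one box contain both ends of a piece. *)
pose D := K^-1 * \sum_j `|x ord0 j ^+ 2 - y ord0 j ^+ 2|.
have D0 : 0 <= D by rewrite mulr_ge0 ?invr_ge0 ?(ltW K0)// sumr_ge0.
have mx := msq_ge0 x; have my := msq_ge0 y.
suff H m : `|V x - V y| <= (A * (1 + (msq x + msq y) / 2) + B) * W +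
    (A * (D + msq x) * W) / m.+1%:R.
  apply/ler_addgt0Pr => e e0.
  set E := A * (D + msq x) * W in H.
  have E0 : 0 <= E by rewrite !mulr_ge0// addr_ge0.
  pose m := Num.truncn (E / e).
  apply: le_trans (H m) _; rewrite lerD2l ler_pdivrMr ?ltr0n//.
  rewrite mulrC -ler_pdivrMr//; apply: ltW; exact: truncnS_gt.
pose q : R := m.+1%:R; have q0 : 0 < q by rewrite ltr0n.
pose z (k : nat) : 'rV[R]_n.+1 := x + (k%:R / q) *: (y - x).
have step (k : nat) : (k < m.+1)%N -> `|V (z k) - V (z k.+1)| <=
    (A * (1 + (msq x + (k%:R / q) * (msq y - msq x) + D / q)) + B) * (W / q).
  move=> km; set r := k%:R / q.
  have r0 : 0 <= r by rewrite divr_ge0// ltW.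
  have r1 : r + q^-1 <= 1.
    by rewrite -[q^-1]mul1r -mulrDl ler_pdivrMr// mul1r natr1 ler_nat.
  have q1 : 0 < q^-1 by rewrite invr_gt0.
  have rS : k.+1%:R / q = r + q^-1 by rewrite -natr1 mulrDl mul1r.
  pose l i := x ord0 i ^+ 2 + r * (y ord0 i ^+ 2 - x ord0 i ^+ 2)
     + `|x ord0 i ^+ 2 - y ord0 i ^+ 2| / q.
  pose M : 'rV[R]_n.+1 := \row_i Num.sqrt (l i).
  have convex (a b p : R) : 0 <= p <= 1 -> (a + p * (b - a)) ^+ 2 <= a ^+ 2 + p * (b ^+ 2 - a ^+ 2).
    move=> /andP[p0 p1]; have -> : a ^+ 2 + p * (b ^+ 2 - a ^+ 2) =
      (a + p * (b - a)) ^+ 2 + p * (1 - p) * (b - a) ^+ 2 by ring.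
    by rewrite lerDl; apply: mulr_ge0; rewrite ?sqr_ge0// mulr_ge0// subr_ge0.
  have kl i : z k ord0 i ^+ 2 <= l i.
    rewrite !mxE -/r; apply: le_trans (convex _ _ _ _) _.
      by rewrite r0 (le_trans _ r1)// lerDl ltW.
    by rewrite lerDl mulr_ge0// ltW.
  have kl' i : z k.+1 ord0 i ^+ 2 <= l i.
    rewrite !mxE rS; apply: le_trans (convex _ _ _ _) _.
      by rewrite r1 andbT addr_ge0// ltW.
    rewrite mulrDl addrA lerD2l mulrC ler_pM2r//.
    by rewrite distrC ler_norm.
  have l0 i : 0 <= l i by exact: le_trans (sqr_ge0 _) (kl i).
  have zM (w : 'rV[R]_n.+1) : (forall i, w ord0 i ^+ 2 <= l i) ->
      forall i, `|w ord0 i| <= M ord0 i.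
    by move=> wl i; rewrite mxE -sqrtr_sqr ler_wsqrtr.
  apply: le_trans (V_step (zM _ kl) (zM _ kl')) _.
  have -> : msq M = msq x + r * (msq y - msq x) + D / q.
    rewrite /msq (eq_bigr l); last by move=> i _; rewrite mxE sqr_sqrtr.
    rewrite /l !big_split/= -mulr_sumr -mulr_suml sumrB /D; ring.
  suff -> : Num.sqrt (dsq (z k) (z k.+1)) = W / q by [].
  have -> : dsq (z k) (z k.+1) = (q^-1) ^+ 2 * dsq x y.
    rewrite /dsq /msq mulrCA; congr (_ * _); rewrite mulr_sumr; apply: eq_bigr => i _.
    by rewrite !mxE rS -/r; ring.
  by rewrite sqrtrM ?sqr_ge0// sqrtr_sqr gtr0_norm// mulrC.
have -> : V x - V y = \sum_(k < m.+1) (V (z k) - V (z k.+1)).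
  rewrite -(big_mkord xpredT (fun k => V (z k) - V (z k.+1))).
  rewrite (eq_bigr (fun k => - (V (z k.+1) - V (z k)))); last by move=> k _; rewrite opprB.
  rewrite sumrN telescope_sumr// opprB; congr (V _ - V _); rewrite /z.
    by rewrite mul0r scale0r addr0.
  by rewrite divff ?gt_eqF// scale1r addrC subrK.
apply: le_trans (ler_norm_sum _ _ _) _.
apply: (@le_trans _ _ (\sum_(k < m.+1)
   (A * (1 + (msq x + (k%:R / q) * (msq y - msq x) + D / q)) + B) * (W / q))).
  by apply: ler_sum => k _; exact: step.
have sumk : \sum_(k < m.+1) (k%:R : R) = q * (q - 1) / 2.
  rewrite /q; elim: (m.+1) => [|p IH]; first by rewrite big_ord0 mul0r mul0r.
  by rewrite big_ord_recr/= IH -natr1; field.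
rewrite -mulr_suml big_split/= sumr_const card_ord -mulr_sumr big_split/=.
rewrite sumr_const card_ord big_split/= big_split/= !sumr_const card_ord.
rewrite -!mulr_suml sumk -[msq x *+ _]mulr_natl -[(D / q) *+ _]mulr_natl -[B *+ _]mulr_natl -/q.
set a := msq x in mx *; set b := msq y in my *.
have -> : (A * (q + (q * a + q * (q - 1) / 2 / q * (b - a) + q * (D / q))) + q * B) * (W / q)
   = (A * (1 + (a + b) / 2) + B) * W + A * (D + (a - b) / 2) * W / q.
  by field; rewrite gt_eqF.
rewrite lerD2l ler_pM2r ?invr_gt0// ler_wpM2r// ler_wpM2l// lerD2l; lra.
Qed.

End segment.
End lipschitz_from_gradient.

(** * The Lipschitz estimate for the value *)

Section value_lipschitz.
Context (R : realType) (T lambda sigma : R) (f : R -> R -> R -> P2 R -> R)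
  (f_mu : R -> R -> R -> P2 R -> R -> R) (L U : R -> R)
  (CL11 CL10 CL20 CU11 CU10 CU20 C2 : R).
Hypotheses (lambda_gt0 : 0 < lambda) (f_assum : drift_assumption T f f_mu)
  (L_assum : cost_assumption L CL11 CL10 CL20) (U_assum : cost_assumption U CU11 CU10 CU20)
  (C2_bound : gradient_bound T lambda sigma f L U CL11 CL10 CU11 CU10 C2).
Variable t : R.
Hypothesis t0T : t \in `[0, T].

Let A := C2 * (CL11 + CU11).
Let B := C2 * (CL10 + CU10).

(** The sign of [C2] is not assumed. For one particle at [a] the bound
    [A * sqrt (1 + 2 * a ^+ 2) + B] dominates an absolute value; large [a] excludes [A < 0]. Then
    either [CL11 + CU11 = 0] and [a = 0] gives the sign of [B], or [C2] itself is nonnegative. *)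
Lemma gradient_constants_ge0 : 0 <= A /\ 0 <= B.
Proof.
have [CL1 CL0 _ _] := derivable_lip_growth L_assum.
have [CU1 CU0 _ _] := derivable_lip_growth U_assum.
have G a : 0 <= A * Num.sqrt (1 + a ^+ 2 + a ^+ 2) + B.
  have [_] := @C2_bound 0 ord0 1 t (const_mx a) ltr01 t0T.
  move=> /(le_trans (normr_ge0 _)); rewrite /G_bound !divr1 mxE big_ord1 invr1 mul1r mxE.
  by rewrite real_normK ?num_real.
have A0 : 0 <= A.
  rewrite leNgt; apply/negP => An.
  pose a := (`|B| + 1) / - A.
  have a0 : 0 <= a by rewrite divr_ge0 ?addr_ge0// oppr_ge0 ltW.
  have sa : a <= Num.sqrt (1 + a ^+ 2 + a ^+ 2).
    by rewrite -[leLHS](ger0_norm a0) -sqrtr_sqr ler_wsqrtr// lerDr addr_ge0// sqr_ge0.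
  have Aa : A * a = - (`|B| + 1) by rewrite /a; field; rewrite lt_eqF.
  have := G a; have : A * Num.sqrt (1 + a ^+ 2 + a ^+ 2) <= A * a by exact: ler_wnM2l (ltW An) _ _ sa.
  have := ler_norm B; lra.
split=> //; have := addr_ge0 CL1 CU1; rewrite le_eqVlt => /predU1P[c0|c0].
  by have := G 0; rewrite /A -c0 mulr0 mul0r add0r.
by rewrite mulr_ge0 ?addr_ge0//; move: A0; rewrite /A pmulr_lge0.
Qed.

Lemma value_lipschitz n (x y : 'rV[R]_n.+1) :
  `|value T lambda sigma f L U 0 t x - value T lambda sigma f L U 0 t y|
    <= (A * (1 + (msq x + msq y) / 2) + B) * Num.sqrt (dsq x y).
Proof.
have [A0 B0] := gradient_constants_ge0.
apply: segment_lipschitz => // u v M uM vM.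
have [Du Hu] := value_vanishing_noise sigma lambda_gt0 f_assum L_assum U_assum t0T u.
have [Dv Hv] := value_vanishing_noise sigma lambda_gt0 f_assum L_assum U_assum t0T v.
apply/ler_addgt0Pr => e e0.
(* The rates [Du] and [Dv] belong to the two fixed end points; the level [eps] is chosen so that
   both errors together are at most [e]. *)
pose D := `|Du| + `|Dv| + 1; have D0 : 0 < D by rewrite ltr_wpDl// addr_ge0.
pose eps := Num.min 1 (e / D).
have eps0 : 0 < eps by rewrite lt_min ltr01 divr_gt0.
have eps1 : 0 < eps <= 1 by rewrite eps0 ge_min lexx.
have epsD : eps * D <= e by rewrite -ler_pdivlMr// ge_min lexx orbT.
have G : `|value T lambda sigma f L U eps t u - value T lambda sigma f L U eps t v| <=
    (A * (1 + msq M) + B) * Num.sqrt (dsq u v).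
  apply: gradient_step => // i z e_i; have [dV bV] := C2_bound i z eps0 t0T.
  split => //; apply: le_trans bV _; rewrite /G_bound /msq.
  by under eq_bigr do rewrite real_normK ?num_real//.
have := Hu _ eps1; have := Hv _ eps1; have := ler_norm Du; have := ler_norm Dv.
move: G; rewrite !ler_norml => /andP[g1 g2] v1 u1 /andP[v2 v3] /andP[u2 u3].
have : eps * Du <= eps * `|Du| by rewrite ler_wpM2l// ltW.
have : eps * Dv <= eps * `|Dv| by rewrite ler_wpM2l// ltW.
have : eps * D = eps * `|Du| + eps * `|Dv| + eps by rewrite /D; ring.
lra.
Qed.

End value_lipschitz.

(** * Optimality of comonotone couplings *)

(** Lebesgue measure on the plane gets a name to which its sigma-finite structure is attached, for
    use in Tonelli's theorem with [P]. *)
Definition plane_measure (R : realType) :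
    set (measurableTypeR R * measurableTypeR R)%type -> \bar R :=
  (@lebesgue_measure R \x @lebesgue_measure R)%E.

Arguments plane_measure R : clear implicits.

HB.instance Definition _ (R : realType) := Measure.on (plane_measure R).

Lemma plane_measure_rectangle (R : realType) (A B : set (measurableTypeR R)) :
  measurable A -> measurable B ->
  plane_measure R (A `*` B) = (lebesgue_measure A * lebesgue_measure B)%E.
Proof. exact: product_measure1E. Qed.

Lemma plane_measure_sigma_finite (R : realType) : sigma_finite setT (plane_measure R).
Proof.
pose I (n : nat) : set (measurableTypeR R) := `[- n%:R, n%:R]%classic.
have mI n : measurable (I n) by exact: measurable_itv.
exists (fun n => I n `*` I n).
  apply/seteqP; split => // p _.
  pose n := (Num.truncn (Num.max `|p.1| `|p.2|)).+1.
  have /ltW : Num.max `|p.1| `|p.2| < n%:R by exact: truncnS_gt.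
  rewrite ge_max !ler_norml => /andP[p1 p2]; exists n => //; split;
    by rewrite /I /= in_itv.
move=> n; split; first exact: measurableX.
rewrite [X in (X < _)%E]plane_measure_rectangle// lte_mul_pinfty//.
  by rewrite lebesgue_measure_itv/=; case: ifP => _; rewrite -?EFinD.
by rewrite lebesgue_measure_itv/=; case: ifP => _; rewrite -?EFinD ltry.
Qed.

HB.instance Definition _ (R : realType) :=
  Measure_isSigmaFinite.Build _ _ _ (plane_measure R) (@plane_measure_sigma_finite R).

Section excess.
Context (R : realType) d (Om : measurableType d) (P : probability Om R).
Notation mu := (@lebesgue_measure R).
Variables X Y : Om -> R.
Hypotheses (mX : measurable_fun setT X) (mY : measurable_fun setT Y).

Definition straddle (a b : R) : set Om := [set w | X w <= a /\ b < Y w].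

Lemma measurable_straddle a b : measurable (straddle a b).
Proof.
rewrite (_ : straddle a b = X @^-1` `]-oo, a] `&` Y @^-1` `]b, +oo[).
  apply: measurableI; rewrite -[X in measurable X]setTI.
    by apply: mX => //; exact: measurable_itv.
  by apply: mY => //; exact: measurable_itv.
by apply/seteqP; split => w; rewrite /straddle /= !in_itv/= andbT.
Qed.

(* Tonelli, using that [(y - x)_+ ^ 2] is the area of the square [[x, y[ ^ 2]. *)
Lemma excess_sqr_integral :
  (\int[P]_w (Num.max 0 (Y w - X w) ^+ 2)%:E =
   \int[plane_measure R]_p P (straddle (Num.min p.1 p.2) (Num.max p.1 p.2)))%E /\
  measurable_fun setT (fun p : measurableTypeR R * measurableTypeR R =>
    P (straddle (Num.min p.1 p.2) (Num.max p.1 p.2))).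
Proof.
pose TT := (measurableTypeR R * measurableTypeR R)%type.
pose S : set (TT * Om) := [set q | [&& X q.2 <= q.1.1, X q.2 <= q.1.2,
   q.1.1 < Y q.2 & q.1.2 < Y q.2]].
have m1 : measurable_fun setT (fun q : TT * Om => q.1.1 : R).
  by apply: (measurableT_comp measurable_fst); exact: measurable_fst.
have m2 : measurable_fun setT (fun q : TT * Om => q.1.2 : R).
  by apply: (measurableT_comp measurable_snd); exact: measurable_fst.
have mXs : measurable_fun setT (fun q : TT * Om => X q.2).
  by apply: (measurableT_comp mX); exact: measurable_snd.
have mYs : measurable_fun setT (fun q : TT * Om => Y q.2).
  by apply: (measurableT_comp mY); exact: measurable_snd.
have mS : measurable S.
  pose g (q : TT * Om) := [&& X q.2 <= q.1.1, X q.2 <= q.1.2, q.1.1 < Y q.2 & q.1.2 < Y q.2].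
  have mg : measurable_fun setT g.
    apply: measurable_and; first exact: measurable_fun_ler.
    apply: measurable_and; first exact: measurable_fun_ler.
    by apply: measurable_and; exact: measurable_fun_ltr.
  rewrite (_ : S = setT `&` g @^-1` [set true]); first exact: mg.
  by apply/seteqP; split => q //= -[].
pose h (q : TT * Om) : \bar R := (\1_S q)%:E.
have mh : measurable_fun setT h by apply/measurable_EFinP; exact: measurable_indic.
have h0 q : (0 <= h q)%E by rewrite lee_fin.
have Ep (p : TT) : (\int[P]_w h (p, w) =
    P (straddle (Num.min p.1 p.2) (Num.max p.1 p.2)))%E.
  rewrite /h (_ : (fun w => _) = (fun w => (\1_(straddle (Num.min p.1 p.2) (Num.max p.1 p.2)) w)%:E)).
    by rewrite integral_indic ?setIT//; exact: measurable_straddle.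
  apply/funext => w; rewrite !indicE; congr ((_ : bool)%:R%:E).
  apply/idP/idP; rewrite !inE /S /straddle /= le_min gt_max.
    by move=> /and4P[-> -> -> ->].
  by move=> [/andP[-> ->] /andP[-> ->]].
have Ew (w : Om) : (\int[plane_measure R]_p h (p, w) = (Num.max 0 (Y w - X w) ^+ 2)%:E)%E.
  pose I : set (measurableTypeR R) := `[X w, Y w[%classic.
  have mI : measurable I by exact: measurable_itv.
  rewrite /h (_ : (fun p => _) = (fun p => (\1_(I `*` I) p)%:E)).
    rewrite integral_indic ?setIT//; last exact: measurableX.
    transitivity (mu I * mu I)%E; first exact: plane_measure_rectangle.
    rewrite lebesgue_measure_itv/= lte_fin /Num.max subr_gt0.
    by case: ifP => _; rewrite ?mule0 ?expr0n// -EFinD -EFinM.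
  apply/funext => p; rewrite !indicE; congr ((_ : bool)%:R%:E).
  apply/idP/idP; rewrite !inE /S /I /= !in_itv/=.
    by move=> /and4P[-> -> -> ->].
  by move=> [/andP[-> ->] /andP[-> ->]].
split.
  under eq_integral do rewrite -Ew.
  under [RHS]eq_integral do rewrite -Ep.
  apply/esym; exact: (@fubini_tonelli _ _ _ _ R (plane_measure R) P h mh h0).
have := measurable_fun_fubini_tonelli_F (m2 := P) h mh h0.
by apply: eq_measurable_fun => p _; rewrite /fubini_F Ep.
Qed.

(** Comonotonicity as nesting of events: for any two thresholds one sublevel set contains the
    other. *)
Definition comonotone := forall a b,
  [set w | X w <= a] `<=` [set w | Y w <= b] \/ [set w | Y w <= b] `<=` [set w | X w <= a].

End excess.

Section comonotone_coupling.
Context (R : realType) d1 (O1 : measurableType d1) (P1 : probability O1 R)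
  d2 (O2 : measurableType d2) (P2 : probability O2 R).

(** The probability of [straddle a b] is at least the positive part of [P (X <= a) - P (Y <= b)],
    which depends on the marginals only. Nested sublevel sets give equality, for all [a] and [b] at
    once. *)
Lemma comonotone_excess_le (X1 Y1 : O1 -> R) (X2 Y2 : O2 -> R) :
  measurable_fun setT X1 -> measurable_fun setT Y1 ->
  measurable_fun setT X2 -> measurable_fun setT Y2 ->
  (forall a, P1 [set w | X1 w <= a] = P2 [set w | X2 w <= a]) ->
  (forall a, P1 [set w | Y1 w <= a] = P2 [set w | Y2 w <= a]) ->
  comonotone X2 Y2 ->
  (\int[P2]_w (Num.max 0 (Y2 w - X2 w) ^+ 2)%:E <=
   \int[P1]_w (Num.max 0 (Y1 w - X1 w) ^+ 2)%:E)%E.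
Proof.
move=> mX1 mY1 mX2 mY2 EX EY com.
have [-> m1] := excess_sqr_integral P1 mX1 mY1.
have [-> m2] := excess_sqr_integral P2 mX2 mY2.
apply: ge0_le_integral => // p _.
set a := Num.min _ _; set b := Num.max _ _.
have mle d (O : measurableType d) (Z : O -> R) c : measurable_fun setT Z ->
    measurable [set w | Z w <= c].
  move=> mZ; rewrite (_ : [set w | _] = setT `&` Z @^-1` `]-oo, c]).
    by apply: mZ => //; exact: measurable_itv.
  by apply/seteqP; split => w; rewrite /= in_itv/= => // -[].
have [sub|sub] := com a b.
  rewrite (_ : straddle X2 Y2 a b = set0) ?measure0//.
  apply/seteqP; split => // w [Xa bY]; have := sub w Xa; rewrite /=.
  by rewrite leNgt bY.
have fin2 : P2 [set w | Y2 w <= b] \is a fin_num by rewrite fin_num_measure//; exact: mle.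
rewrite -(leeD2rE _ _ fin2).
have -> : (P2 (straddle X2 Y2 a b) + P2 [set w | (Y2 w <= b)%R] = P2 [set w | (X2 w <= a)%R])%E.
  rewrite -measureU; [congr (P2 _)|exact: measurable_straddle|exact: mle|].
    apply/seteqP; split => w /=; first by move=> [[]//|]; exact: sub.
    by move=> Xa; have [Yb|bY] := leP (Y2 w) b; [right|left].
  by apply/seteqP; split => // w [[_ bY]] /=; rewrite leNgt bY.
rewrite -EX -EY -measureU; [|exact: measurable_straddle|exact: mle|]; last first.
  by apply/seteqP; split => // w [[_ bY]] /=; rewrite leNgt bY.
apply: le_measure; rewrite ?inE; [exact: mle| |].
  by apply: measurableU; [exact: measurable_straddle|exact: mle].
by move=> w Xa; have [Yb|bY] := leP (Y1 w) b; [right|left].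
Qed.

(** The square splits into the squares of the two positive parts, and the previous bound applies to
    each with the roles exchanged. *)
Lemma comonotone_optimal (X1 Y1 : O1 -> R) (X2 Y2 : O2 -> R) :
  measurable_fun setT X1 -> measurable_fun setT Y1 ->
  measurable_fun setT X2 -> measurable_fun setT Y2 ->
  (forall a, P1 [set w | X1 w <= a] = P2 [set w | X2 w <= a]) ->
  (forall a, P1 [set w | Y1 w <= a] = P2 [set w | Y2 w <= a]) ->
  comonotone X2 Y2 ->
  (\int[P2]_w ((X2 w - Y2 w) ^+ 2)%:E <= \int[P1]_w ((X1 w - Y1 w) ^+ 2)%:E)%E.
Proof.
move=> mX1 mY1 mX2 mY2 EX EY com.
have split d (O : measurableType d) (P : probability O R) (X Y : O -> R) :
    measurable_fun setT X -> measurable_fun setT Y ->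
    (\int[P]_w ((X w - Y w) ^+ 2)%:E = \int[P]_w (Num.max 0 (Y w - X w) ^+ 2)%:E +
      \int[P]_w (Num.max 0 (X w - Y w) ^+ 2)%:E)%E.
  move=> mX mY; rewrite -ge0_integralD//.
  - apply: eq_integral => w _; rewrite -EFinD; congr (_%:E).
    by rewrite /Num.max !subr_gt0; case: ltgtP => [?|?|->]; ring.
  - by move=> w _; rewrite lee_fin sqr_ge0.
  - apply/measurable_EFinP; apply: measurable_funX; apply: measurable_maxr => //.
    exact: measurable_funB.
  - by move=> w _; rewrite lee_fin sqr_ge0.
  - apply/measurable_EFinP; apply: measurable_funX; apply: measurable_maxr => //.
    exact: measurable_funB.
rewrite !split//; apply: leeD; apply: comonotone_excess_le => //.
by move=> a b; have [|] := com b a; [right|left].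
Qed.

End comonotone_coupling.

(** * Square integrable variables and their laws *)

Section l2_norm.
Context (R : realType) d (Om : measurableType d) (P : probability Om R).

Definition l2norm (Z : Om -> R) : R := Num.sqrt (fine (\int[P]_w (Z w ^+ 2)%:E)).

Lemma l2norm_ge0 Z : 0 <= l2norm Z. Proof. exact: sqrtr_ge0. Qed.

Definition finite_energy (Z : Om -> R) :=
  measurable_fun setT Z /\ (\int[P]_w (Z w ^+ 2)%:E < +oo)%E.

Lemma energy_ge0 (Z : Om -> R) : (0 <= \int[P]_w (Z w ^+ 2)%:E)%E.
Proof. by apply: integral_ge0 => w _; rewrite lee_fin sqr_ge0. Qed.

Lemma energy_fin Z : finite_energy Z -> (\int[P]_w (Z w ^+ 2)%:E)%E \is a fin_num.
Proof. by move=> [_ Zf]; rewrite ge0_fin_numE// energy_ge0. Qed.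

Lemma l2norm_sqr Z : l2norm Z ^+ 2 = fine (\int[P]_w (Z w ^+ 2)%:E).
Proof. by rewrite sqr_sqrtr// fine_ge0// energy_ge0. Qed.

Lemma Lnorm2E Z : finite_energy Z -> ('N[P]_2%:E[EFin \o Z] = (l2norm Z)%:E)%E.
Proof.
move=> fZ; rewrite unlock /=.
under eq_integral do rewrite /= powR_mulrn// -normrX ger0_norm ?sqr_ge0//.
rewrite -(fineK (energy_fin fZ)) poweR_EFin powR12_sqrt//.
by rewrite fine_ge0// energy_ge0.
Qed.

Lemma finite_energyD Z1 Z2 : finite_energy Z1 -> finite_energy Z2 ->
  finite_energy (fun w => Z1 w + Z2 w).
Proof.
move=> [m1 f1] [m2 f2]; split; first exact: measurable_funD.
have ms (Z : Om -> R) : measurable_fun setT Z -> measurable_fun setT (fun w : Om => (Z w ^+ 2)%:E).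
  by move=> mZ; apply/measurable_EFinP; exact: measurable_funX.
apply: (@le_lt_trans _ _ (\int[P]_w ((2%:E * (Z1 w ^+ 2)%:E) + 2%:E * (Z2 w ^+ 2)%:E)))%E.
  apply: ge0_le_integral => //.
  - by move=> w _; rewrite lee_fin sqr_ge0.
  - by apply: ms; exact: measurable_funD.
  - by apply: emeasurable_funD; apply: measurable_funeM; exact: ms.
  - move=> w _; rewrite -!EFinM -EFinD lee_fin; have := sqr_ge0 (Z1 w - Z2 w); nra.
rewrite ge0_integralD//; last 4 first.
- by move=> w _; rewrite mule_ge0// lee_fin sqr_ge0.
- by apply: measurable_funeM; exact: ms.
- by move=> w _; rewrite mule_ge0// lee_fin sqr_ge0.
- by apply: measurable_funeM; exact: ms.
rewrite !ge0_integralZl//; try exact: ms; try (by move=> w _; rewrite lee_fin sqr_ge0).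
by rewrite lte_add_pinfty// lte_mul_pinfty.
Qed.

Lemma finite_energyN Z : finite_energy Z -> finite_energy (fun w => - Z w).
Proof.
move=> [m f]; split; first exact: measurable_funN.
by under eq_integral do rewrite sqrrN.
Qed.

Lemma finite_energyB Z1 Z2 : finite_energy Z1 -> finite_energy Z2 ->
  finite_energy (fun w => Z1 w - Z2 w).
Proof. by move=> f1 f2; apply: finite_energyD => //; exact: finite_energyN. Qed.

Lemma l2normN Z : l2norm (fun w => - Z w) = l2norm Z.
Proof. by rewrite /l2norm; under eq_integral do rewrite sqrrN. Qed.

Lemma l2norm_triangle Z1 Z2 : finite_energy Z1 -> finite_energy Z2 ->
  l2norm (fun w => Z1 w + Z2 w) <= l2norm Z1 + l2norm Z2.
Proof.
move=> f1 f2; rewrite -lee_fin EFinD -!Lnorm2E//; last exact: finite_energyD.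
by apply: minkowski_EFin; [exact: f1.1|exact: f2.1|rewrite ler1n].
Qed.

End l2_norm.

Section wasserstein.
Context (R : realType).
Implicit Types mu nu : P2 R.

Section laws.
Context d (Om : measurableType d) (P : probability Om R).

Lemma has_law_energy (X : Om -> R) mu : measurable_fun setT X -> has_law P X mu ->
  (\int[P]_w (X w ^+ 2)%:E = \int[mu]_y (y ^+ 2)%:E)%E.
Proof.
move=> mX lX; apply: (has_law_integral (g := fun y => (y ^+ 2)%:E) mX lX).
  by apply/measurable_EFinP; exact: measurable_funX.
by move=> y; rewrite lee_fin sqr_ge0.
Qed.

Lemma has_law_finite_energy (X : Om -> R) mu : measurable_fun setT X -> has_law P X mu ->
  finite_energy P X.
Proof. by move=> mX lX; split => //; rewrite (has_law_energy mX lX); exact: p2_finite_moment. Qed.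

Lemma has_law_moment2 (X : Om -> R) mu : measurable_fun setT X -> has_law P X mu ->
  moment2 mu = l2norm P X ^+ 2.
Proof. by move=> mX lX; rewrite l2norm_sqr (has_law_energy mX lX). Qed.

Lemma coupling_inf_le (X Y : Om -> R) mu nu :
  measurable_fun setT X -> measurable_fun setT Y -> has_law P X mu -> has_law P Y nu ->
  (ereal_inf [set (\int[pi]_z ((z.1 - z.2) ^+ 2)%:E)%E | pi in coupling mu nu]
   <= \int[P]_w ((X w - Y w) ^+ 2)%:E)%E.
Proof.
move=> mX mY lX lY.
pose TT := (measurableTypeR R * measurableTypeR R)%type.
have mXY : @measurable_fun _ _ Om TT setT (fun w => (X w, Y w)).
  exact: measurable_fun_pair.
pose XY : {RV P >-> TT} := @mfun_Sub _ _ Om TT (fun w => (X w, Y w)) (mem_set mXY).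
apply: ereal_inf_lbound; exists (distribution P XY).
  move=> A mA; rewrite /= /distribution /pushforward; split.
    by rewrite -lX//; congr (P _); apply/seteqP; split => w /= => [[]|].
  by rewrite -lY//; congr (P _); apply/seteqP; split => w /= => [[]|].
rewrite ge0_integral_distribution//.
- apply/measurable_EFinP; apply: measurable_funX; apply: measurable_funB.
    exact: measurable_fst.
  exact: measurable_snd.
- by move=> z; rewrite lee_fin sqr_ge0.
Qed.

Lemma W2_le (X Y : Om -> R) mu nu :
  measurable_fun setT X -> measurable_fun setT Y -> has_law P X mu -> has_law P Y nu ->
  W2 mu nu <= l2norm P (fun w => X w - Y w).
Proof.
move=> mX mY lX lY; have le := coupling_inf_le mX mY lX lY.
have fXY := finite_energyB (has_law_finite_energy mX lX) (has_law_finite_energy mY lY).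
rewrite /W2 /l2norm ler_wsqrtr//; apply: fine_le => //; last exact: energy_fin.
rewrite ge0_fin_numE; first exact: le_lt_trans le fXY.2.
apply: le_ereal_inf_tmp => _ [pi _ <-]; apply: integral_ge0 => z _.
by rewrite lee_fin sqr_ge0.
Qed.

(** Under a coupling [pi] the coordinates of the plane have the two given laws, so
    [comonotone_optimal] compares every coupling with the pair [X], [Y]. *)
Lemma W2_comonotone (X Y : Om -> R) mu nu :
  measurable_fun setT X -> measurable_fun setT Y -> has_law P X mu -> has_law P Y nu ->
  comonotone X Y -> W2 mu nu = l2norm P (fun w => X w - Y w).
Proof.
move=> mX mY lX lY com; rewrite /W2 /l2norm; congr (Num.sqrt (fine _)).
apply/eqP; rewrite eq_le coupling_inf_le//=.
apply: le_ereal_inf_tmp => _ [pi cpi <-].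
have hl a : measurable (`]-oo, a]%classic : set (measurableTypeR R)).
  exact: measurable_itv.
apply: (@comonotone_optimal R _ (measurableTypeR R * measurableTypeR R)%type pi _ Om P
  (fun z => z.1) (fun z => z.2) X Y) => //.
- exact: measurable_fst.
- exact: measurable_snd.
- move=> a; have [piX _] := cpi _ (hl a); have := lX _ (hl a); rewrite -piX.
  rewrite (_ : X @^-1` _ = [set w | X w <= a]); last first.
    by apply/seteqP; split => w; rewrite /= in_itv.
  move=> ->; congr (pi _); apply/seteqP; split => z; rewrite /= in_itv/=; first by [].
  by case.
- move=> a; have [_ piY] := cpi _ (hl a); have := lY _ (hl a); rewrite -piY.
  rewrite (_ : Y @^-1` _ = [set w | Y w <= a]); last first.
    by apply/seteqP; split => w; rewrite /= in_itv.
  move=> ->; congr (pi _); apply/seteqP; split => z; rewrite /= in_itv/=; first by [].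
  by case.
Qed.

End laws.
End wasserstein.

(** * Quantile functions *)

Section half_lines.
Context (R : realType).

Lemma half_line_diff (a b : R) :
  `]a, b]%classic = `]-oo, b]%classic `\` `]-oo, a]%classic.
Proof.
apply/seteqP; split => x /=; rewrite !in_itv/=.
  by move=> /andP[ax ->]; split => //; apply/negP; rewrite -ltNge.
by move=> [-> /negP]; rewrite -ltNge => ->.
Qed.

Lemma measurable_sublevel d (Om : measurableType d) (Z : Om -> R) :
  (forall a, measurable [set w | Z w <= a]) -> measurable_fun setT Z.
Proof.
move=> mZ; apply: (@measurability _ _ Om (measurableTypeR R) setT Z (@ocitv R)) => //.
move=> _ [_ [[a b] _ <-] <-] /=; rewrite setTI half_line_diff.
rewrite (_ : Z @^-1` _ = [set w | Z w <= b] `\` [set w | Z w <= a]); first exact: measurableD.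
by apply/seteqP; split => w; rewrite /= !in_itv.
Qed.

Lemma measure_half_line_unique (m1 m2 : probability (measurableTypeR R) R) :
  (forall a, m1 `]-oo, a]%classic = m2 `]-oo, a]%classic) ->
  forall A, measurable A -> m1 A = m2 A.
Proof.
move=> E; apply: (@measure_unique _ R (measurableTypeR R) (@ocitv R)
  (fun n => `]- n%:R, n%:R]%classic) _ _ _ _ m1 m2) => //.
- exact: ocitvI.
- move=> n; exact: is_ocitv.
- apply/seteqP; split => // x _; exists (Num.truncn `|x|).+1 => //=.
  have : `|x| < (Num.truncn `|x|).+1%:R by exact: truncnS_gt.
  by rewrite ltr_norml in_itv/= => /andP[-> /ltW ->].
- move=> _ [[a b] _ <-] /=.
  have [ab|ba] := leP a b; last by rewrite set_itv_ge ?measure0// bnd_simp -leNgt ltW.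
  rewrite half_line_diff !measureD//; try exact: measurable_itv;
    rewrite ?ltey_eq ?fin_num_measure//; try exact: measurable_itv.
  rewrite setIidr; last by apply: subset_itvl; rewrite bnd_simp.
  by congr (_ - _)%E; exact: E.
- move=> k; rewrite ltey_eq fin_num_measure//; exact: measurable_itv.
Qed.

End half_lines.

Section uniform_variable.
Context (R : realType).

Definition unif : probability (measurableTypeR R) R := uniform_prob (@ltr01 R).

(* Uniformly distributed, with values in the open unit interval. *)
Definition uvar (w : measurableTypeR R) : R := if 0 < w < 1 then w else 2^-1.

Lemma uvar_itv w : 0 < uvar w < 1.
Proof. by rewrite /uvar; case: ifP => // _; rewrite invr_gt0 ltr0n invf_lt1 ?ltr1n. Qed.

Lemma measurable_uvar_le a : measurable [set w | uvar w <= a].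
Proof.
have m1 : measurable_fun setT (fun w : measurableTypeR R => 0 < w < 1).
  by apply: measurable_and; apply: measurable_fun_ltr.
have mU : measurable_fun setT uvar by apply: measurable_fun_ifT.
rewrite (_ : [set w | _] = setT `&` uvar @^-1` `]-oo, a]).
  by apply: mU => //; exact: measurable_itv.
by apply/seteqP; split => w; rewrite /= in_itv/= => // -[].
Qed.

Lemma unifE (A : set (measurableTypeR R)) : measurable A ->
  unif A = lebesgue_measure (A `&` `[0, 1]%classic).
Proof.
move=> mA; rewrite /unif /= /uniform_prob integral_uniform_pdf.
rewrite (eq_integral (fun=> 1%:E)); last first.
  by move=> x; rewrite inE/= => -[_]; rewrite in_itv/= /uniform_pdf => ->; rewrite subr0 invr1.
rewrite integral_cst ?mul1e//; apply: measurableI => //; exact: measurable_itv.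
Qed.

Lemma unif_uvar_le (a : R) : 0 <= a <= 1 -> unif [set w | uvar w <= a] = a%:E.
Proof.
move=> /andP[a0 a1]; rewrite unifE; last exact: measurable_uvar_le.
set S := _ `&` _.
have mI (i : interval R) : measurable ([set` i] : set (measurableTypeR R)) by exact: measurable_itv.
have mS : measurable S by apply: measurableI => //; exact: measurable_uvar_le.
have litv (x y : R) (bx by' : bool) : x <= y ->
    lebesgue_measure [set` Interval (BSide bx x) (BSide by' y)] = (y - x)%:E.
  move=> xy; rewrite lebesgue_measure_itv/= lte_fin; case: ltP => // yx.
  by rewrite (@le_anti _ _ x y) ?subrr// xy yx.
move: a1; rewrite le_eqVlt => /predU1P[a1|a1].
  rewrite (_ : S = `[0, 1]%classic) ?litv ?ler01// ?subr0 ?a1//.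
  apply/seteqP; split => [w []//|w w01]; split => //=; rewrite a1 ltW//.
  by have /andP[] := uvar_itv w.
apply/eqP; rewrite eq_le; apply/andP; split.
  (* The point 1 is added because [uvar] takes the value [2^-1] there. *)
  apply: (@le_trans _ _ (lebesgue_measure (`[0, a]%classic `|` `[1, 1]%classic))).
    apply: le_measure; rewrite ?inE//; first exact: measurableU.
    move=> w [/= wa]; rewrite !in_itv/= => /andP[w0 w1]; rewrite w0 w1 /= andbT.
    have [w1'|] := ltP w 1; [left|by right].
    move: w0; rewrite le_eqVlt => /predU1P[<-//|w0].
    by move: wa; rewrite /uvar w0 w1'.
  apply: le_trans (measureU2 _ _ _) _ => //.
  by rewrite /= !litv// subrr adde0 subr0.
rewrite -[a in a%:E]subr0 -(litv 0 a false false)//.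
apply: le_measure; rewrite ?inE//.
move=> w; rewrite /= !in_itv/= => /andP[w0 wa]; split; last by rewrite /= in_itv/= (ltW w0) (le_trans wa)// ltW.
by rewrite /= /uvar w0 (le_lt_trans wa).
Qed.

End uniform_variable.

Section quantile.
Context (R : realType) (mu : probability (measurableTypeR R) R).

Let measurable_idTR :
  @measurable_fun _ _ (measurableTypeR R) R setT (fun x : measurableTypeR R => x : R).
Proof. exact: (@measurable_id _ (measurableTypeR R) setT). Qed.

Let idTR : {RV mu >-> R} := mfun_Sub (mem_set measurable_idTR).

Definition distr_fun (s : R) : R := fine (mu `]-oo, s]%classic).

Lemma distr_funE s : mu `]-oo, s]%classic = (distr_fun s)%:E.
Proof. by rewrite fineK// fin_num_measure//; exact: measurable_itv. Qed.

Let cdfE s : cdf idTR s = (distr_fun s)%:E.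
Proof. by rewrite -distr_funE. Qed.

Lemma distr_fun_mono s t : s <= t -> distr_fun s <= distr_fun t.
Proof. by move=> st; rewrite -lee_fin -!cdfE; exact: cdf_nondecreasing. Qed.

Lemma distr_fun_itv s : 0 <= distr_fun s <= 1.
Proof. by rewrite -!lee_fin -cdfE cdf_ge0 cdf_le1. Qed.

Lemma distr_fun_right s u : (forall e, 0 < e -> u <= distr_fun (s + e)) -> u <= distr_fun s.
Proof.
move=> H.
have rc : distr_fun t @[t --> s^'+] --> distr_fun s.
  by apply: fine_cvg; rewrite -cdfE; exact: (@cdf_right_continuous _ _ _ mu idTR s).
apply: (cvgr_to_ge rc); near=> t.
have st : s < t by near: t; exact: nbhs_right_gt.
by rewrite -[t](subrKC s); apply: H; rewrite subr_gt0.
Unshelve. all: by end_near. Qed.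

Definition quantile (u : R) : R := inf [set s | u <= distr_fun s].

(** The Galois connection between quantile and distribution functions. The condition on [u] makes
    the set nonempty and bounded below, and right continuity makes the infimum attained. *)
Lemma quantile_le u s : 0 < u < 1 -> (quantile u <= s) = (u <= distr_fun s).
Proof.
move=> /andP[u0 u1].
have [lo lolt] : exists lo, distr_fun lo < u.
  have h : distr_fun @ -oo --> (0 : R) by exact: (fine_cvg (cvg_cdfNy0 idTR)).
  have /filter_ex[lo] : \forall t \near -oo, distr_fun t < u by exact: (cvgr_lt 0).
  by exists lo.
have [hi hige] : exists hi, u <= distr_fun hi.
  have h : distr_fun @ +oo --> (1 : R) by exact: (fine_cvg (cvg_cdfy1 idTR)).
  have /filter_ex[hi] : \forall t \near +oo, u < distr_fun t by exact: (cvgr_gt 1).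
  by move=> /ltW; exists hi.
have hinf : has_inf [set s | u <= distr_fun s].
  split; first by exists hi.
  exists lo => r ur; rewrite leNgt; apply/negP => rlo.
  by have := le_lt_trans (le_trans ur (distr_fun_mono (ltW rlo))) lolt; rewrite ltxx.
apply/idP/idP => [qs|us]; last by apply: ge_inf => //; exact: hinf.2.
apply: distr_fun_right => e e0.
have [r ur] := inf_adherent e0 hinf; rewrite -/(quantile u) => rq.
by apply: le_trans ur (distr_fun_mono _); apply: le_trans (ltW rq) _; rewrite lerD2r.
Qed.

Definition quantile_var (w : measurableTypeR R) : R := quantile (uvar w).

Lemma quantile_var_le s : [set w | quantile_var w <= s] = [set w | uvar w <= distr_fun s].
Proof. by apply/seteqP; split => w /=; rewrite quantile_le// uvar_itv. Qed.

Lemma measurable_quantile_var : measurable_fun setT quantile_var.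
Proof. by apply: measurable_sublevel => a; rewrite quantile_var_le; exact: measurable_uvar_le. Qed.

Lemma has_law_quantile : has_law (unif R) quantile_var mu.
Proof.
pose X : {mfun measurableTypeR R >-> measurableTypeR R} := @mfun_Sub _ _
  (measurableTypeR R) (measurableTypeR R) quantile_var (mem_set measurable_quantile_var).
move=> A mA; rewrite -[LHS]/(distribution (unif R) X A).
apply: (@measure_half_line_unique R (distribution (unif R) X) mu) => // a;
  rewrite distr_funE /= /distribution /pushforward.
rewrite (_ : X @^-1` _ = [set w | quantile_var w <= a]); last first.
  by apply/seteqP; split => w; rewrite /= in_itv.
by rewrite quantile_var_le unif_uvar_le// distr_fun_itv.
Qed.

Lemma quantile_mono u v : 0 < u -> u <= v -> v < 1 -> quantile u <= quantile v.
Proof.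
move=> u0 uv v1; rewrite quantile_le ?u0 ?(le_lt_trans uv)//.
have v01 : 0 < v < 1 by rewrite v1 (lt_le_trans u0).
by apply: le_trans uv _; rewrite -quantile_le.
Qed.

End quantile.

(** All sublevel sets involved are sublevel sets of the single variable [uvar]. *)
Lemma comonotone_quantile (R : realType) (mu nu : probability (measurableTypeR R) R) :
  comonotone (quantile_var mu) (quantile_var nu).
Proof.
move=> a b; rewrite !quantile_var_le.
by have [ab|ba] := leP (distr_fun mu a) (distr_fun nu b); [left|right] => w /= /le_trans; apply; rewrite // ltW.
Qed.

(** * The Wasserstein distance on the line *)

Section wasserstein_metric.
Context (R : realType).
Implicit Types mu nu : P2 R.

Notation X_ mu := (quantile_var mu).

Lemma has_law_eqmeas d (Om : measurableType d) (P : probability Om R) (X : Om -> R) mu nu :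
  mu ≡μ nu -> has_law P X nu -> has_law P X mu.
Proof. by move=> mn lX A mA; rewrite lX//; apply/esym; exact: mn. Qed.

Lemma quantile_energy mu : finite_energy (unif R) (X_ mu).
Proof. exact: has_law_finite_energy (@measurable_quantile_var _ mu) (has_law_quantile mu). Qed.

Lemma moment2_quantile mu : moment2 mu = l2norm (unif R) (X_ mu) ^+ 2.
Proof. exact: has_law_moment2 (@measurable_quantile_var _ mu) (has_law_quantile mu). Qed.

(** All measures live on the single space [unif R], so [W2] inherits its properties from an L2
    norm. *)
Lemma W2E mu nu : W2 mu nu = l2norm (unif R) (fun w => X_ mu w - X_ nu w).
Proof.
apply: W2_comonotone; [exact: measurable_quantile_var|exact: measurable_quantile_var
  |exact: has_law_quantile|exact: has_law_quantile|exact: comonotone_quantile].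
Qed.

Lemma W2_ge0 mu nu : 0 <= W2 mu nu. Proof. exact: sqrtr_ge0. Qed.

Lemma W2_sym mu nu : W2 mu nu = W2 nu mu.
Proof.
rewrite !W2E -l2normN; congr (l2norm _ _).
by apply/funext => w; rewrite opprB.
Qed.

Lemma W2_refl mu : W2 mu mu = 0.
Proof.
rewrite W2E /l2norm; under eq_integral do rewrite subrr expr0n/=.
by rewrite integral0 sqrtr0.
Qed.

Lemma W2_triangle nu mu rho : W2 mu rho <= W2 mu nu + W2 nu rho.
Proof.
rewrite !W2E (_ : (fun w => X_ mu w - X_ rho w) =
    fun w => (X_ mu w - X_ nu w) + (X_ nu w - X_ rho w)); last first.
  by apply/funext => w; rewrite addrA subrK.
by apply: l2norm_triangle; apply: finite_energyB; exact: quantile_energy.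
Qed.

Lemma moment2_le mu nu : moment2 nu <= (Num.sqrt (moment2 mu) + W2 mu nu) ^+ 2.
Proof.
rewrite !moment2_quantile sqrtr_sqr ger0_norm ?l2norm_ge0//.
rewrite ler_sqr ?nnegrE ?addr_ge0 ?l2norm_ge0 ?W2_ge0// W2_sym W2E.
rewrite (_ : X_ nu = fun w => X_ mu w + (X_ nu w - X_ mu w)); last first.
  by apply/funext => w; rewrite subrKC.
under [in X in _ <= _ + X]eq_fun do rewrite subrKC.
apply: l2norm_triangle; first exact: quantile_energy.
by apply: finite_energyB; exact: quantile_energy.
Qed.

End wasserstein_metric.

(** * Empirical measures as step functions *)

Section step_variables.
Context (R : realType) (n : nat).
Let K : R := n.+1%:R.
Let K0 : 0 < K. Proof. by rewrite ltr0n. Qed.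

Definition cell (i : nat) : set (measurableTypeR R) :=
  [set w | i%:R / K < uvar w /\ uvar w <= i.+1%:R / K].

Lemma cell_grid (i : nat) : (i <= n.+1)%N -> 0 <= i%:R / K <= 1.
Proof. by move=> iK; rewrite divr_ge0 ?(ltW K0)//= ler_pdivrMr// mul1r ler_nat. Qed.

Let cellE i : cell i = [set w | uvar w <= i.+1%:R / K] `\` [set w | uvar w <= i%:R / K].
Proof.
apply/seteqP; split => w; first by move=> [a b]; split => //=; rewrite leNgt a.
by move=> [a /negP]; rewrite -ltNge => b; split.
Qed.

Lemma measurable_cell i : measurable (cell i).
Proof. by rewrite cellE; apply: measurableD; exact: measurable_uvar_le. Qed.

Lemma unif_cell i : (i < n.+1)%N -> unif R (cell i) = K^-1%:E.
Proof.
move=> iK; rewrite cellE measureD; [|exact: measurable_uvar_le|exact: measurable_uvar_le|].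
  rewrite setIidr; last first.
    move=> w /= /le_trans; apply; by rewrite ler_pM2r ?invr_gt0// ler_nat.
  transitivity ((i.+1%:R / K)%:E - (i%:R / K)%:E)%E.
    by congr (_ - _)%E; apply: unif_uvar_le; apply: cell_grid => //; exact: ltnW.
  by rewrite -EFinB -mulrBl -natr1 addrAC subrr add0r mul1r.
by rewrite ltey_eq fin_num_measure//; exact: measurable_uvar_le.
Qed.

Lemma cell_exists w : exists i : 'I_n.+1, cell i w.
Proof.
have /andP[u0 u1] := uvar_itv w.
have ex : exists j, uvar w <= j%:R / K by exists n.+1; rewrite divff ?gt_eqF// ltW.
case: (ex_minnP ex) => -[|i]; first by rewrite mul0r leNgt u0.
move=> ui imin; have iK : (i < n.+1)%N by apply: imin; rewrite divff ?gt_eqF// ltW.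
exists (Ordinal iK); split => //=; rewrite ltNge; apply/negP => /imin.
by rewrite ltnn.
Qed.

Lemma cell_unique w i j : cell i w -> cell j w -> i = j.
Proof.
suff le a b : cell a w -> cell b w -> (a <= b)%N.
  by move=> ci cj; apply/eqP; rewrite eqn_leq !le.
move=> [a1 _] [_ b2]; have := lt_le_trans a1 b2.
by rewrite ltr_pM2r ?invr_gt0// ltr_nat ltnS.
Qed.

(** For a nondecreasing row this is the quantile variable of the empirical measure. *)
Definition step_var (x : 'rV[R]_n.+1) (w : measurableTypeR R) : R :=
  \sum_(i < n.+1) x ord0 i * \1_(cell i) w.

Lemma step_varE (x : 'rV[R]_n.+1) (i : 'I_n.+1) w : cell i w -> step_var x w = x ord0 i.
Proof.
move=> ci; rewrite /step_var (bigD1 i)//= indicE mem_set// mulr1 big1 ?addr0// => j ji.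
rewrite indicE memNset ?mulr0// => /(cell_unique ci) /val_inj ij.
by rewrite ij eqxx in ji.
Qed.

Lemma measurable_step_var x : measurable_fun setT (step_var x).
Proof.
apply: measurable_sum => i; apply: measurable_funM => //; apply: measurable_indic.
exact: measurable_cell.
Qed.

Lemma integral_step_var (x : 'rV[R]_n.+1) : (forall i, 0 <= x ord0 i) ->
  (\int[unif R]_w (step_var x w)%:E = (K^-1 * \sum_i x ord0 i)%:E)%E.
Proof.
move=> x0; rewrite /step_var; under eq_integral do rewrite -sumEFin.
rewrite ge0_integral_sum//; last 2 first.
- move=> i; apply/measurable_EFinP; apply: measurable_funM => //.
  by apply: measurable_indic; exact: measurable_cell.
- by move=> i w _; rewrite lee_fin mulr_ge0.
rewrite mulr_sumr -sumEFin; apply: eq_bigr => i _.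
under eq_integral do rewrite EFinM.
rewrite ge0_integralZl//; last 2 first.
- by apply/measurable_EFinP; apply: measurable_indic; exact: measurable_cell.
- by rewrite lee_fin.
rewrite integral_indic//; last exact: measurable_cell.
rewrite setIT; apply: (etrans (congr1 (fun a => ((x ord0 i)%:E * a)%E) (unif_cell (ltn_ord i)))).
by rewrite -EFinM mulrC.
Qed.

Lemma has_law_step_var x : has_law (unif R) (step_var x) (empirical x).
Proof.
move=> A mA.
have mS : measurable (step_var x @^-1` A).
  by rewrite -[X in measurable X]setTI; exact: measurable_step_var.
pose y : 'rV[R]_n.+1 := \row_i \1_A (x ord0 i).
have yE w : \1_(step_var x @^-1` A) w = step_var y w.
  have [i ci] := cell_exists w; rewrite (step_varE y ci) mxE !indicE.
  by congr ((_ : bool)%:R); apply/idP/idP; rewrite !inE /= (step_varE x ci).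
transitivity (\int[unif R]_w (step_var y w)%:E)%E.
  under eq_integral do rewrite -yE.
  by rewrite integral_indic// setIT.
rewrite integral_step_var; last by move=> i; rewrite mxE.
rewrite EFinM; apply/esym; apply: (etrans (empirical_measureE x A)); congr (_ * _)%E.
by rewrite -sumEFin; apply: eq_bigr => i _; rewrite mxE diracE indicE.
Qed.

Lemma step_var_energy x : l2norm (unif R) (step_var x) = Num.sqrt (msq x).
Proof.
pose y : 'rV[R]_n.+1 := \row_i x ord0 i ^+ 2.
rewrite /l2norm (_ : (fun w => _) = fun w => (step_var y w)%:E).
  rewrite integral_step_var; last by move=> i; rewrite mxE sqr_ge0.
  by congr (Num.sqrt (_ * _)); apply: eq_bigr => i _; rewrite mxE.
apply/funext => w; have [i ci] := cell_exists w.
by rewrite !(step_varE _ ci) mxE.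
Qed.

Definition nondecreasing_row (x : 'rV[R]_n.+1) :=
  forall i j : 'I_n.+1, (i <= j)%N -> x ord0 i <= x ord0 j.

Lemma comonotone_step x y : nondecreasing_row x -> nondecreasing_row y ->
  comonotone (step_var x) (step_var y).
Proof.
move=> xm ym a b.
have [H|] := pselect (forall i, x ord0 i <= a -> y ord0 i <= b).
  left => w /=; have [i ci] := cell_exists w.
  by rewrite !(step_varE _ ci); exact: H.
move=> /existsNP[i /not_implyP[xa /negP]]; rewrite -ltNge => yb; right => w /=.
have [j cj] := cell_exists w; rewrite !(step_varE _ cj) => yj.
have [ij|ji] := leqP i j; last by apply: le_trans xa; apply: xm; exact: ltnW.
by have := lt_le_trans yb (le_trans (ym _ _ ij) yj); rewrite ltxx.
Qed.

Lemma sorted_representative (x : 'rV[R]_n.+1) : exists2 p : 'S_n.+1,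
  nondecreasing_row (colsub p x) & empirical x ≡μ empirical (colsub p x).
Proof.
pose tx := [tuple x ord0 i | i < n.+1].
have sz : size (sort <=%R tx) == n.+1 by rewrite size_sort size_tuple.
have /tuple_permP[p E] : perm_eq (Tuple sz) tx by rewrite perm_sort.
exists p; last exact/empirical_balanced/balanced_perm.
have pE i : colsub p x ord0 i = nth 0 (sort <=%R tx) i.
  have -> : nth 0 (sort <=%R tx) i = tnth [tuple tnth tx (p i) | i < n.+1] i.
    by rewrite (tnth_nth 0) -E.
  by rewrite !tnth_mktuple mxE.
move=> i j ij; rewrite !pE; apply: sorted_leq_nth => //.
- exact: le_trans.
- by apply: sort_sorted; exact: le_total.
- by rewrite inE (eqP sz).
- by rewrite inE (eqP sz).
Qed.

Lemma W2_empirical_sorted (mu nu : P2 R) x y :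
  nondecreasing_row x -> nondecreasing_row y ->
  mu ≡μ empirical x -> nu ≡μ empirical y -> W2 mu nu = Num.sqrt (dsq x y).
Proof.
move=> xm ym mux nuy.
rewrite (W2_comonotone (measurable_step_var x) (measurable_step_var y)
  (has_law_eqmeas mux (has_law_step_var x)) (has_law_eqmeas nuy (has_law_step_var y))
  (comonotone_step xm ym)).
rewrite -step_var_energy; congr (l2norm _ _); apply/funext => w.
by have [i ci] := cell_exists w; rewrite !(step_varE _ ci) !mxE.
Qed.

End step_variables.

Lemma empirical_pair (R : realType) (mu nu : P2 R) : is_empirical mu -> is_empirical nu ->
  exists n (x y : 'rV[R]_n.+1), [/\ mu ≡μ empirical x, nu ≡μ empirical y &
    W2 mu nu = Num.sqrt (dsq x y)].
Proof.
move=> [n [x mux]] [m [y nuy]].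
have [k [phi [psi [bphi bpsi]]]] := common_refinement R n m.
have [p px pE] := sorted_representative (colsub phi x).
have [q qy qE] := sorted_representative (colsub psi y).
have mux' : mu ≡μ empirical (colsub p (colsub phi x)).
  by move=> A mA; rewrite mux// (empirical_balanced x bphi)// pE.
have nuy' : nu ≡μ empirical (colsub q (colsub psi y)).
  by move=> A mA; rewrite nuy// (empirical_balanced y bpsi)// qE.
exists k, (colsub p (colsub phi x)), (colsub q (colsub psi y)); split => //.
exact: W2_empirical_sorted px qy mux' nuy'.
Qed.

(** * Density of the empirical measures *)

Section density.
Context (R : realType) (mu : P2 R).
Notation X := (quantile_var mu).

Definition clamp (M y : R) : R := Num.max (- M) (Num.min M y).

Lemma clampE M y : `|y| <= M -> clamp M y = y.
Proof.
rewrite ler_norml => /andP[y1 y2].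
by rewrite /clamp min_r// max_r.
Qed.

Lemma clamp_itv M y : 0 <= M -> - M <= clamp M y <= M.
Proof. by move=> M0; rewrite /clamp le_max lexx/= ge_max ge_min lexx/= andbT (le_trans _ M0)// oppr_le0. Qed.

Lemma clamp_mono M y z : y <= z -> clamp M y <= clamp M z.
Proof. by move=> yz; rewrite /clamp ge_max !le_max lexx/= le_min !ge_min lexx/= yz !orbT. Qed.

Lemma clamp_norm M y : 0 <= M -> `|clamp M y| <= `|y| /\ `|y - clamp M y| <= `|y|.
Proof.
move=> M0; have := ler_norm y; have := ler_norm (- y); rewrite normrN !ler_norml => h1 h2.
by rewrite /clamp /Num.max /Num.min; case: (ltP M y) => ?; case: ltP => ?; split; lra.
Qed.

Lemma measurable_clamp M : measurable_fun setT (fun w => clamp M (X w)).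
Proof.
apply: measurable_maxr => //; apply: measurable_minr => //.
exact: measurable_quantile_var.
Qed.

Lemma clamp_cvg e : 0 < e -> exists2 M, 0 <= M &
  l2norm (unif R) (fun w => X w - clamp M (X w)) < e.
Proof.
move=> e0; have [mX fX] := quantile_energy mu.
pose F (k : nat) := (\int[unif R]_w ((X w - clamp k%:R (X w)) ^+ 2)%:E)%E.
have mD k : measurable_fun setT (fun w => X w - clamp k%:R (X w)).
  by apply: measurable_funB => //; exact: measurable_clamp.
have F0 : F @ \oo --> 0%E.
  rewrite -(integral0 (unif R) setT).
  apply: (@dominated_cvg _ _ _ (unif R) _ measurableT _ _ (fun w => (X w ^+ 2)%:E)) => //.
  - by move=> k; apply/measurable_EFinP; exact: measurable_funX.
  - move=> w _; apply: cvg_near_cst; near=> k; rewrite clampE ?subrr ?expr0n//.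
    by near: k; exact: nbhs_infty_ger.
  - apply/integrableP; split; first by apply/measurable_EFinP; exact: measurable_funX.
    by under eq_integral do rewrite /= ger0_norm ?sqr_ge0//.
  - move=> k w _; rewrite lee_fin ger0_norm ?sqr_ge0// -real_normK ?num_real//.
    by rewrite -[leRHS]real_normK ?num_real// ler_sqr ?nnegrE//; have [] := clamp_norm (X w) (ler0n R k).
have [k Fk] : exists k, (F k < (e ^+ 2)%:E)%E.
  have : \forall k \near \oo, (F k < (e ^+ 2)%:E)%E.
    have U : nbhs (0 : \bar R)%E [set u | (u < (e ^+ 2)%:E)%E].
      by apply: (@open_ereal_lt' R 0%E); rewrite lte_fin exprn_gt0.
    exact: (F0 _ U).
  by move=> /filter_ex[k]; exists k.
exists k%:R => //; rewrite -(ltr_pXn2r (n := 2)) ?nnegrE ?l2norm_ge0 ?(ltW e0)//.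
rewrite l2norm_sqr -lte_fin fineK// ge0_fin_numE ?energy_ge0//.
by rewrite (lt_trans Fk)// ltry.
Unshelve. all: by end_near. Qed.

(** The clamped quantile function is monotone with values in [[-M, M]]. On each cell the squared
    error is at most [2 * M] times the increment of [g], and the increments telescope to [2 * M]. *)
Lemma clamp_step M n : 0 <= M -> exists z : 'rV[R]_n.+1,
  l2norm (unif R) (fun w => clamp M (X w) - step_var z w) ^+ 2 <= 4 * M ^+ 2 / n.+1%:R.
Proof.
move=> M0; pose K : R := n.+1%:R; have K0 : 0 < K by rewrite ltr0n.
(* The values at the two ends are set to [- M] and [M] by hand, [quantile] being meaningful for
   levels strictly between 0 and 1. *)
pose g (i : nat) : R := if i == 0 then - M else if (i <= n)%N then clamp M (quantile mu (i%:R / K)) else M.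
have gM i : - M <= g i <= M.
  rewrite /g; case: ifP => _; first by rewrite lexx ge0_cp.
  by case: ifP => _; [exact: clamp_itv|rewrite lexx ge0_cp].
have gX i w : cell n i w -> (i < n.+1)%N -> g i <= clamp M (X w) <= g i.+1.
  move=> [ui iu] iK; have /andP[u0 u1] := uvar_itv w; apply/andP; split.
    rewrite /g; case: ifP => [_|i0]; first by have /andP[] := clamp_itv (X w) M0.
    rewrite -ltnS iK; apply: clamp_mono; apply: quantile_mono => //; last exact: ltW.
    by rewrite divr_gt0// ltr0n lt0n i0.
  rewrite /g /=; case: ifP => [iN|_]; last by have /andP[] := clamp_itv (X w) M0.
  apply: clamp_mono; apply: quantile_mono => //.
  by rewrite ltr_pdivrMr// mul1r ltr_nat ltnS.
pose z : 'rV[R]_n.+1 := \row_i g i; exists z.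
pose y : 'rV[R]_n.+1 := \row_i (2 * M * (g i.+1 - g i)).
have gS (i : 'I_n.+1) : g i <= g i.+1.
  (* The midpoint of the cell, where [uvar] is the identity, serves as a witness between the two
     values of [g]. *)
  pose w : measurableTypeR R := (i%:R + 2^-1) / K.
  have i0 : 0 <= i%:R :> R by exact: ler0n.
  have iK : i%:R + 1 <= K by rewrite natr1 ler_nat.
  have uw : uvar w = w.
    by rewrite /uvar ifT// /w divr_gt0//= ?ltr_pdivrMr ?mul1r//; lra.
  have /andP[g1 g2] : g i <= clamp M (X w) <= g i.+1.
    have r1 : i%:R / K < (i%:R + 2^-1) / K by rewrite ltr_pM2r ?invr_gt0//; lra.
    have r2 : (i%:R + 2^-1) / K <= i.+1%:R / K.
      have -> : i.+1%:R = i%:R + 1 :> R by rewrite natr1.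
      by rewrite ler_pM2r ?invr_gt0//; lra.
    by apply: gX => //; rewrite /cell /= uw.
  exact: le_trans g1 g2.
have M2 : 0 <= 2 * M by rewrite mulr_ge0.
have y0 i : 0 <= y ord0 i by rewrite mxE mulr_ge0// subr_ge0.
have mD : measurable_fun setT (fun w => clamp M (X w) - step_var z w).
  by apply: measurable_funB; [exact: measurable_clamp|exact: measurable_step_var].
have le : (\int[unif R]_w ((clamp M (X w) - step_var z w) ^+ 2)%:E <=
    (4 * M ^+ 2 / K)%:E)%E.
  apply: (@le_trans _ _ (\int[unif R]_w (step_var y w)%:E)%E).
    apply: ge0_le_integral => //.
    - by move=> w _; rewrite lee_fin sqr_ge0.
    - by apply/measurable_EFinP; exact: measurable_funX.
    - by apply/measurable_EFinP; exact: measurable_step_var.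
    - move=> w _; have [i ci] := cell_exists n w.
      rewrite !(step_varE _ ci) !mxE lee_fin.
      have /andP[g1 g2] := gX _ _ ci (ltn_ord i).
      have /andP[a1 a2] := clamp_itv (X w) M0; have /andP[b1 b2] := gM i.
      set a := clamp M (X w) in g1 g2 a1 a2 *.
      rewrite expr2; apply: ler_pM; rewrite ?subr_ge0//; first lra.
      by rewrite lerD2r.
  rewrite integral_step_var// lee_fin.
  rewrite (eq_bigr (fun i : 'I_n.+1 => 2 * M * (g i.+1 - g i))); last by move=> i _; rewrite mxE.
  rewrite -mulr_sumr -(big_mkord xpredT (fun i => g i.+1 - g i)) telescope_sumr//.
  by rewrite /g /= ltnn mulrC ler_pM2r ?invr_gt0//; rewrite expr2; lra.
rewrite l2norm_sqr -lee_fin fineK// ge0_fin_numE ?energy_ge0//.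
exact: le_lt_trans le (ltry _).
Qed.

Lemma empirical_dense e : 0 < e -> exists2 nu, is_empirical nu & W2 mu nu < e.
Proof.
move=> e0; have e2 : 0 < e / 2 by rewrite divr_gt0.
have [M M0 XM] := clamp_cvg e2.
pose n := Num.truncn (4 * M ^+ 2 / (e / 2) ^+ 2).
have [z Hz] := clamp_step n M0.
exists (empirical z); first by exists n, z.
have mX := @measurable_quantile_var _ mu; have mZ := measurable_step_var z.
have mM := measurable_clamp M.
have fX := quantile_energy mu.
have fZ := has_law_finite_energy mZ (has_law_step_var z).
apply: le_lt_trans (W2_le mX mZ (has_law_quantile mu) (has_law_step_var z)) _.
have fM : finite_energy (unif R) (fun w => clamp M (X w)).
  split => //; apply: le_lt_trans fX.2; apply: ge0_le_integral => //.
  - by move=> w _; rewrite lee_fin sqr_ge0.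
  - by apply/measurable_EFinP; exact: measurable_funX.
  - by apply/measurable_EFinP; exact: measurable_funX.
  - move=> w _; rewrite lee_fin -real_normK ?num_real// -[leRHS]real_normK ?num_real//.
    by rewrite ler_sqr ?nnegrE//; have [] := clamp_norm (X w) M0.
rewrite (_ : (fun w => _) = fun w => (X w - clamp M (X w)) + (clamp M (X w) - step_var z w)).
  apply: le_lt_trans (l2norm_triangle (finite_energyB fX fM) (finite_energyB fM fZ)) _.
  rewrite [ltRHS](splitr e); apply: ltrD => //.
  rewrite -(ltr_pXn2r (n := 2)) ?nnegrE ?l2norm_ge0 ?(ltW e2)//.
  apply: le_lt_trans Hz _.
  have swap (a b c : R) : 0 < b -> 0 < c -> a / b < c -> a / c < b.
    by move=> b0 c0; rewrite !ltr_pdivrMr// mulrC.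
  apply: swap; rewrite ?exprn_gt0// ?ltr0n//; exact: truncnS_gt.
by apply/funext => w; rewrite addrA subrK.
Qed.

End density.

(** * Extension of the value function *)

Section extension.
Context (R : realType) (V : P2 R -> R) (A B : R).
Hypotheses (A_ge0 : 0 <= A) (B_ge0 : 0 <= B).
Hypothesis V_lip : forall mu nu : P2 R, is_empirical mu -> is_empirical nu ->
  `|V mu - V nu| <= (A * (1 + (moment2 mu + moment2 nu) / 2) + B) * W2 mu nu.
Implicit Types mu nu e : P2 R.

(** The Lipschitz constant of [V] among empirical measures at distance at most [r] from [mu];
    [moment2_le] bounds their second moments. *)
Let lip mu (r : R) : R := A * (1 + (Num.sqrt (moment2 mu) + r) ^+ 2) + B.

Let lip_ge0 mu r : 0 <= lip mu r.
Proof. by rewrite addr_ge0// mulr_ge0// addr_ge0// sqr_ge0. Qed.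

Let V_local mu r e1 e2 : is_empirical e1 -> is_empirical e2 ->
  W2 mu e1 <= r -> W2 mu e2 <= r -> `|V e1 - V e2| <= lip mu r * W2 e1 e2.
Proof.
move=> E1 E2 r1 r2; apply: le_trans (V_lip E1 E2) _; rewrite ler_wpM2r ?W2_ge0//.
rewrite lerD2r ler_wpM2l// lerD2l.
have bnd e : W2 mu e <= r -> moment2 e <= (Num.sqrt (moment2 mu) + r) ^+ 2.
  move=> er; apply: le_trans (moment2_le mu e) _.
  by rewrite ler_sqr ?nnegrE ?addr_ge0 ?sqrtr_ge0 ?(le_trans _ er) ?W2_ge0// lerD2l.
have := bnd _ r1; have := bnd _ r2; lra.
Qed.

(* McShane's formula, with the Lipschitz constant of the unit ball around [mu]. *)
Let candidates mu : set R :=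
  [set V e + lip mu 1 * W2 mu e | e in [set e | is_empirical e /\ W2 mu e <= 1]].

Let Vbar mu : R := inf (candidates mu).

(** With [mu] itself as [e] this is the extension property; with [e] arbitrarily close to [mu] it
    carries the Lipschitz bound from [V] to [Vbar]. *)
Let Vbar_near mu e : is_empirical e -> W2 mu e <= 1 ->
  `|Vbar mu - V e| <= lip mu 1 * W2 mu e.
Proof.
move=> Ee e1.
have lb : lbound (candidates mu) (V e - lip mu 1 * W2 mu e).
  move=> _ [e' [Ee' e1'] <-].
  have := V_local Ee Ee' e1 e1'; rewrite ler_norml => /andP[_ h].
  have tri : W2 e e' <= W2 mu e + W2 mu e' by rewrite (W2_sym mu e) W2_triangle.
  have := ler_wpM2l (lip_ge0 mu 1) tri; rewrite mulrDr; lra.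
have in_e : candidates mu (V e + lip mu 1 * W2 mu e) by exists e.
rewrite ler_norml; apply/andP; split.
  rewrite lerBrDl; apply: lb_le_inf; [by exists (V e + lip mu 1 * W2 mu e)|exact: lb].
by rewrite lerBlDl; apply: ge_inf => //; exists (V e - lip mu 1 * W2 mu e).
Qed.

Lemma unique_extension : exists! Vbar : P2 R -> R,
  locally_lipschitz Vbar /\ (forall mu, is_empirical mu -> Vbar mu = V mu).
Proof.
have Vbar_ext mu : is_empirical mu -> Vbar mu = V mu.
  move=> Emu; have := @Vbar_near mu mu Emu; rewrite W2_refl => /(_ ler01).
  by rewrite mulr0 normr_le0 subr_eq0 => /eqP.
have Vbar_lip : locally_lipschitz Vbar.
  move=> mu; exists 1 => //; exists (lip mu 2) => nu1 nu2 d1 d2.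
  apply/ler_addgt0Pr => eta eta0.
  (* [D] collects the coefficients of [d] in the final estimate. The radius 2 allows for
     approximations at distance at most 1 from points of the unit ball around [mu]. *)
  pose D := lip nu1 1 + lip nu2 1 + 2 * lip mu 2 + 1.
  have D0 : 0 < D by rewrite ltr_wpDl// !addr_ge0// mulr_ge0.
  pose d := Num.min 1 (eta / D).
  have d0 : 0 < d by rewrite lt_min ltr01 divr_gt0.
  have d1' : d <= 1 by rewrite ge_min lexx.
  have dD : d * D <= eta by rewrite -ler_pdivlMr// ge_min lexx orbT.
  have [e1 E1 h1] := empirical_dense nu1 d0.
  have [e2 E2 h2] := empirical_dense nu2 d0.
  have n1 := Vbar_near E1 (le_trans (ltW h1) d1').
  have n2 := Vbar_near E2 (le_trans (ltW h2) d1').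
  have m1 : W2 mu e1 <= 2 by apply: le_trans (W2_triangle nu1 _ _) _; lra.
  have m2 : W2 mu e2 <= 2 by apply: le_trans (W2_triangle nu2 _ _) _; lra.
  have n12 := V_local E1 E2 m1 m2.
  have t12 : W2 e1 e2 <= W2 nu1 nu2 + 2 * d.
    apply: le_trans (W2_triangle nu1 _ _) _; rewrite (W2_sym e1).
    have := W2_triangle nu2 nu1 e2; lra.
  have b1 : lip nu1 1 * W2 nu1 e1 <= lip nu1 1 * d by rewrite ler_wpM2l// ltW.
  have b2 : lip nu2 1 * W2 nu2 e2 <= lip nu2 1 * d by rewrite ler_wpM2l// ltW.
  have b12 := ler_wpM2l (lip_ge0 mu 2) t12.
  have DE : d * D = lip nu1 1 * d + lip nu2 1 * d + lip mu 2 * (2 * d) + d.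
    by rewrite /D; ring.
  have tri : `|Vbar nu1 - Vbar nu2| <= `|Vbar nu1 - V e1| + `|V e1 - V e2| + `|Vbar nu2 - V e2|.
    rewrite (_ : Vbar nu1 - Vbar nu2 = (Vbar nu1 - V e1) + (V e1 - V e2) - (Vbar nu2 - V e2)).
      by apply: le_trans (ler_normB _ _) _; rewrite lerD2r ler_normD.
    by ring.
  move: b12; rewrite mulrDr; lra.
exists Vbar; split; first by split.
move=> V' [lV' eV']; apply/funext => mu.
(* Uniqueness: both extensions are compared with their common value at an empirical measure close to
   [mu]. [K1] and [K2] may be negative, hence the absolute values in [D]. *)
have [r1 r10 [K1 lip1]] := Vbar_lip mu; have [r2 r20 [K2 lip2]] := lV' mu.
apply/eqP; rewrite -subr_eq0 -normr_le0; apply/ler_addgt0Pr => eta eta0; rewrite add0r.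
pose D := `|K1| + `|K2| + 1.
have D0 : 0 < D by rewrite ltr_wpDl// addr_ge0.
pose d := Num.min (Num.min r1 r2) (eta / D).
have d0 : 0 < d by rewrite !lt_min r10 r20 divr_gt0.
have dD : d * D <= eta by rewrite -ler_pdivlMr// ge_min lexx orbT.
have [e Ee he] := empirical_dense mu d0.
have e1 : W2 mu e < r1 by apply: lt_le_trans he _; rewrite !ge_min lexx.
have e2 : W2 mu e < r2 by apply: lt_le_trans he _; rewrite !ge_min lexx orbT.
have := lip1 mu e; rewrite W2_refl => /(_ r10 e1) h1.
have := lip2 mu e; rewrite W2_refl => /(_ r20 e2) h2.
have W0 := W2_ge0 mu e.
have k (K : R) : K * W2 mu e <= `|K| * d.
  by apply: le_trans (ler_wpM2r W0 (ler_norm K)) _; rewrite ler_wpM2l// ltW.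
have := k K1; have := k K2.
have -> : Vbar mu - V' mu = (Vbar mu - Vbar e) - (V' mu - V' e).
  by rewrite (eV' e Ee) -(Vbar_ext e Ee); ring.
move=> k2 k1; apply: le_trans (ler_normB _ _) _.
have : d * D = `|K1| * d + `|K2| * d + d by rewrite /D; ring.
lra.
Qed.

End extension.

Lemma moment2_eqmeas (R : realType) (mu nu : P2 R) : mu ≡μ nu -> moment2 mu = moment2 nu.
Proof. by move=> E; rewrite /moment2; congr fine; apply: eq_measure_integral => A mA _; exact: E. Qed.

Theorem theorem2p3 (R : realType) (T lambda sigma : R)
    (f : R -> R -> R -> P2 R -> R) (f_mu : R -> R -> R -> P2 R -> R -> R)
    (L U : R -> R) (CL11 CL10 CL20 CU11 CU10 CU20 C2 Gamma1 Gamma2 : R)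
    (T_gt0 : 0 < T) (lambda_gt0 : 0 < lambda)
    (f_assum : drift_assumption T f f_mu)
    (L_assum : cost_assumption L CL11 CL10 CL20)
    (U_assum : cost_assumption U CU11 CU10 CU20)
    (LU_growth : subquadratic L U)
    (C2_bound : gradient_bound T lambda sigma f L U CL11 CL10 CU11 CU10 C2)
    (hypR : hypothesis_R T lambda f f_mu CL11 CL10 CU11 CU10 Gamma1 Gamma2) :
  let V := lifted_value T lambda sigma f L U in
  let C71 := C2 * (CL11 + CU11 + CL10 + CU10) in
  let C72 := C2 * (CL11 + CU11) / 2 in
  forall t, t \in `[0, T] ->
    (forall mu1 mu2 : P2 R, is_empirical mu1 -> is_empirical mu2 ->
       `|V t mu1 - V t mu2| <=
         C71 * W2 mu1 mu2
         + C72 * (W2 mu1 mu2 ^+ 2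
                  + (moment2 mu1 + moment2 mu2) * W2 mu1 mu2)) /\
    (exists! Vbar : P2 R -> R,
       locally_lipschitz Vbar /\
       (forall mu, is_empirical mu -> Vbar mu = V t mu)).
Proof.
move=> V C71 C72 t t0T.
have [A0 B0] := gradient_constants_ge0 L_assum U_assum C2_bound t0T.
have V_lip mu nu : is_empirical mu -> is_empirical nu -> `|V t mu - V t nu| <=
    (C2 * (CL11 + CU11) * (1 + (moment2 mu + moment2 nu) / 2) + C2 * (CL10 + CU10)) * W2 mu nu.
  move=> Emu Enu; have [n [x [y [mux nuy ->]]]] := empirical_pair Emu Enu.
  rewrite /V (lifted_valueE lambda sigma f_assum L_assum U_assum t0T mux).
  rewrite (lifted_valueE lambda sigma f_assum L_assum U_assum t0T nuy).
  rewrite (moment2_eqmeas mux) (moment2_eqmeas nuy) !moment2_empirical.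
  exact: (value_lipschitz lambda_gt0 f_assum L_assum U_assum C2_bound t0T).
split; last exact: unique_extension V_lip.
move=> mu nu Emu Enu; apply: le_trans (V_lip _ _ Emu Enu) _.
rewrite /C71 /C72; set a := C2 * (CL11 + CU11) in A0 *.
have W0 := W2_ge0 mu nu; set W := W2 mu nu in W0 *.
(* The stated bound exceeds the one obtained by exactly [a / 2 * W ^+ 2]. *)
have : 0 <= a * W ^+ 2 by rewrite mulr_ge0// sqr_ge0.
have -> : C2 * (CL11 + CU11 + CL10 + CU10) = a + C2 * (CL10 + CU10) by rewrite /a; ring.
lra.
Qed.
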